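(* Let $(F_n)_{n\in\mathbb{N}}$ be a sequence of quasi-infinitely divisible distribution functions with spectral pairs $(\gamma_n,G_n)$, $\gamma_n\in\mathbb{R}$, $G_n\in\boldsymbol{V}$, $n\in\mathbb{N}$. Suppose that for some decompositions $$G_n(x)=G_n^+(x)-G_n^-(x),\quad x\in\mathbb{R},\ n\in\mathbb{N},$$ with non-decreasing functions $G_n^+,G_n^-\in\boldsymbol{V}$, one has $$\varlimsup_{n\to\infty}G_n^-(+\infty)=M<\infty$$ with some $M\geqslant 0$. Let $(F_n)_{n\in\mathbb{N}}$ weakly converge to a distribution function $F$. Then $\varlimsup_{n\to\infty}\|G_n\|=B<\infty$ for some $B\geqslant 0$, and $F$ is quasi-infinitely divisible with some spectral pair $(\gamma,G)$, where $\gamma\in\mathbb{R}$ and $G\in\boldsymbol{V}$ with $\|G\|\leqslant B$. Moreover, $\gamma_n\to\gamma$, $G_n\Rightarrow G$ (basic convergence), and $G_n(+\infty)\to G(+\infty)$, $n\to\infty$. Also $B\leqslant G(+\infty)+2M$.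
   Context: $\boldsymbol{V}$ denotes the class of all functions $G:\mathbb{R}\to\mathbb{R}$ of bounded variation on $\mathbb{R}$ that are right-continuous at every point and satisfy $G(-\infty)=0$, where $G(\pm\infty)$ denote the limits at $\pm\infty$. For $G\in\boldsymbol{V}$, $\|G\|$ is the total variation of $G$ on $\mathbb{R}$; integrals $\int_{\mathbb{R}} h\,dG$ are with respect to the finite signed Lebesgue--Stieltjes measure $\mu_G$ with $\mu_G((a,b])=G(b)-G(a)$. A number $\tau>0$ is fixed throughout. A (probability) distribution function $F$ on $\mathbb{R}$ is quasi-infinitely divisible if its characteristic function $f(t)=\int_{\mathbb{R}}e^{itx}\,dF(x)$ has the form $$f(t)=\exp\Bigl\{it\gamma+\int_{\mathbb{R}}\Bigl(e^{itx}-1-\tfrac{it}{\tau}\sin(\tau x)\Bigr)\tfrac{1+x^2}{x^2}\,dG(x)\Bigr\},\quad t\in\mathbb{R},$$ with some $\gamma\in\mathbb{R}$ and $G\in\boldsymbol{V}$ (the integrand at $x=0$ is defined by continuity, i.e. equals $-t^2/2$). The pair $(\gamma,G)$ is uniquely determined by $F$ and is called its spectral pair. (The property does not depend on $\tau$; $\gamma$ depends on $\tau$ but $G$ does not. All spectral pairs are taken with the same fixed $\tau$.) Basic convergence: for $G_n,G\in\boldsymbol{V}$, $(G_n)_{n\in\mathbb{N}}$ converges basically to $G$, written $G_n\Rightarrow G$, $n\to\infty$, if every subsequence of $(G_n)_{n\in\mathbb{N}}$ contains a further subsequence $(G_{n_k})_{k\in\mathbb{N}}$ for which there is an at most countable set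 $D\subset\mathbb{R}$ (depending in general on the choice of the subsequences) such that $G_{n_k}(x_2)-G_{n_k}(x_1)\to G(x_2)-G(x_1)$, $k\to\infty$, for all $x_1,x_2\in\mathbb{R}\setminus D$. Weak convergence of $(F_n)$ to $F$ means $\int_{\mathbb{R}}h\,dF_n\to\int_{\mathbb{R}}h\,dF$ for every bounded continuous $h:\mathbb{R}\to\mathbb{R}$. *)

(* Defs.v *)
From HB Require Import structures.
From mathcomp Require Import all_boot all_order all_algebra.
From mathcomp Require Import all_classical all_reals all_analysis.
From mathcomp Require Import complex.

Set Implicit Arguments.
Unset Strict Implicit.
Unset Printing Implicit Defensive.

Import Order.TTheory GRing.Theory Num.Theory.
Import numFieldNormedType.Exports.

Local Open Scope classical_set_scope.
Local Open Scope ring_scope.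
Local Open Scope complex_scope.

(* Distribution functions on R are the terms of type
   [cumulativeBounded (0 : R) (1 : R)]: non-decreasing, right-continuous, with
   limit 0 at -oo and 1 at +oo; the associated law is
   [lebesgue_stieltjes_measure F]. *)

Section complex_valued.
Context {R : realType}.

Definition expi (x : R) : R[i] := cos x +i* sin x.

Definition expC (z : R[i]) : R[i] := (expR (complex.Re z))%:C * expi (complex.Im z).

Definition Cintegral d (T : measurableType d)
    (mu : {measure set T -> \bar R}) (h : T -> R[i]) : R[i] :=
  (\int[mu]_(x in setT) complex.Re (h x)) +i* (\int[mu]_(x in setT) complex.Im (h x)).

(* The value does not depend on the Hahn decomposition that is chosen. *)
Definition charge_Cintegral d (T : measurableType d)
    (nu : {charge set T -> \bar R}) (h : T -> R[i]) : R[i] :=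
  let nuPN := projT2 (cid (projT2 (cid (Hahn_decomposition nu)))) in
  Cintegral (jordan_pos nuPN) h - Cintegral (jordan_neg nuPN) h.

Definition charfun (F : cumulativeBounded (0 : R) (1 : R)) (t : R) : R[i] :=
  Cintegral (lebesgue_stieltjes_measure F) (fun x => expi (t * x)).

End complex_valued.

Section bounded_variation.
Context {R : realType}.
Implicit Types G : R -> R.

Definition variation_norm G : \bar R :=
  ereal_sup [set v | exists a b : R, a <= b /\ v = total_variation a b G].

Definition classV G : Prop :=
  [/\ (variation_norm G < +oo)%E, right_continuous G & G @ -oo --> (0 : R)].

(* G(+oo); the limit exists when G has bounded variation on R. *)
Definition limy G : R := lim (G @ +oo).

(* For G in V such a charge exists and is unique: it is the signed
   Lebesgue-Stieltjes measure of G. *)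
Definition is_stieltjes_charge G
    (nu : {charge set (measurableTypeR R) -> \bar R}) : Prop :=
  forall a b : R, a <= b -> nu `]a, b]%classic = (G b - G a)%:E.

Definition basic_cvg (G_ : nat -> R -> R) G : Prop :=
  forall phi : nat -> nat, increasing_seq phi ->
  exists2 psi : nat -> nat, increasing_seq psi &
  exists2 D : set R, countable D &
  forall x1 x2 : R, ~ D x1 -> ~ D x2 ->
    (G_ (phi (psi k)) x2 - G_ (phi (psi k)) x1) @[k --> \oo] --> G x2 - G x1.

Definition weak_cvg (F_ : nat -> cumulativeBounded (0 : R) (1 : R))
    (F : cumulativeBounded (0 : R) (1 : R)) : Prop :=
  forall h : R -> R, continuous h -> bounded_fun h ->
    \int[lebesgue_stieltjes_measure (F_ n)]_(x in setT) h x @[n --> \oo] -->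
    \int[lebesgue_stieltjes_measure F]_(x in setT) h x.

End bounded_variation.

Section spectral_pair.
Context {R : realType}.

(* The value at 0 is the limit of the second expression as x tends to 0. *)
Definition spectral_kernel (tau t x : R) : R[i] :=
  if x == 0 then (- (t ^+ 2 / 2))%:C
  else (expi (t * x) - 1 - (t / tau * sin (tau * x))%:C * 'i%C)
       * ((1 + x ^+ 2) / x ^+ 2)%:C.

Definition spectral_pair (tau : R) (F : cumulativeBounded (0 : R) (1 : R))
    (gamma : R) (G : R -> R) : Prop :=
  classV G /\
  exists2 nu, is_stieltjes_charge G nu &
  forall t : R, charfun F t =
    expC ((t * gamma)%:C * 'i%C + charge_Cintegral nu (spectral_kernel tau t)).

End spectral_pair.

(* Main.v *)
Require Import Defs.
From HB Require Import structures.
From mathcomp Require Import all_boot all_order all_algebra.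
From mathcomp Require Import all_classical all_reals all_analysis.
From mathcomp Require Import complex.
From mathcomp Require Import measurable_realfun ring lra.

(** Write the exponent of the n-th characteristic function as r_n(t) + i u_n(t).
    With the nonnegative kernel c(t,x) = (1 - cos tx)(1 + x^2)/x^2 the real part
    is minus the integral of c(t,.) against dG_n, and the second differences of
    r_n and u_n are the integrals of cos(tx) c(s,x) and sin(tx) c(s,x) against
    dG_n: the drift gamma_n and the centering term drop out.

    Bound on the variation. By weak convergence |f_n| is bounded below near 0,
    so the integral of c(s,.) against dG_n is bounded for small s; since the
    masses of the G_n^- are bounded, so are the integrals against dG_n^+. One
    value of s controls the mass of G_n^+ near 0, and an average over s, in which
    1 - cos sx becomes 1 - sinc(hx), controls it away from 0
    ([positive_mass_bounded]). The average comes from the product formula of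
    Viete, sinc(hx) being the infinite product of the cos(hx/2^j)
    ([sint_sinc_le]).

    Convergence of the exponents. The f_n are equicontinuous and converge, hence
    converge locally uniformly; |f_n| is bounded below on compact sets because
    the mass of G_n^+ is bounded. Thus r_n is locally uniformly Cauchy, and so is
    u_n: the cosine of u_n - u_m stays positive, u_n - u_m is continuous and
    vanishes at 0, so no multiple of 2 pi can intervene ([exponents_cauchy]).

    Passage to the limit. Mass of the G_n^+ and G_n^- may escape to infinity, and
    only their difference is controlled there. Equicontinuity of the exponents
    makes the integrals of cos(tx)(1 - sinc(hx)) and sin(tx)(1 - sinc(hx))
    against dG_n small for small h, uniformly in n ([sint_sinc_small]), whereas
    cos(tx) sinc(hx) vanishes at infinity. After Helly selection, vague
    convergence therefore already gives convergence of the Fourier transforms of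
    dG_n along a subsequence ([sint_trig_cvg]), in particular of the total masses.
    The two kernels of the exponent are trigonometric polynomials plus functions
    that vanish at infinity, so gamma_n converges and the limit has the
    exponent built from the limit pair ([exponents_limitE]).

    The exponents determine the pair ([exponents_injective]), so all
    subsequential limits agree and the whole sequence converges. The estimates
    on the norms follow from lower semicontinuity of the variation
    ([variation_norm_lsc]) and from the bound of the norm of G_n by
    G_n(+oo) + 2 G_n^-(+oo). *)

Set Implicit Arguments.
Unset Strict Implicit.
Unset Printing Implicit Defensive.

Import Order.TTheory GRing.Theory Num.Theory.
Import numFieldNormedType.Exports.
Local Open Scope classical_set_scope.
Local Open Scope ring_scope.

(** * Integrals of bounded measurable functions *)

Section bounded_measurable.
Context {R : realType}.
Local Notation T := (measurableTypeR R).
Local Notation fmeas := {finite_measure set T -> \bar R}.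
Implicit Types (h k : R -> R) (mu : fmeas).

(** Every integrand below is of this kind, so that integrability against finite
    measures never has to be discussed separately. *)
Definition bmf h : Prop :=
  measurable_fun [set: T] (h : T -> R) /\ exists C : R, forall x, `|h x| <= C.

Lemma bmf_cst c : bmf (fun=> c).
Proof. by split; [exact: measurable_cst | exists `|c|]. Qed.

Lemma bmfD h k : bmf h -> bmf k -> bmf (fun x => h x + k x).
Proof.
move=> [mh [C hC]] [mk [D kD]]; split; first exact: measurable_funD.
by exists (C + D) => x; rewrite (le_trans (ler_normD _ _))// lerD.
Qed.

Lemma bmfM h k : bmf h -> bmf k -> bmf (fun x => h x * k x).
Proof.
move=> [mh [C hC]] [mk [D kD]]; split; first exact: measurable_funM.
by exists (C * D) => x; rewrite normrM ler_pM.
Qed.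

Lemma bmfN h : bmf h -> bmf (fun x => - h x).
Proof.
move=> bh; have := bmfM (bmf_cst (-1)) bh.
by congr bmf; apply/funext => x; rewrite mulN1r.
Qed.

Lemma bmfB h k : bmf h -> bmf k -> bmf (fun x => h x - k x).
Proof. by move=> bh /bmfN bk; exact: bmfD. Qed.

Lemma bmf_indic (A : set R) : measurable (A : set T) -> bmf (\1_A : R -> R).
Proof.
move=> mA; split; first exact: measurable_indic.
by exists 1 => x; rewrite indicE; case: (_ \in _); rewrite ?normr0 ?normr1.
Qed.

Lemma continuous_bmf h C : continuous h -> (forall x, `|h x| <= C) -> bmf h.
Proof.
by move=> ch hC; split; [exact: continuous_measurable_fun | exists C].
Qed.

Lemma bmf_integrable mu h : bmf h -> mu.-integrable setT (EFin \o h).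
Proof.
move=> [mh [C hC]]; apply: measurable_bounded_integrable => //.
  by rewrite ltey_eq fin_num_measure.
exists C; split; first by rewrite num_real.
  by move=> y Cy x _; apply: le_trans (hC x) _; exact: ltW.
Qed.

Definition mass mu : R := fine (mu setT).

Lemma mass_ge0 mu : 0 <= mass mu.
Proof. exact: fine_ge0. Qed.

Lemma Rintegral_indic mu (A : set R) : measurable (A : set T) ->
  \int[mu]_x (\1_A x : R) = fine (mu A).
Proof. by move=> mA; rewrite /Rintegral integral_indic// setIT. Qed.

Lemma Rintegral_dct mu (h_ : nat -> R -> R) h C :
  (forall n, measurable_fun [set: T] (h_ n : T -> R)) ->
  (forall n x, `|h_ n x| <= C) -> (forall x, h_ n x @[n --> \oo] --> h x) ->
  bmf h /\ \int[mu]_x h_ n x @[n --> \oo] --> \int[mu]_x h x.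
Proof.
move=> mh hC cvh.
have bh : bmf h.
  split; first by apply: (measurable_fun_cvg (h:=h_)) => // x _; exact: cvh.
  by exists C => x; apply: (cvgr_to_le (cvg_norm (cvh x))); exact: nearW.
split => //; apply: fine_cvg; rewrite fineK; last first.
  exact/integrable_fin_num/bmf_integrable.
have := @dominated_convergence _ T R mu setT measurableT
  (fun n x => (h_ n x)%:E) (EFin \o h) (fun=> C%:E).
case => //.
- by move=> n; exact/measurable_EFinP.
- by case: bh => mh' _; exact/measurable_EFinP.
- by apply/aeW => x _; apply: cvg_EFin; [near=> n | exact: cvh].
- exact/(bmf_integrable mu (bmf_cst C)).
- by apply/aeW => x n _; rewrite lee_fin.
Unshelve. all: end_near. Qed.
End bounded_measurable.

(** * Integrals against a difference of two finite measures *)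

Section signed_integral.
Context {R : realType}.
Local Notation T := (measurableTypeR R).
Local Notation fmeas := {finite_measure set T -> \bar R}.
Implicit Types (h k : R -> R) (m p : fmeas).

(** Working with a pair of positive measures instead of a charge keeps the
    decomposition G = G^+ - G^- visible; estimates use only the two masses. *)
Definition sint (m1 m2 : fmeas) h : R := \int[m1]_x h x - \int[m2]_x h x.

Lemma sint_cst (m1 m2 : fmeas) c : sint m1 m2 (fun=> c) = c * (mass m1 - mass m2).
Proof. by rewrite /sint !Rintegral_cst// mulrBr. Qed.

Lemma sintD (m1 m2 : fmeas) h k : bmf h -> bmf k ->
  sint m1 m2 (fun x => h x + k x) = sint m1 m2 h + sint m1 m2 k.
Proof.
move=> bh bk; rewrite /sint !RintegralD//; try exact: bmf_integrable.
ring.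
Qed.

Lemma sintZ (m1 m2 : fmeas) c h : bmf h -> sint m1 m2 (fun x => c * h x) = c * sint m1 m2 h.
Proof.
by move=> bh; rewrite /sint !RintegralZl// ?mulrBr//; exact: bmf_integrable.
Qed.

Lemma sintN (m1 m2 : fmeas) h : bmf h -> sint m1 m2 (fun x => - h x) = - sint m1 m2 h.
Proof.
move=> bh; rewrite -mulN1r -sintZ//.
by congr sint; apply/funext => x; rewrite mulN1r.
Qed.

Lemma sintB (m1 m2 : fmeas) h k : bmf h -> bmf k ->
  sint m1 m2 (fun x => h x - k x) = sint m1 m2 h - sint m1 m2 k.
Proof. by move=> bh bk; rewrite sintD ?sintN//; exact: bmfN. Qed.

Lemma Rintegral_mass_le m h C : bmf h -> (forall x, h x <= C) ->
  \int[m]_x h x <= C * mass m.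
Proof.
move=> bh hC; rewrite -Rintegral_cst//; apply: le_Rintegral => //.
- exact: bmf_integrable.
- exact/bmf_integrable/bmf_cst.
Qed.

Lemma Rintegral_mass_ge m h C : bmf h -> (forall x, C <= h x) ->
  C * mass m <= \int[m]_x h x.
Proof.
move=> bh hC; rewrite -Rintegral_cst//; apply: le_Rintegral => //.
- exact/bmf_integrable/bmf_cst.
- exact: bmf_integrable.
Qed.

Lemma Rintegral_norm_le m h C : bmf h -> (forall x, `|h x| <= C) ->
  `|\int[m]_x h x| <= C * mass m.
Proof.
move=> bh hC; rewrite ler_norml; apply/andP; split.
  by rewrite -mulNr; apply: Rintegral_mass_ge => // x; have := hC x; rewrite ler_norml => /andP[].
by apply: Rintegral_mass_le => // x; have := hC x; rewrite ler_norml => /andP[].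
Qed.

Lemma sint_norm_le (m1 m2 : fmeas) h C : bmf h -> (forall x, `|h x| <= C) ->
  `|sint m1 m2 h| <= C * (mass m1 + mass m2).
Proof.
move=> bh hC; rewrite (le_trans (ler_normB _ _))// mulrDr.
by rewrite lerD// Rintegral_norm_le.
Qed.

Lemma sint_dct (m1 m2 : fmeas) (h_ : nat -> R -> R) h C :
  (forall n, measurable_fun [set: T] (h_ n : T -> R)) ->
  (forall n x, `|h_ n x| <= C) -> (forall x, h_ n x @[n --> \oo] --> h x) ->
  sint m1 m2 (h_ n) @[n --> \oo] --> sint m1 m2 h.
Proof.
move=> mh hC cvh; have [_ c1] := Rintegral_dct m1 mh hC cvh.
by have [_ c2] := Rintegral_dct m2 mh hC cvh; exact: cvgB.
Qed.

Lemma oc_cover : \bigcup_n `]- n%:R, n%:R]%classic = [set: R].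
Proof.
apply/seteqP; split => // x _; exists (Num.bound `|x|) => //=.
have : `|x| < (Num.bound `|x|)%:R by exact: archi_boundP.
by rewrite ltr_norml in_itv/= => /andP[-> /ltW].
Qed.

Lemma measure_eq_ocitv (m p : {measure set T -> \bar R}) :
  (forall a b, m `]a, b]%classic < +oo)%E ->
  (forall a b, a <= b -> m `]a, b]%classic = p `]a, b]%classic) ->
  forall A, measurable (A : set T) -> m A = p A.
Proof.
move=> moo mp A mA.
apply: (@g_sigma_algebra_measure_unique _ R T (@ocitv R) _
  (fun n => `]- n%:R, n%:R]%classic)) => //.
- by move=> X [[a b] _ <-]; exact: measurable_itv.
- by move=> i; exact: is_ocitv.
- exact: oc_cover.
- exact: ocitvI.
- move=> _ [[a b] _ <-] /=; have [ab|ba] := leP a b; first exact: mp.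
  by rewrite set_itv_ge ?measure0// bnd_simp -leNgt ltW.
Qed.

Lemma fmeas_lty m (A : set T) : measurable A -> (m A < +oo)%E.
Proof. by move=> mA; rewrite ltey_eq fin_num_measure. Qed.

(** m1 + p2 and p1 + m2 are positive measures that agree on half-open intervals,
    hence everywhere: this makes [sint] independent of the decomposition, and in
    particular of the choice of a Hahn decomposition. *)
Lemma sint_eq_ocitv (m1 m2 p1 p2 : fmeas) :
  (forall a b : R, (a <= b)%R -> m1 `]a, b]%classic + p2 `]a, b]%classic
                       = p1 `]a, b]%classic + m2 `]a, b]%classic)%E ->
  forall h, bmf h -> sint m1 m2 h = sint p1 p2 h.
Proof.
move=> mp h bh.
have mE A : measurable (A : set T) -> measure_add m1 p2 A = measure_add p1 m2 A.
  apply: measure_eq_ocitv => [a b|a b ab].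
    apply: (@le_lt_trans _ _ (m1 `]a, b]%classic + p2 `]a, b]%classic)%E).
      by rewrite -measure_addE.
    by rewrite lte_add_pinfty// fmeas_lty.
  have := mp _ _ ab; rewrite -!measure_addE; exact.
suff : \int[m1]_x h x + \int[p2]_x h x = \int[p1]_x h x + \int[m2]_x h x.
  by rewrite /sint => e; lra.
have ih m := bmf_integrable m bh.
apply: EFin_inj; rewrite !EFinD /Rintegral !fineK;
  try exact/integrable_fin_num/bmf_integrable.
rewrite -(integral_measure_add measurableT (ih m1) (ih p2)).
rewrite -(integral_measure_add measurableT (ih p1) (ih m2)).
by apply: eq_measure_integral => A mA _; exact: mE.
Qed.

Definition is_cdf m (g : R -> R) := forall x, m `]-oo, x]%classic = (g x)%:E.

Lemma is_cdf_oc m g a b : is_cdf m g -> a <= b ->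
  m `]a, b]%classic = (g b - g a)%:E.
Proof.
move=> mg ab; have -> : `]a, b]%classic = `]-oo, b]%classic `\` `]-oo, a]%classic.
  apply/seteqP; split => x /=; rewrite !in_itv/=.
    by move=> /andP[ax xb]; split => //; apply/negP; rewrite -ltNge.
  by move=> [-> /negP]; rewrite -ltNge => ->.
have sub : `]-oo, a]%classic `<=` `]-oo, b]%classic.
  by apply: subset_itvl; rewrite bnd_simp.
by rewrite measureD//= ?fmeas_lty// (setIidr sub) !mg.
Qed.

Lemma is_cdf_mass m g : is_cdf m g -> g n%:R @[n --> \oo] --> mass m.
Proof.
move=> mg; have -> : (fun n => g n%:R) = (fun n => fine (m `]-oo, n%:R]%classic)).
  by apply/funext => n; rewrite mg.
apply: fine_cvg; rewrite fineK ?fin_num_measure//.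
have -> : [set: T] = \bigcup_n `]-oo, n%:R]%classic.
  apply/esym; rewrite -subTset -oc_cover; apply: subset_bigcup => n _.
  exact: subset_itvr.
apply: (@nondecreasing_cvg_mu _ T R m (fun n => `]-oo, n%:R]%classic)) => //.
- exact: bigcupT_measurable.
- move=> a b ab; apply/subsetPset/subset_itvl.
  by rewrite bnd_simp ler_nat.
Qed.

Lemma is_cdf_nd m g : is_cdf m g -> {homo g : x y / x <= y}.
Proof.
move=> mg x y xy; rewrite -subr_ge0 -lee_fin -(is_cdf_oc mg xy).
exact: measure_ge0.
Qed.

Lemma nd_bounded_cvgy (g : R -> R) C : {homo g : x y / x <= y} ->
  (forall x, g x <= C) -> g @ +oo --> sup (range g).
Proof.
move=> nd gC; apply: nondecreasing_cvgr => //.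
by exists C => _ [x _ <-].
Qed.

(** Monotonicity gives g(x) - g(y) <= variation, and g(y) tends to 0 at -oo. *)
Lemma classV_nd_bounds (g : R -> R) : classV g -> {homo g : x y / x <= y} ->
  (forall x, 0 <= g x) /\ exists C, forall x, g x <= C.
Proof.
move=> [+ _ g0] nd => vg; have g_ge0 x : 0 <= g x.
  apply: (cvgr_to_le g0); exists x; split; first by rewrite num_real.
  by move=> y /ltW; exact: nd.
split => //.
have v0 : (0 <= variation_norm g)%E.
  apply: (@le_trans _ _ (total_variation 0 0 g)).
    by rewrite total_variation_ge0.
  by apply: ereal_sup_ubound; exists 0, 0.
have vfin : variation_norm g \is a fin_num by rewrite ge0_fin_numE.
exists (fine (variation_norm g)) => x.
have cv : g x - g y @[y --> -oo] --> g x - 0 by apply: cvgB => //; exact: cvg_cst.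
rewrite -[g x]subr0; apply: (cvgr_to_le cv); exists x; split; first by rewrite num_real.
move=> y /ltW yx; rewrite -lee_fin fineK//.
apply: (@le_trans _ _ (total_variation y x g)).
  by apply: le_trans (total_variation_ge _ yx); rewrite lee_fin ler_norm.
by apply: ereal_sup_ubound; exists y, x.
Qed.

End signed_integral.

(** * Measures of nondecreasing functions and charges *)

Section stieltjes_existence.
Context {R : realType}.
Local Notation T := (measurableTypeR R).
Local Notation fmeas := {finite_measure set T -> \bar R}.

Lemma lebesgue_stieltjes_oc (f : cumulative R R) a b : a <= b ->
  lebesgue_stieltjes_measure f `]a, b]%classic = (f b - f a)%:E.
Proof.
move=> ab; rewrite /lebesgue_stieltjes_measure /measure_extension.
by rewrite measurable_mu_extE/= ?wlength_itv_bnd//; exact: is_ocitv.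
Qed.

Lemma lebesgue_stieltjes_cdf (f : cumulative R R) x : f y @[y --> -oo] --> (0 : R) ->
  lebesgue_stieltjes_measure f `]-oo, x]%classic = (f x)%:E.
Proof.
move=> f0.
have -> : `]-oo, x]%classic = \bigcup_n `]x - n%:R, x]%classic.
  apply/seteqP; split => [y /= | y [n _ /=]]; rewrite !in_itv/=; last by case/andP.
  move=> yx; exists (Num.bound `|y - x|) => //=; rewrite in_itv/= yx andbT.
  have : `|y - x| < (Num.bound `|y - x|)%:R by exact: archi_boundP.
  by rewrite ltr_norml => /andP[+ _]; rewrite ltrBrDr addrC.
have h1 : lebesgue_stieltjes_measure f `]x - n%:R, x]%classic @[n --> \oo] -->
    lebesgue_stieltjes_measure f (\bigcup_n `]x - n%:R, x]%classic).
  apply: (@nondecreasing_cvg_mu _ T R (lebesgue_stieltjes_measure f)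
    (fun n => `]x - n%:R, x]%classic)) => //.
  - exact: bigcupT_measurable.
  - by move=> a b ab; apply/subsetPset/subset_itvr; rewrite bnd_simp lerB// ler_nat.
apply: (cvg_unique _ h1) => //.
have -> : (fun n => lebesgue_stieltjes_measure f `]x - n%:R, x]%classic) =
    (fun n => (f x - f (x - n%:R))%:E).
  by apply/funext => n; rewrite lebesgue_stieltjes_oc// gerBl.
apply: cvg_EFin; first by near=> n.
rewrite -[X in _ --> X]subr0; apply: cvgB; first exact: cvg_cst.
apply: (cvg_comp _ _ _ f0).
apply/cvgrNyPle => M; near=> n; rewrite lerBlDl -lerBlDr.
by near: n; apply: nbhs_infty_ger.
Unshelve. all: end_near. Qed.

Definition stieltjes_fmeas (f : cumulative R R)
  (ff : fin_num_fun (lebesgue_stieltjes_measure f)) := lebesgue_stieltjes_measure f.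

HB.instance Definition _ f ff := Measure.on (@stieltjes_fmeas f ff).

HB.instance Definition _ f ff :=
  @Measure_isFinite.Build _ T R (@stieltjes_fmeas f ff) ff.

(** Membership in the class V is what makes the Stieltjes measure finite. *)
Lemma exists_cdf (g : R -> R) : classV g -> {homo g : x y / x <= y} ->
  exists m : fmeas, is_cdf m g.
Proof.
move=> gV nd; have [_ [C gC]] := classV_nd_bounds gV nd.
have [_ rc g0] := gV.
pose f : cumulative R R := HB.pack g (isCumulative.Build R _ R g nd rc).
have fT : (lebesgue_stieltjes_measure f setT <= C%:E)%E.
  have h1 : lebesgue_stieltjes_measure f `]-oo, n%:R]%classic @[n --> \oo] -->
      lebesgue_stieltjes_measure f setT.
    have -> : [set: T] = \bigcup_n `]-oo, n%:R]%classic.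
      apply/esym; rewrite -subTset -oc_cover; apply: subset_bigcup => n _.
      exact: subset_itvr.
    apply: (@nondecreasing_cvg_mu _ T R (lebesgue_stieltjes_measure f)
      (fun n => `]-oo, n%:R]%classic)) => //.
    - exact: bigcupT_measurable.
    - by move=> a b ab; apply/subsetPset/subset_itvl; rewrite bnd_simp ler_nat.
  apply: (cvge_to_le h1); apply: nearW => n.
  by rewrite lebesgue_stieltjes_cdf// lee_fin; exact: gC.
have ff : fin_num_fun (lebesgue_stieltjes_measure f).
  move=> A mA; rewrite ge0_fin_numE//; apply: (le_lt_trans _ (ltry C)).
  by apply: le_trans fT; apply: le_measure; rewrite ?inE.
by exists [the fmeas of stieltjes_fmeas ff] => x; exact: (@lebesgue_stieltjes_cdf f).
Qed.

Lemma is_cdf_limy (m : fmeas) (g : R -> R) : is_cdf m g ->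
  g @ +oo --> limy g /\ limy g = mass m.
Proof.
move=> mg; have nd := is_cdf_nd mg.
have gm x : g x <= mass m.
  rewrite -lee_fin -mg /mass fineK ?fin_num_measure//.
  by apply: le_measure; rewrite ?inE.
have cg := nd_bounded_cvgy nd gm.
have lg : limy g = sup (range g) by exact: cvg_lim.
split; first by rewrite lg.
rewrite lg; apply: cvg_unique (is_cdf_mass mg) => //.
exact: (cvg_comp _ _ (@cvgr_idn R)).
Qed.

End stieltjes_existence.

Section charges.
Context {R : realType}.
Local Notation T := (measurableTypeR R).
Local Notation fmeas := {finite_measure set T -> \bar R}.

Lemma stieltjes_charge_exists (m1 m2 : fmeas) (g1 g2 : R -> R) :
  is_cdf m1 g1 -> is_cdf m2 g2 ->
  exists nu, is_stieltjes_charge (fun x => g1 x - g2 x) nu.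
Proof.
move=> c1 c2.
exists [the {charge set T -> \bar R} of cadd (charge_of_finite_measure m1)
   (cscale (-1) (charge_of_finite_measure m2))].
move=> a b ab; rewrite /= /cadd/= cscaleN1.
have -> : (g1 b - g2 b - (g1 a - g2 a))%:E =
    ((g1 b - g1 a)%:E - (g2 b - g2 a)%:E)%E.
  by rewrite -EFinN -EFinD; congr EFin; lra.
by congr (_ - _)%E; exact: is_cdf_oc.
Qed.

Lemma hahn_CintegralE (m1 m2 : fmeas) (g1 g2 : R -> R)
    (nu : {charge set T -> \bar R}) P N (nuPN : hahn_decomposition nu P N) :
  is_cdf m1 g1 -> is_cdf m2 g2 ->
  is_stieltjes_charge (fun x => g1 x - g2 x) nu ->
  forall h : R -> R[i], bmf (fun x => complex.Re (h x)) ->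
    bmf (fun x => complex.Im (h x)) ->
  Cintegral (jordan_pos nuPN) h - Cintegral (jordan_neg nuPN) h =
   (sint m1 m2 (fun x => complex.Re (h x)) +i*
    sint m1 m2 (fun x => complex.Im (h x)))%C.
Proof.
move=> c1 c2 nuG h bR bI.
have E k : bmf k -> sint m1 m2 k =
    sint [the fmeas of jordan_pos nuPN] [the fmeas of jordan_neg nuPN] k.
  apply: sint_eq_ocitv => a b ab.
  have mab : measurable (`]a, b]%classic : set T) by exact: measurable_itv.
  have dec : nu `]a, b]%classic = (jordan_pos nuPN `]a, b]%classic
      - jordan_neg nuPN `]a, b]%classic)%E.
    by rewrite (jordan_decomp nuPN mab) /cadd/= cscaleN1.
  rewrite nuG// in dec; move: dec.
  rewrite (is_cdf_oc c1)// (is_cdf_oc c2)//=.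
  have : jordan_pos nuPN `]a, b]%classic \is a fin_num by rewrite fin_num_measure.
  have : jordan_neg nuPN `]a, b]%classic \is a fin_num by rewrite fin_num_measure.
  move: (jordan_pos nuPN _) (jordan_neg nuPN _) => [x| |] [y| |]//= _ _.
  by move=> -[e]; congr EFin; lra.
by rewrite !E//; apply/eqP; rewrite eq_complex /= !eqxx.
Qed.

Lemma charge_CintegralE (m1 m2 : fmeas) (g1 g2 : R -> R) nu :
  is_cdf m1 g1 -> is_cdf m2 g2 ->
  is_stieltjes_charge (fun x => g1 x - g2 x) nu ->
  forall h : R -> R[i], bmf (fun x => complex.Re (h x)) ->
    bmf (fun x => complex.Im (h x)) ->
  charge_Cintegral nu h = (sint m1 m2 (fun x => complex.Re (h x)) +i*
    sint m1 m2 (fun x => complex.Im (h x)))%C.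
Proof. by move=> c1 c2 nuG h bR bI; exact: hahn_CintegralE. Qed.

End charges.

Section kernels.
Context {R : realType}.
Local Notation T := (measurableTypeR R).
Local Notation fmeas := {finite_measure set T -> \bar R}.

(** Minus the real part of the kernel of the exponent; nonnegative. *)
Definition cos_kernel (t x : R) : R :=
  if x == 0 then t ^+ 2 / 2 else (1 - cos (t * x)) * ((1 + x ^+ 2) / x ^+ 2).

(** The imaginary part of the kernel of the exponent. *)
Definition sin_kernel (tau t x : R) : R :=
  if x == 0 then 0
  else (sin (t * x) - t / tau * sin (tau * x)) * ((1 + x ^+ 2) / x ^+ 2).

Lemma spectral_kernelE tau t x :
  spectral_kernel tau t x = ((- cos_kernel t x) +i* sin_kernel tau t x)%C.
Proof.
rewrite /spectral_kernel /cos_kernel /sin_kernel; case: ifPn => _; apply/eqP;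
  rewrite eq_complex/= ?oppr0 ?eqxx//.
apply/andP; split; apply/eqP; ring.
Qed.

Lemma charfunE (F : cumulativeBounded (0 : R) (1 : R)) t :
  charfun F t = ((\int[lebesgue_stieltjes_measure F]_x cos (t * x)) +i*
    \int[lebesgue_stieltjes_measure F]_x sin (t * x))%C.
Proof. by []. Qed.

Lemma expCE (a b c : R) :
  expC ((c%:C * 'i + (a +i* b))%C) =
  ((expR a * cos (c + b)) +i* (expR a * sin (c + b)))%C.
Proof.
rewrite /expC /expi; apply/eqP; rewrite eq_complex/=.
rewrite !(mul0r, mulr0, mulr1, subr0, addr0, add0r, subrr).
by rewrite oppr0 add0r !eqxx.
Qed.

End kernels.

(** * Trigonometric inequalities and the kernels of the exponent *)

Section trigonometry.
Context {R : realType}.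
Implicit Types (u v t s x h : R).

Lemma ge0_of_derive (f df : R -> R) : (forall x, is_derive x 1 f (df x)) ->
  f 0 = 0 -> (forall x, 0 <= x -> 0 <= df x) -> forall u, 0 <= u -> 0 <= f u.
Proof.
move=> fd f0 df0 u u0.
have cf : {within `[0, u], continuous f}.
  apply: continuous_subspaceT => x.
  by apply: differentiable_continuous; apply/derivable1_diffP; apply: ex_derive.
have [c c0u] := MVT_segment u0 (fun x _ => fd x) cf.
rewrite f0 !subr0 => ->; apply: mulr_ge0 => //; apply: df0.
by move: c0u; rewrite in_itv/= => /andP[].
Qed.

Lemma sin_le_id u : 0 <= u -> sin u <= u.
Proof.
move=> u0; rewrite -subr_ge0.
apply: (@ge0_of_derive (fun u => u - sin u) (fun u => 1 - cos u)) => //.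
by rewrite sin0 subrr.
Qed.

Lemma cos_ge_quad u : 1 - cos u <= u ^+ 2 / 2.
Proof.
wlog u0 : u / 0 <= u.
  move=> H; have [|/ltW u0] := leP 0 u; first exact: H.
  by have := H (- u); rewrite oppr_ge0 cosN sqrrN; apply.
rewrite -subr_ge0.
apply: (@ge0_of_derive (fun u => u ^+ 2 / 2 - (1 - cos u)) (fun u => u - sin u)) => //.
- move=> x; apply: is_derive_eq.
  by rewrite /GRing.scale/=; lra.
- by rewrite cos0 expr0n/=; lra.
- by move=> x x0; rewrite subr_ge0 sin_le_id.
Qed.

Lemma sin_ge_cubic u : 0 <= u -> u - u ^+ 3 / 6 <= sin u.
Proof.
move=> u0; rewrite -subr_ge0.
apply: (@ge0_of_derive (fun u => sin u - (u - u ^+ 3 / 6))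
    (fun u => u ^+ 2 / 2 - (1 - cos u))) => //.
- move=> x; apply: is_derive_eq.
  by rewrite /GRing.scale/=; lra.
- by rewrite sin0 expr0n/=; lra.
- by move=> x x0; rewrite subr_ge0 cos_ge_quad.
Qed.

Lemma sin_sub_cubic u : `|sin u - u| <= `|u| ^+ 3 / 6.
Proof.
wlog u0 : u / 0 <= u.
  move=> H; have [|/ltW u0] := leP 0 u; first exact: H.
  have := H (- u); rewrite oppr_ge0 sinN normrN => /(_ u0).
  by rewrite (_ : - sin u - - u = - (sin u - u)) ?normrN//; ring.
have := sin_ge_cubic u0; have := sin_le_id u0 => h1 h2.
rewrite (ger0_norm u0) ler0_norm; lra.
Qed.

(** The cubic bound serves for small u, the trivial one for large u; the quadratic
    form is what bounds the kernels globally after division by x^2. *)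
Lemma sin_sub_quad u : `|sin u - u| <= u ^+ 2.
Proof.
have [u2|u2] := leP `|u| 2.
  apply: le_trans (sin_sub_cubic u) _; rewrite -[u ^+ 2]real_normK ?num_real//.
  have := normr_ge0 u; move: `|u| u2 => v v2 v0.
  rewrite [v ^+ 3]exprS; have : v * v ^+ 2 <= 2 * v ^+ 2 by rewrite ler_wpM2r// exprn_ge0.
  have : 0 <= v ^+ 2 by rewrite exprn_ge0.
  lra.
apply: le_trans (ler_normB _ _) _.
have := sin_max u; rewrite -[u ^+ 2]real_normK ?num_real//.
move: `|u| `|sin u| u2 => v w v2 w1; rewrite expr2.
have : 2 * v <= v * v by rewrite ler_wpM2r; lra.
lra.
Qed.

Definition sinc u : R := if u == 0 then 1 else sin u / u.

Lemma sincM u : sinc u * u = sin u.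
Proof.
rewrite /sinc; case: ifPn => [/eqP ->|u0]; first by rewrite sin0 mulr0.
by rewrite divfK.
Qed.

Lemma sinc_near1 u : `|sinc u - 1| <= `|u|.
Proof.
rewrite /sinc; case: ifPn => [_|u0]; first by rewrite subrr normr0.
have -> : sin u / u - 1 = (sin u - u) / u by field.
rewrite normrM normfV ler_pdivrMr ?normr_gt0// -expr2 real_normK ?num_real//.
exact: sin_sub_quad.
Qed.

Lemma sinc_le1 u : `|sinc u| <= 1.
Proof.
rewrite /sinc; case: ifPn => [_|u0]; first by rewrite normr1.
rewrite normrM normfV ler_pdivrMr ?normr_gt0// mul1r.
wlog u1 : u u0 / 0 <= u.
  move=> H; have [|/ltW u1] := leP 0 u; first exact: H.
  by have := H (- u); rewrite oppr_ge0 sinN !normrN oppr_eq0; exact.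
rewrite (ger0_norm u1); have [u2|u2] := leP u 1; last first.
  by rewrite (le_trans (sin_max _))// ltW.
rewrite ger0_norm ?sin_le_id//; apply: le_trans (sin_ge_cubic u1).
have : u * u ^+ 2 <= u * 1 by rewrite ler_wpM2l// exprn_ile1.
by rewrite -exprS; lra.
Qed.

Lemma sinc_mul_le1 u : `|sinc u| * `|u| <= 1.
Proof. by rewrite -normrM sincM sin_max. Qed.

Lemma sinc_ge u : `|u| <= 1 -> 5 / 6 <= sinc u.
Proof.
wlog u1 : u / 0 <= u.
  move=> H; have [|/ltW u1] := leP 0 u; first exact: H.
  have := H (- u); rewrite oppr_ge0 normrN => /(_ u1) {}H /H.
  by rewrite /sinc oppr_eq0 sinN invrN mulrNN.
rewrite (ger0_norm u1) /sinc; case: ifPn => [_ _|u0 u2]; first lra.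
rewrite ler_pdivlMr ?lt_def ?u0//; apply: le_trans (sin_ge_cubic u1).
have : u * u ^+ 2 <= u * 1 by rewrite ler_wpM2l// exprn_ile1.
by rewrite -exprS; lra.
Qed.

Lemma continuous_mul (f g : R -> R) : continuous f -> continuous g ->
  continuous (fun x => f x * g x).
Proof. by move=> cf cg x; apply: (@continuousM _ _ f g); [exact: cf|exact: cg]. Qed.

Lemma continuous_sub (f g : R -> R) : continuous f -> continuous g ->
  continuous (fun x => f x - g x).
Proof. by move=> cf cg x; apply: continuousB; [exact: cf|exact: cg]. Qed.

Lemma continuous_add (f g : R -> R) : continuous f -> continuous g ->
  continuous (fun x => f x + g x).
Proof. by move=> cf cg x; apply: continuousD; [exact: cf|exact: cg]. Qed.

(** The functions extended by continuity at 0 have a Lipschitz bound there. *)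
Lemma continuous_if0 (g : R -> R) a K :
  (forall x, x != 0 -> {for x, continuous g}) ->
  (forall x, x != 0 -> `|g x - a| <= K * `|x|) ->
  continuous (fun x => if x == 0 then a else g x).
Proof.
move=> cg gK x; have [->|x0] := eqVneq x 0; last first.
  rewrite /continuous_at (negbTE x0).
  apply: cvg_trans (cg _ x0); apply: near_eq_cvg.
  near=> y; rewrite ifF//; apply/negbTE; near: y.
  exact: (@open_neq R 0 _ x0).
rewrite /continuous_at eqxx; apply/cvgrPdist_le => e e0; near=> y.
case: ifPn => [_|y0]; first by rewrite subrr normr0 ltW.
rewrite distrC; apply: (le_trans (gK _ y0)).
apply: (@le_trans _ _ ((`|K| + 1) * `|y|)).
  by rewrite ler_wpM2r// (le_trans (ler_norm _))// lerDl.
rewrite mulrC -ler_pdivlMr ?ltr_pwDr//.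
near: y.
have d0 : 0 < e / (`|K| + 1) by rewrite divr_gt0 ?ltr_pwDr.
exists (e / (`|K| + 1)) => //= y /=; rewrite sub0r normrN; exact: ltW.
Unshelve. all: end_near. Qed.

End trigonometry.

Section kernel_analysis.
Context {R : realType}.
Local Notation T := (measurableTypeR R).
Implicit Types (u v t s x h tau : R).

(** Continuous functions vanishing at infinity, the test functions of vague
    convergence. *)
Definition C0 (f : R -> R) := continuous f /\
  forall e, 0 < e -> exists A, forall x, A <= `|x| -> `|f x| <= e.

Lemma continuous_cosM t : continuous (fun x : R => cos (t * x)).
Proof.
move=> x; apply: continuous_comp; last exact: continuous_cos.
exact: mulrl_continuous.
Qed.

Lemma continuous_sinM t : continuous (fun x : R => sin (t * x)).
Proof.
move=> x; apply: continuous_comp; last exact: continuous_sin.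
exact: mulrl_continuous.
Qed.

Lemma bmf_cos t : bmf (fun x => cos (t * x)).
Proof. by apply: (@continuous_bmf _ _ 1) => [|x]; [exact: continuous_cosM|exact: cos_max]. Qed.

Lemma bmf_sin t : bmf (fun x => sin (t * x)).
Proof. by apply: (@continuous_bmf _ _ 1) => [|x]; [exact: continuous_sinM|exact: sin_max]. Qed.

Lemma C0_decay (f : R -> R) K : continuous f -> (forall x, `|f x| * `|x| <= K) -> C0 f.
Proof.
move=> cf fK; split=> // e e0; exists (`|K| / e + 1) => x xA.
have x0 : 0 < `|x| by rewrite (lt_le_trans _ xA)// ltr_wpDl// divr_ge0// ltW.
rewrite -(ler_pM2r x0); apply: (le_trans (fK x)).
apply: (@le_trans _ _ (e * (`|K| / e + 1))); last by rewrite ler_wpM2l// ltW.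
rewrite mulrDr mulr1 mulrCA divff ?gt_eqF// mulr1.
by rewrite (le_trans (ler_norm _))// lerDl ltW.
Qed.

Lemma continuous_sinc : continuous (@sinc R).
Proof.
apply: (@continuous_if0 _ _ 1 1) => x x0.
  apply: continuousM; first exact: continuous_sin.
  by apply: continuousV => //; exact: cvg_id.
rewrite mul1r; have := sinc_near1 x.
by rewrite /sinc (negbTE x0).
Qed.

Lemma continuous_sincM t : continuous (fun x : R => sinc (t * x)).
Proof.
move=> x; apply: continuous_comp; last exact: continuous_sinc.
exact: mulrl_continuous.
Qed.

Lemma bmf_sincM t : bmf (fun x => sinc (t * x)).
Proof. by apply: (@continuous_bmf _ _ 1) => [|x]; [exact: continuous_sincM|exact: sinc_le1]. Qed.

Lemma C0_sincM h (e : R -> R) : 0 < h -> continuous e -> (forall x, `|e x| <= 1) ->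
  C0 (fun x => e x * sinc (h * x)).
Proof.
move=> h0 ce e1; apply: (@C0_decay _ h^-1).
  by apply: continuous_mul => //; exact: continuous_sincM.
move=> x; rewrite normrM -mulrA -[h^-1]mul1r; apply: ler_pM => //.
rewrite -[h^-1]mul1r ler_pdivlMr// -mulrA.
by rewrite (_ : `|x| * h = `|h * x|) ?sinc_mul_le1// normrM (gtr0_norm h0) mulrC.
Qed.

(** The part (1 - cos tx)/x^2 of the kernel, which vanishes at infinity; written
    through sinc, it needs no special value at 0. *)
Definition cos_tail t x : R := t ^+ 2 / 2 * sinc (t / 2 * x) ^+ 2.

Lemma cos_tail_ge0 t x : 0 <= cos_tail t x.
Proof. by rewrite mulr_ge0// ?divr_ge0// sqr_ge0. Qed.

Lemma cos_tail_le t x : cos_tail t x <= t ^+ 2 / 2.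
Proof.
rewrite -[leRHS]mulr1 ler_wpM2l ?divr_ge0 ?sqr_ge0//.
by rewrite -real_normK ?num_real// exprn_ile1// sinc_le1.
Qed.

Lemma cos_tailM t x : cos_tail t x * x ^+ 2 = 1 - cos (t * x).
Proof.
have -> : t * x = (t / 2 * x) *+ 2 by rewrite mulr2n; field.
rewrite cos_mulr2n cos2sin2 -sincM /cos_tail -[in RHS]mulr_natr exprMn mulr2n.
by field.
Qed.

Lemma cos_kernelE t x : cos_kernel t x = (1 - cos (t * x)) + cos_tail t x.
Proof.
rewrite /cos_kernel; case: ifPn => [/eqP ->|x0].
  by rewrite mulr0 cos0 subrr add0r /cos_tail mulr0 /sinc eqxx expr1n mulr1.
by rewrite -cos_tailM; field.
Qed.

Lemma continuous_cos_tail t : continuous (cos_tail t).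
Proof.
move=> x; apply: (@continuousM _ _ (fun=> t ^+ 2 / 2) (fun x => sinc (t / 2 * x) ^+ 2)).
  exact: cvg_cst.
apply: (@continuous_comp _ _ _ (fun x => sinc (t / 2 * x)) (fun y => y ^+ 2)).
  exact: continuous_sincM.
exact: exprn_continuous.
Qed.

Lemma C0_cos_tail t : C0 (cos_tail t).
Proof.
apply: (@C0_decay _ `|t|); first exact: continuous_cos_tail.
move=> x; have [->|t0] := eqVneq t 0.
  by rewrite /cos_tail expr0n !mul0r normr0 mul0r.
have s1 := sinc_le1 (t / 2 * x); have s2 := sinc_mul_le1 (t / 2 * x).
rewrite (_ : cos_tail t x = t * t / 2 * (sinc (t / 2 * x) * sinc (t / 2 * x))); last first.
  by rewrite /cos_tail; ring.
have n2 : `|2^-1 : R| = 2^-1 by rewrite ger0_norm.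
move: s2; rewrite !normrM n2.
move: s1; set a := `|sinc _| => s1 s2; have a0 : 0 <= a by exact: normr_ge0.
have s3 : a * (a * (`|t| / 2 * `|x|)) <= 1 * 1 by rewrite ler_pM// !mulr_ge0.
have -> : `|t| * `|t| / 2 * (a * a) * `|x| = `|t| * (a * (a * (`|t| / 2 * `|x|))) by ring.
by rewrite -[leRHS]mulr1 ler_wpM2l//; lra.
Qed.

Lemma cos_kernel_ge0 t x : 0 <= cos_kernel t x.
Proof. by rewrite cos_kernelE addr_ge0 ?cos_tail_ge0// subr_ge0 cos_le1. Qed.

Lemma cos_kernel_le t x : cos_kernel t x <= 2 + t ^+ 2 / 2.
Proof.
by rewrite cos_kernelE lerD ?cos_tail_le//; have := cos_geN1 (t * x); lra.
Qed.

Lemma bmf_cos_tail t : bmf (cos_tail t).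
Proof.
apply: (@continuous_bmf _ _ (t ^+ 2 / 2)); first exact: continuous_cos_tail.
by move=> x; rewrite ger0_norm ?cos_tail_ge0// cos_tail_le.
Qed.

Lemma bmf_1cos t : bmf (fun x => 1 - cos (t * x)).
Proof. by apply: bmfB; [exact: bmf_cst|exact: bmf_cos]. Qed.

Lemma bmf_cos_kernel t : bmf (cos_kernel t).
Proof.
have -> : cos_kernel t = (fun x => (1 - cos (t * x)) + cos_tail t x).
  by apply/funext => x; rewrite cos_kernelE.
by apply: bmfD; [exact: bmf_1cos|exact: bmf_cos_tail].
Qed.

(** The first summand controls the mass near 0, where sinc(hx) is close to 1; the
    second controls the rest of the line. *)
Lemma cos_kernel_sinc_ge h x : 0 < h -> h <= 1 ->
  h ^+ 2 / 3 <= cos_kernel h x + (1 - sinc (h * x)).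
Proof.
move=> h0 h1; have s1 := sinc_le1 (h * x).
have s1' : sinc (h * x) <= 1 by rewrite (le_trans (ler_norm _)).
have [hx|hx] := leP `|h * x| 2.
  suff : h ^+ 2 / 3 <= cos_tail h x by rewrite cos_kernelE; have := cos_le1 (h * x); lra.
  have : 5 / 6 <= sinc (h / 2 * x).
    by apply: sinc_ge; move: hx; rewrite !normrM !normfV (@ger0_norm _ 2)//; lra.
  rewrite /cos_tail; move: (sinc _) => v v56.
  have v2 : (5 / 6) ^+ 2 <= v ^+ 2 by rewrite ler_sqr ?nnegrE//; lra.
  have : h ^+ 2 / 2 * (5 / 6) ^+ 2 <= h ^+ 2 / 2 * v ^+ 2.
    by rewrite ler_wpM2l// divr_ge0// sqr_ge0.
  have : 0 <= h ^+ 2 by exact: sqr_ge0.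
  lra.
have s2 := sinc_mul_le1 (h * x).
have s3 : `|sinc (h * x)| <= 1 / 2.
  rewrite leNgt; apply/negP => s3.
  have : 1 / 2 * 2 < `|sinc (h * x)| * `|h * x| by apply: ltr_pM => //; lra.
  by lra.
have := ler_norm (sinc (h * x)); have := cos_kernel_ge0 h x.
have : h ^+ 2 <= 1 by rewrite exprn_ile1// ltW.
lra.
Qed.

(** The second difference in t of the kernel factorizes; together with
    [sin_kernel_diff2] this is how the exponent, free of its linear part, gives
    access to the Fourier transform of the spectral measure. *)
Lemma cos_kernel_diff2 t s x :
  cos_kernel (t + s) x + cos_kernel (t - s) x - 2 * cos_kernel t x =
  2 * (cos (t * x) * cos_kernel s x).
Proof.
rewrite /cos_kernel; case: ifPn => [/eqP ->|x0]; first by rewrite mulr0 cos0; field.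
by rewrite [(t + s) * x]mulrDl [(t - s) * x]mulrBl cosD cosB; ring.
Qed.

Lemma sin_kernel_diff2 tau t s x : tau != 0 ->
  2 * sin_kernel tau t x - sin_kernel tau (t + s) x - sin_kernel tau (t - s) x =
  2 * (sin (t * x) * cos_kernel s x).
Proof.
move=> tau0; rewrite /sin_kernel /cos_kernel; case: ifPn => [/eqP ->|x0].
  by rewrite !mulr0 sin0; ring.
by rewrite [(t + s) * x]mulrDl [(t - s) * x]mulrBl sinD sinB; field; rewrite x0.
Qed.

(** The part of the kernel that vanishes at infinity; the centering term makes it
    continuous at 0. *)
Definition sin_tail tau t x : R :=
  if x == 0 then 0 else (sin (t * x) - t / tau * sin (tau * x)) / x ^+ 2.

Lemma sin_kernelE tau t x :
  sin_kernel tau t x = (sin (t * x) - t / tau * sin (tau * x)) + sin_tail tau t x.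
Proof.
rewrite /sin_kernel /sin_tail; case: ifPn => [/eqP ->|x0]; last by move: (t / tau) => a; field.
by rewrite !mulr0 sin0; ring.
Qed.

Lemma sin_tau_sub tau t x : tau != 0 -> sin (t * x) - t / tau * sin (tau * x) =
  (sin (t * x) - t * x) - t / tau * (sin (tau * x) - tau * x).
Proof. by move=> tau0; field. Qed.

Lemma sin_tail_norm_le tau t x : 0 < tau -> `|sin_tail tau t x| <= t ^+ 2 + `|t| * tau.
Proof.
move=> tau0; rewrite /sin_tail; case: ifPn => [_|x0].
  by rewrite normr0 addr_ge0 ?sqr_ge0// mulr_ge0// ltW.
have x2 : 0 < x ^+ 2 by rewrite exprn_even_gt0.
rewrite normrM normfV (gtr0_norm x2) ler_pdivrMr// sin_tau_sub ?gt_eqF//.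
apply: (le_trans (ler_normB _ _)); rewrite normrM normrM normfV (gtr0_norm tau0).
have a1 := sin_sub_quad (t * x); have a2 := sin_sub_quad (tau * x).
have : `|t| / tau * `|sin (tau * x) - tau * x| <= `|t| / tau * (tau * x) ^+ 2.
  by rewrite ler_wpM2l// divr_ge0// ltW.
have -> : `|t| / tau * (tau * x) ^+ 2 = `|t| * tau * x ^+ 2 by field; rewrite gt_eqF.
move: a1; rewrite exprMn; lra.
Qed.

Lemma sin_tail_norm_le1 tau t x : 0 < tau ->
  `|sin_tail tau t x| <= (`|t| ^+ 3 + `|t| * tau ^+ 2) / 6 * `|x|.
Proof.
move=> tau0; rewrite /sin_tail; case: ifPn => [/eqP ->|x0].
  by rewrite normr0 mulr0.
have x2 : 0 < x ^+ 2 by rewrite exprn_even_gt0.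
rewrite normrM normfV (gtr0_norm x2) ler_pdivrMr// sin_tau_sub ?gt_eqF//.
apply: (le_trans (ler_normB _ _)); rewrite normrM normrM normfV (gtr0_norm tau0).
have a1 := sin_sub_cubic (t * x); have a2 := sin_sub_cubic (tau * x).
have : `|t| / tau * `|sin (tau * x) - tau * x| <= `|t| / tau * (`|tau * x| ^+ 3 / 6).
  by rewrite ler_wpM2l// divr_ge0// ltW.
rewrite !normrM (gtr0_norm tau0) in a1 *.
have -> : `|t| / tau * ((tau * `|x|) ^+ 3 / 6) = `|t| * tau ^+ 2 / 6 * `|x| ^+ 3.
  by field; rewrite gt_eqF.
move: a1; rewrite exprMn.
have -> : x ^+ 2 = `|x| ^+ 2 by rewrite real_normK ?num_real.
have -> : (`|t| ^+ 3 + `|t| * tau ^+ 2) / 6 * `|x| * `|x| ^+ 2 =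
  `|t| ^+ 3 * `|x| ^+ 3 / 6 + `|t| * tau ^+ 2 / 6 * `|x| ^+ 3 by field.
lra.
Qed.

Lemma sin_kernel_main_norm_le tau t x : 0 < tau ->
  `|sin (t * x) - t / tau * sin (tau * x)| <= 1 + `|t| / tau.
Proof.
move=> tau0; apply: (le_trans (ler_normB _ _)); rewrite lerD ?sin_max//.
rewrite normrM -[leRHS]mulr1 ler_pM// ?sin_max//.
by rewrite normrM normfV (gtr0_norm tau0).
Qed.

Lemma continuous_sin_tail tau t : 0 < tau -> continuous (sin_tail tau t).
Proof.
move=> tau0; apply: (@continuous_if0 _ _ 0 ((`|t| ^+ 3 + `|t| * tau ^+ 2) / 6)) => x x0.
  apply: continuousM.
    apply: continuousB; first exact: continuous_sinM.
    by apply: continuousM; [exact: cvg_cst|exact: continuous_sinM].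
  apply: continuousV; first by rewrite expf_neq0.
  exact: exprn_continuous.
by rewrite subr0; have := sin_tail_norm_le1 t x tau0; rewrite /sin_tail (negbTE x0).
Qed.

Lemma C0_sin_tail tau t : 0 < tau -> C0 (sin_tail tau t).
Proof.
move=> tau0; apply: (@C0_decay _ ((1 + `|t| / tau) + (t ^+ 2 + `|t| * tau))).
  exact: continuous_sin_tail.
have A0 : 0 <= 1 + `|t| / tau by rewrite addr_ge0// divr_ge0// ltW.
have B0 : 0 <= t ^+ 2 + `|t| * tau by rewrite addr_ge0 ?sqr_ge0// mulr_ge0// ltW.
move=> x; have [x1|x1] := leP `|x| 1.
  have := sin_tail_norm_le t x tau0.
  have : `|sin_tail tau t x| * `|x| <= `|sin_tail tau t x| * 1 by rewrite ler_wpM2l.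
  lra.
have x0 : x != 0 by rewrite -normr_gt0 (lt_trans _ x1).
have x0' : 0 < `|x| by rewrite normr_gt0.
have m := @sin_kernel_main_norm_le tau t x tau0.
rewrite /sin_tail (negbTE x0) normrM normfV normrX.
move: m; set a := `|sin _ - _| => m.
rewrite (_ : a / `|x| ^+ 2 * `|x| = a / `|x|); last by field; rewrite normr_eq0.
apply: (@le_trans _ _ a); last lra.
by rewrite ler_pdivrMr// ler_peMr //; [exact: normr_ge0|exact: ltW].
Qed.

Lemma bmf_sin_tail tau t : 0 < tau -> bmf (sin_tail tau t).
Proof.
move=> tau0; apply: continuous_bmf; first exact: continuous_sin_tail.
by move=> x; exact: sin_tail_norm_le.
Qed.

Lemma bmf_sin_kernel tau t : 0 < tau -> bmf (sin_kernel tau t).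
Proof.
move=> tau0; have -> : sin_kernel tau t = (fun x =>
    (sin (t * x) - t / tau * sin (tau * x)) + sin_tail tau t x).
  by apply/funext => x; rewrite sin_kernelE.
apply: bmfD; last exact: bmf_sin_tail.
apply: bmfB; first exact: bmf_sin.
by apply: bmfM; [exact: bmf_cst|exact: bmf_sin].
Qed.

Lemma sin_kernel_norm_le tau t x : 0 < tau ->
  `|sin_kernel tau t x| <= (1 + `|t| / tau) + (t ^+ 2 + `|t| * tau).
Proof.
move=> tau0; rewrite sin_kernelE (le_trans (ler_normD _ _))// lerD//.
  exact: sin_kernel_main_norm_le.
exact: sin_tail_norm_le.
Qed.

End kernel_analysis.

(** * Averages of cosines *)

Section viete.
Context {R : realType}.
Local Notation T := (measurableTypeR R).
Local Notation fmeas := {finite_measure set T -> \bar R}.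
Implicit Types (h s x : R) (N : nat).

Definition viete h N x : R := \prod_(j < N) cos (h / 2 ^+ j.+1 * x).

Lemma vieteS h N x : viete h N.+1 x = viete h N x * cos (h / 2 ^+ N.+1 * x).
Proof. by rewrite /viete big_ord_recr. Qed.

Lemma viete_le1 h N x : `|viete h N x| <= 1.
Proof.
elim: N => [|N IH]; first by rewrite /viete big_ord0 normr1.
by rewrite vieteS normrM mulr_ile1// cos_max.
Qed.

Lemma viete_sinc h N x : viete h N x * sinc (h / 2 ^+ N * x) = sinc (h * x).
Proof.
elim: N => [|N <-]; first by rewrite /viete big_ord0 mul1r expr0 divr1.
rewrite vieteS -mulrA; congr (_ * _).
set u := h / 2 ^+ N.+1 * x.
have -> : h / 2 ^+ N * x = u *+ 2.
  by rewrite /u exprS mulr2n; field; rewrite expf_neq0.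
have [->|u0] := eqVneq u 0; first by rewrite mul0rn /sinc eqxx cos0 mulr1.
rewrite /sinc (negbTE u0) mulrn_eq0/= (negbTE u0) sin_mulr2n !mulr2n.
by field; rewrite -mulr2n mulrn_eq0/= u0.
Qed.

Lemma bmf_viete h N : bmf (viete h N).
Proof.
elim: N => [|N IH].
  have -> : viete h 0 = (fun=> 1) by apply/funext => x; rewrite /viete big_ord0.
  exact: bmf_cst.
have -> : viete h N.+1 = (fun x => viete h N x * cos (h / 2 ^+ N.+1 * x)).
  by apply/funext => x; rewrite vieteS.
by apply: bmfM => //; exact: bmf_cos.
Qed.

Lemma viete_cvg h x : viete h N x @[N --> \oo] --> sinc (h * x).
Proof.
apply/cvgrPdist_le => e e0; near=> N.
rewrite -(viete_sinc h N) -[X in _ - X]mulr1 -mulrBr normrM.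
rewrite (le_trans (ler_piMl _ (viete_le1 _ _ _)))//.
apply: (le_trans (sinc_near1 _)).
rewrite (_ : h / 2 ^+ N * x = (h * x) / 2 ^+ N); last by ring.
rewrite normrM normfV (@ger0_norm _ (2 ^+ N)) ?exprn_ge0//.
have p2 : 0 < 2 ^+ N :> R by exact: exprn_gt0.
rewrite (ler_pdivrMr _ _ p2) -(ler_pdivrMl _ _ e0).
apply: (@le_trans _ _ N%:R).
  by near: N; exact: nbhs_infty_ger.
by rewrite -natrX ler_nat ltnW// ltn_expl.
Unshelve. all: end_near. Qed.

(** sinc(hx) is the product of the cos(hx/2^j), and multiplying by one factor
    averages the hypothesis over two opposite shifts of s. The bound hence
    passes from 1 - cos(sx), |s| <= h, to all partial products, and to sinc by
    dominated convergence. *)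
Lemma sint_sinc_le (m1 m2 : fmeas) (e : R -> R) h c : 0 <= h -> bmf e ->
  (forall s, `|s| <= h -> sint m1 m2 (fun x => e x * (1 - cos (s * x))) <= c) ->
  sint m1 m2 (fun x => e x * (1 - sinc (h * x))) <= c.
Proof.
move=> h0 be H.
have bv N s : bmf (fun x => e x * (1 - cos (s * x) * viete h N x)).
  apply: bmfM => //; apply: bmfB; first exact: bmf_cst.
  by apply: bmfM; [exact: bmf_cos|exact: bmf_viete].
have P N s : `|s| <= h / 2 ^+ N ->
    sint m1 m2 (fun x => e x * (1 - cos (s * x) * viete h N x)) <= c.
  elim: N s => [s|N IH s sh].
    rewrite expr0 divr1 => /H; congr (sint _ _ _ <= _).
    by apply/funext => x; rewrite /viete big_ord0 mulr1.
  set d := h / 2 ^+ N.+1.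
  have dd : d + d = h / 2 ^+ N by rewrite /d exprS; field; rewrite expf_neq0.
  have d0 : 0 <= d by rewrite divr_ge0// exprn_ge0.
  have -> : (fun x => e x * (1 - cos (s * x) * viete h N.+1 x)) =
    (fun x => 2^-1 * (e x * (1 - cos ((s + d) * x) * viete h N x) +
              e x * (1 - cos ((s - d) * x) * viete h N x))).
    apply/funext => x; rewrite vieteS -/d mulrDl mulrBl cosD cosB.
    by field.
  rewrite sintZ; last exact: bmfD.
  rewrite sintD//.
  have s1 : `|s + d| <= h / 2 ^+ N by rewrite (le_trans (ler_normD _ _))// -dd (ger0_norm d0) lerD2r.
  have s2 : `|s - d| <= h / 2 ^+ N by rewrite (le_trans (ler_normB _ _))// -dd (ger0_norm d0) lerD2r.
  by have := IH _ s1; have := IH _ s2; lra.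
have [C eC] := be.2.
have cv : sint m1 m2 (fun x => e x * (1 - viete h N x)) @[N --> \oo] -->
    sint m1 m2 (fun x => e x * (1 - sinc (h * x))).
  apply: (@sint_dct _ _ _ _ _ (C * 2)).
  - move=> N; have := (bv N 0).1; congr measurable_fun.
    by apply/funext => x; rewrite mul0r cos0 mul1r.
  - move=> N x; rewrite normrM ler_pM// (le_trans (ler_normB _ _))// normr1.
    by have := viete_le1 h N x; lra.
  - move=> x; apply: cvgM; first exact: cvg_cst.
    by apply: cvgB; [exact: cvg_cst|exact: viete_cvg].
apply: (cvgr_to_le cv); apply: nearW => N.
have := P N 0; rewrite normr0 divr_ge0// ?exprn_ge0// => /(_ isT).
congr (sint _ _ _ <= _); apply/funext => x.
by rewrite mul0r cos0 mul1r.
Qed.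

Lemma sint_sinc_norm_le (m1 m2 : fmeas) (e : R -> R) h c : 0 <= h -> bmf e ->
  (forall s, `|s| <= h -> `|sint m1 m2 (fun x => e x * (1 - cos (s * x)))| <= c) ->
  `|sint m1 m2 (fun x => e x * (1 - sinc (h * x)))| <= c.
Proof.
move=> h0 be H.
have b k (t : R) : bmf k -> bmf (fun x => e x * (1 - k x)).
  by move=> bk; apply: bmfM => //; apply: bmfB => //; exact: bmf_cst.
rewrite ler_norml; apply/andP; split; last first.
  by apply: sint_sinc_le => // s /H; rewrite ler_norml => /andP[].
rewrite lerNl -sintN; last by apply: b => //; exact: bmf_sincM.
rewrite (_ : (fun x => _) = fun x => (- e x) * (1 - sinc (h * x))); last first.
  by apply/funext => x; rewrite mulNr.
apply: sint_sinc_le => //; first exact: bmfN.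
move=> s /H; rewrite ler_norml => /andP[+ _].
rewrite lerNl -sintN; last by apply: b => //; exact: bmf_cos.
by congr (sint _ _ _ <= _); apply/funext => x; rewrite mulNr.
Qed.

End viete.

(** * Injectivity of the Fourier transform on signed measures *)

Section sign_approximation.
Context {R : realType}.
Implicit Types (u v x y : R).

(** Its iterates converge to the sign function on [-1, 1]: 1 is an attracting fixed
    point, and the polynomial is odd. *)
Definition smoothstep u : R := (3 * u - u ^+ 3) / 2.

Lemma smoothstepN u : smoothstep (- u) = - smoothstep u.
Proof. by rewrite /smoothstep; field. Qed.

Lemma iter_smoothstepN N u : iter N smoothstep (- u) = - iter N smoothstep u.
Proof. by elim: N => //= N ->; rewrite smoothstepN. Qed.

Lemma one_sub_smoothstep u : 1 - smoothstep u = (1 - u) * ((1 - u) * (2 + u) / 2).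
Proof. by rewrite /smoothstep; field. Qed.

Lemma iter_smoothstep_bounds N u : 0 <= u -> u <= 1 ->
  u <= iter N smoothstep u <= 1 /\ 1 - iter N smoothstep u <= (1 - u / 2) ^+ N.
Proof.
move=> u0 u1; elim: N => [|N [/andP[IH1 IH2] IH3]] /=.
  by rewrite lexx u1 expr0; split => //; lra.
move: (iter N smoothstep u) IH1 IH2 IH3 => v uv v1 v2.
have v0 : 0 <= v by exact: le_trans uv.
split.
  apply/andP; split; last first.
    by rewrite -subr_ge0 one_sub_smoothstep !mulr_ge0//; lra.
  apply: (le_trans uv); rewrite -subr_ge0.
  rewrite (_ : _ - v = v * ((1 - v) * (1 + v)) / 2); last by rewrite /smoothstep; field.
  by rewrite !mulr_ge0//; lra.
rewrite one_sub_smoothstep exprSr ler_pM//; [lra| |].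
  by rewrite !mulr_ge0//; lra.
have : 0 <= v * v by rewrite mulr_ge0.
lra.
Qed.

Lemma iter_smoothstep_le1 N u : `|u| <= 1 -> `|iter N smoothstep u| <= 1.
Proof.
wlog u0 : u / 0 <= u.
  move=> H; have [|/ltW u0] := leP 0 u; first exact: H.
  by have := H (- u); rewrite oppr_ge0 iter_smoothstepN !normrN; exact.
rewrite (ger0_norm u0) => u1.
have [/andP[h1 h2] _] := iter_smoothstep_bounds N u0 u1.
by rewrite ger0_norm// (le_trans u0).
Qed.

Lemma iter_smoothstep_cvg u : `|u| <= 1 ->
  iter N smoothstep u @[N --> \oo] --> Num.sg u.
Proof.
wlog u0 : u / 0 <= u.
  move=> H; have [|/ltW u0] := leP 0 u; first exact: H.
  have := H (- u); rewrite oppr_ge0 normrN sgrN => /(_ u0) {}H /H.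
  move=> cv; rewrite -[Num.sg u]opprK.
  rewrite (_ : (fun N => _) = fun N => - iter N smoothstep (- u)); first exact: cvgN.
  by apply/funext => N; rewrite iter_smoothstepN opprK.
rewrite (ger0_norm u0) => u1; move: u0; rewrite le_eqVlt => /predU1P[<-|u0].
  rewrite sgr0; have -> : (fun N => iter N smoothstep 0) = (fun=> 0).
    apply/funext => N; elim: N => //= N ->.
    by rewrite /smoothstep expr0n/=; field.
  exact: cvg_cst.
rewrite (gtr0_sg u0).
have cv : (1 - u / 2) ^+ N @[N --> \oo] --> (0 : R).
  by apply: cvg_expr; rewrite ger0_norm; lra.
apply/cvgrPdist_le => e e0; near=> N.
have [/andP[h1 h2] h3] := iter_smoothstep_bounds N (ltW u0) u1.
rewrite ger0_norm ?subr_ge0//; apply: (le_trans h3).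
apply: (le_trans (ler_norm _)); rewrite -[X in `|X|]subr0 distrC.
by near: N; move/cvgrPdist_le : cv; exact.
Unshelve. all: end_near. Qed.

Lemma inv_cvg0 x : x / n.+1%:R @[n --> \oo] --> (0 : R).
Proof.
rewrite -[X in _ --> X](mulr0 x); apply: cvgM; first exact: cvg_cst.
exact: cvg_harmonic.
Qed.

Lemma sg_sin_cvg x : Num.sg (sin (x / n.+1%:R)) @[n --> \oo] --> Num.sg x.
Proof.
apply/cvgrPdist_le => e e0; near=> n.
have u1 : `|x / n.+1%:R| <= 1.
  rewrite -[X in `|X|]subr0 distrC; near: n.
  by have /cvgrPdist_le := inv_cvg0 x; apply.
rewrite -sincM sgrM (_ : Num.sg (sinc _) = 1); last first.
  by apply: gtr0_sg; have := sinc_ge u1; lra.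
rewrite mul1r sgrM (_ : Num.sg (_^-1) = 1) ?mulr1 ?subrr ?normr0 ?ltW//.
exact: gtr0_sg.
Unshelve. all: end_near. Qed.

End sign_approximation.

Section multiplier_algebra.
Context {R : realType}.
Local Notation T := (measurableTypeR R).
Local Notation fmeas := {finite_measure set T -> \bar R}.
Variables m1 m2 : fmeas.
Implicit Types (h k : R -> R) (t x y : R).

(** The functions h for which h times the signed measure m1 - m2 has zero Fourier
    transform. *)
Definition fnull h := bmf h /\ forall t,
  sint m1 m2 (fun x => h x * cos (t * x)) = 0 /\
  sint m1 m2 (fun x => h x * sin (t * x)) = 0.

(** These multipliers form an algebra that contains the trigonometric polynomials
    and is closed under bounded pointwise limits; it thereby contains indicators of
    half-lines, which replaces any inversion formula. *)
Definition fmult k := bmf k /\ forall h, fnull h -> fnull (fun x => k x * h x).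

Lemma fnullD h k : fnull h -> fnull k -> fnull (fun x => h x + k x).
Proof.
move=> [bh nh] [bk nk]; split; first exact: bmfD.
move=> t; have [h1 h2] := nh t; have [k1 k2] := nk t.
have bc := bmf_cos t; have bs := bmf_sin t; split.
  rewrite (_ : (fun x => _) = fun x => h x * cos (t * x) + k x * cos (t * x)).
    by rewrite sintD ?h1 ?k1 ?addr0//; exact: bmfM.
  by apply/funext => x; rewrite mulrDl.
rewrite (_ : (fun x => _) = fun x => h x * sin (t * x) + k x * sin (t * x)).
  by rewrite sintD ?h2 ?k2 ?addr0//; exact: bmfM.
by apply/funext => x; rewrite mulrDl.
Qed.

Lemma fnullZ c h : fnull h -> fnull (fun x => c * h x).
Proof.
move=> [bh nh]; split; first exact/bmfM/bh/bmf_cst.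
move=> t; have [h1 h2] := nh t.
have bc := bmf_cos t; have bs := bmf_sin t; split.
  rewrite (_ : (fun x => _) = fun x => c * (h x * cos (t * x))).
    by rewrite sintZ ?h1 ?mulr0//; exact: bmfM.
  by apply/funext => x; rewrite mulrA.
rewrite (_ : (fun x => _) = fun x => c * (h x * sin (t * x))).
  by rewrite sintZ ?h2 ?mulr0//; exact: bmfM.
by apply/funext => x; rewrite mulrA.
Qed.

Lemma fnull_cvg (h_ : nat -> R -> R) h C : (forall n, fnull (h_ n)) ->
  (forall n x, `|h_ n x| <= C) -> (forall x, h_ n x @[n --> \oo] --> h x) ->
  fnull h.
Proof.
move=> hn hC cvh.
have mh n : measurable_fun [set: T] (h_ n : T -> R) by have [[]] := hn n.
split; first by have [] := Rintegral_dct m1 mh hC cvh.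
have H (e : R -> R) : bmf e -> (forall x, `|e x| <= 1) ->
    (forall n, sint m1 m2 (fun x => h_ n x * e x) = 0) ->
    sint m1 m2 (fun x => h x * e x) = 0.
  move=> be e1 hn0.
  have cv : sint m1 m2 (fun x => h_ n x * e x) @[n --> \oo] -->
      sint m1 m2 (fun x => h x * e x).
    apply: (@sint_dct _ _ _ _ _ (C * 1)).
    - by move=> n; have [] := bmfM (hn n).1 be.
    - by move=> n x; rewrite normrM ler_pM.
    - by move=> x; apply: cvgM; [exact: cvh|exact: cvg_cst].
  apply: (cvg_unique _ cv) => //.
  by rewrite (_ : (fun n => _) = fun=> 0); [exact: cvg_cst|exact/funext].
by move=> t; split; apply: H => [|x|n];
  [exact: bmf_cos|exact: cos_max|have [_ /(_ t)[]] := hn n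
  |exact: bmf_sin|exact: sin_max|have [_ /(_ t)[]] := hn n].
Qed.

Lemma fmult_cst c : fmult (fun=> c).
Proof. by split; [exact: bmf_cst|move=> h /fnullZ]. Qed.

Lemma fmultD h k : fmult h -> fmult k -> fmult (fun x => h x + k x).
Proof.
move=> [bh mh] [bk mk]; split; first exact: bmfD.
move=> q nq; have := fnullD (mh _ nq) (mk _ nq).
by congr fnull; apply/funext => x; rewrite mulrDl.
Qed.

Lemma fmultM h k : fmult h -> fmult k -> fmult (fun x => h x * k x).
Proof.
move=> [bh mh] [bk mk]; split; first exact: bmfM.
move=> q nq; have := mh _ (mk _ nq).
by congr fnull; apply/funext => x; rewrite mulrA.
Qed.

Lemma fmultZ c h : fmult h -> fmult (fun x => c * h x).
Proof. by move=> mh; apply: fmultM => //; exact: fmult_cst. Qed.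

Lemma fmultB h k : fmult h -> fmult k -> fmult (fun x => h x - k x).
Proof.
move=> mh /(fmultZ (-1)) /(fmultD mh).
by congr fmult; apply/funext => x; rewrite mulN1r.
Qed.

Lemma fmult_cvg (k_ : nat -> R -> R) k C : (forall n, fmult (k_ n)) ->
  (forall n x, `|k_ n x| <= C) -> (forall x, k_ n x @[n --> \oo] --> k x) ->
  fmult k.
Proof.
move=> mk kC cvk; split.
  by have [] := @Rintegral_dct _ m1 _ _ _ (fun n => (mk n).1.1) kC cvk.
move=> h nh; have [[_ [D hD]] _] := nh.
apply: (@fnull_cvg (fun n x => k_ n x * h x) _ (C * D)).
- by move=> n; apply: (mk n).2.
- by move=> n x; rewrite normrM ler_pM.
- by move=> x; apply: cvgM => //; exact: cvg_cst.
Qed.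

Lemma fmult_cos s : fmult (fun x => cos (s * x)).
Proof.
split; first exact: bmf_cos.
move=> h [bh nh]; split; first by apply: bmfM => //; exact: bmf_cos.
have b e : bmf e -> bmf (fun x => h x * e x) by exact: bmfM.
move=> t; have [h1 h2] := nh (t + s); have [h3 h4] := nh (t - s); split.
  rewrite (_ : (fun x => _) = fun x => 2^-1 * (h x * cos ((t + s) * x) + h x * cos ((t - s) * x))).
    by rewrite sintZ ?sintD ?h1 ?h3 ?addr0 ?mulr0//; try apply: bmfD; apply: b; exact: bmf_cos.
  by apply/funext => x; rewrite [(t + s) * x]mulrDl [(t - s) * x]mulrBl cosB cosD; field.
rewrite (_ : (fun x => _) = fun x => 2^-1 * (h x * sin ((t + s) * x) + h x * sin ((t - s) * x))).
  by rewrite sintZ ?sintD ?h2 ?h4 ?addr0 ?mulr0//; try apply: bmfD; apply: b; exact: bmf_sin.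
by apply/funext => x; rewrite [(t + s) * x]mulrDl [(t - s) * x]mulrBl sinB sinD; field.
Qed.

Lemma fmult_sin s : fmult (fun x => sin (s * x)).
Proof.
split; first exact: bmf_sin.
move=> h [bh nh]; split; first by apply: bmfM => //; exact: bmf_sin.
have b e : bmf e -> bmf (fun x => h x * e x) by exact: bmfM.
move=> t; have [h1 h2] := nh (t + s); have [h3 h4] := nh (t - s); split.
  rewrite (_ : (fun x => _) = fun x => 2^-1 * (h x * sin ((t + s) * x) - h x * sin ((t - s) * x))).
    by rewrite sintZ ?sintB ?h2 ?h4 ?subr0 ?mulr0//; try apply: bmfB; apply: b; exact: bmf_sin.
  by apply/funext => x; rewrite [(t + s) * x]mulrDl [(t - s) * x]mulrBl sinB sinD; field.
rewrite (_ : (fun x => _) = fun x => 2^-1 * (h x * cos ((t - s) * x) - h x * cos ((t + s) * x))).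
  by rewrite sintZ ?sintB ?h1 ?h3 ?subr0 ?mulr0//; try apply: bmfB; apply: b; exact: bmf_cos.
by apply/funext => x; rewrite [(t + s) * x]mulrDl [(t - s) * x]mulrBl cosB cosD; field.
Qed.

Lemma fmult_smoothstep k : fmult k -> fmult (fun x => smoothstep (k x)).
Proof.
move=> mk; have := fmultZ 2^-1 (fmultB (fmultZ 3 mk) (fmultM mk (fmultM mk mk))).
by congr fmult; apply/funext => x; rewrite /smoothstep; field.
Qed.

Lemma fmult_iter_smoothstep N k : fmult k -> fmult (fun x => iter N smoothstep (k x)).
Proof. by move=> mk; elim: N => //= N; exact: fmult_smoothstep. Qed.

(** Iterating [smoothstep] on sin((x - y)/n) gives the sign of sin((x - y)/n), which
    is the sign of x - y as soon as n is large. *)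
Lemma fmult_sg y : fmult (fun x => Num.sg (x - y)).
Proof.
apply: (@fmult_cvg (fun n x => Num.sg (sin ((x - y) / n.+1%:R))) _ 1).
- move=> n; apply: (@fmult_cvg (fun N x => iter N smoothstep (sin ((x - y) / n.+1%:R))) _ 1).
  + move=> N; apply: fmult_iter_smoothstep.
    set s := n.+1%:R^-1.
    have := fmultB (fmultZ (cos (s * y)) (fmult_sin s)) (fmultZ (sin (s * y)) (fmult_cos s)).
    congr fmult; apply/funext => x.
    by rewrite (_ : (x - y) * s = s * x - s * y) ?sinB; ring.
  + by move=> N x; apply: iter_smoothstep_le1; exact: sin_max.
  + by move=> x; apply: iter_smoothstep_cvg; exact: sin_max.
- by move=> n x; rewrite normr_sg; case: (_ != 0); rewrite ?normr0 ?lexx ?ler01.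
- by move=> x; exact: sg_sin_cvg.
Qed.

Definition ind_le y x : R := if x <= y then 1 else 0.

Lemma fmult_ind_le y : fmult (ind_le y).
Proof.
have m := fmult_sg y.
have := fmultB (fmult_cst 1) (fmultZ 2^-1 (fmultD m (fmultM m m))).
congr fmult; apply/funext => x; rewrite /ind_le -subr_le0.
have [lt0|gt0|->] := ltgtP (x - y) 0.
- by rewrite (ltr0_sg lt0); field.
- by rewrite (gtr0_sg gt0); field.
- by rewrite sgr0; field.
Qed.

Definition ind_box A x : R := ind_le A x * (1 - ind_le (- A) x).

Lemma fmult_ind_box A : fmult (ind_box A).
Proof.
apply: fmultM; first exact: fmult_ind_le.
by apply: fmultB; [exact: fmult_cst|exact: fmult_ind_le].
Qed.

Lemma ind_boxE A x : ind_box A x = if - A < x <= A then 1 else 0.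
Proof.
rewrite /ind_box /ind_le andbC; case: (x <= A) => /=; last by rewrite mul0r.
by rewrite mul1r leNgt; case: (- A < x); rewrite /= ?subr0 ?subrr.
Qed.

Lemma ind_box_idem A x : ind_box A x * ind_box A x = ind_box A x.
Proof. by rewrite ind_boxE; case: ifPn; rewrite ?mulr1 ?mulr0. Qed.

Lemma ind_box_sqr_le A x : `|ind_box A x * x ^+ 2| <= A ^+ 2.
Proof.
rewrite ind_boxE; case: ifPn => [/andP[xl xr]|_]; last by rewrite mul0r normr0 sqr_ge0.
have xA : `|x| <= A by rewrite ler_norml xr andbT ltW.
rewrite mul1r ger0_norm ?sqr_ge0// -[leLHS]real_normK ?num_real//.
by rewrite ler_sqr ?nnegrE// (le_trans _ xA).
Qed.

Lemma ind_box_le1 A x : `|ind_box A x| <= 1.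
Proof. by rewrite ind_boxE; case: ifPn; rewrite ?normr1 ?normr0. Qed.

Lemma sinc_scaled_cvg x : sinc (n.+1%:R^-1 / 2 * x) ^+ 2 @[n --> \oo] --> (1 : R).
Proof.
have c : sinc (n.+1%:R^-1 / 2 * x) @[n --> \oo] --> (1 : R).
  apply/cvgrPdist_le => e e0; near=> n.
  rewrite distrC (le_trans (sinc_near1 _))//.
  rewrite (_ : _ / 2 * x = (x / 2) / n.+1%:R); last by ring.
  rewrite -[X in `|X|]subr0 distrC; near: n.
  by have /cvgrPdist_le := inv_cvg0 (x / 2); apply.
by rewrite -[X in _ --> X](mulr1 1); under eq_fun do rewrite expr2; exact: cvgM.
Unshelve. all: end_near. Qed.

Lemma sinc_sqr_le1 (u : R) : sinc u ^+ 2 <= 1.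
Proof. by rewrite -real_normK ?num_real// exprn_ile1// sinc_le1. Qed.

Lemma one_sub_cos_scaled s x : s != 0 ->
  2 / s ^+ 2 * (1 - cos (s * x)) = sinc (s / 2 * x) ^+ 2 * x ^+ 2.
Proof. by move=> s0; rewrite -cos_tailM /cos_tail; field. Qed.

Lemma cos_kernel_scaled s x : s != 0 ->
  2 / s ^+ 2 * cos_kernel s x = sinc (s / 2 * x) ^+ 2 * (1 + x ^+ 2).
Proof.
by move=> s0; rewrite cos_kernelE mulrDr one_sub_cos_scaled// /cos_tail; field.
Qed.

Let invS_neq0 n : n.+1%:R^-1 != 0 :> R. Proof. by rewrite invr_neq0. Qed.

Lemma fmult_sqr_ind_box A : fmult (fun x => ind_box A x * x ^+ 2).
Proof.
apply: (@fmult_cvg (fun n x =>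
  ind_box A x * (2 / n.+1%:R^-1 ^+ 2 * (1 - cos (n.+1%:R^-1 * x)))) _ (A ^+ 2)).
- move=> n; apply: fmultM; first exact: fmult_ind_box.
  by apply/fmultZ/fmultB; [exact: fmult_cst|exact: fmult_cos].
- move=> n x; apply: le_trans (ind_box_sqr_le A x); rewrite one_sub_cos_scaled//.
  rewrite mulrCA normrM ler_piMl// ger0_norm ?sqr_ge0//.
  exact: sinc_sqr_le1.
- move=> x; under eq_fun do rewrite one_sub_cos_scaled//.
  apply: cvgM; first exact: cvg_cst.
  by rewrite -[X in _ --> X]mul1r; apply: cvgM; [exact: sinc_scaled_cvg|exact: cvg_cst].
Qed.

Hypothesis cos_kernel_null : forall s, fnull (cos_kernel s).

(** 2/s^2 times the kernel tends to 1 + x^2 as s tends to 0, boundedly on bounded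
    sets. *)
Lemma fnull_ind_box_quad A : fnull (fun x => ind_box A x * (1 + x ^+ 2)).
Proof.
apply: (@fnull_cvg (fun n x =>
  ind_box A x * (2 / n.+1%:R^-1 ^+ 2 * cos_kernel n.+1%:R^-1 x)) _ (1 + A ^+ 2)).
- by move=> n; apply: (fmult_ind_box A).2; exact/fnullZ/cos_kernel_null.
- move=> n x; rewrite cos_kernel_scaled// mulrCA normrM.
  apply: (@le_trans _ _ `|ind_box A x * (1 + x ^+ 2)|).
    by rewrite ler_piMl// ger0_norm ?sqr_ge0// sinc_sqr_le1.
  rewrite mulrDr mulr1 (le_trans (ler_normD _ _))// lerD ?ind_box_le1//.
  exact: ind_box_sqr_le.
- move=> x; under eq_fun do rewrite cos_kernel_scaled//.
  apply: cvgM; first exact: cvg_cst.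
  by rewrite -[X in _ --> X]mul1r; apply: cvgM; [exact: sinc_scaled_cvg|exact: cvg_cst].
Qed.

(** With r = 1 - (1 + x^2)/(1 + A^2), restricted to the interval, the geometric sum
    of the r^k times 1 - r is 1 - r^N and stays in the ideal; r^N tends to 0. This
    divides by the weight 1 + x^2 using only the closure properties. *)
Lemma fnull_ind_box A : fnull (ind_box A).
Proof.
set K := 1 + A ^+ 2; have K0 : 0 < K by rewrite ltr_pwDl// sqr_ge0.
pose r x := ind_box A x * (1 - (1 + x ^+ 2) / K).
have rE x : r x = (1 - K^-1) * ind_box A x - K^-1 * (ind_box A x * x ^+ 2).
  by rewrite /r; field; rewrite gt_eqF.
have mr : fmult r.
  have := fmultB (fmultZ (1 - K^-1) (fmult_ind_box A)) (fmultZ K^-1 (fmult_sqr_ind_box A)).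
  by congr fmult; apply/funext => x; rewrite rE.
have r01 x : 0 <= r x <= 1 - K^-1.
  have K1 : K^-1 <= 1 by rewrite invf_le1// /K lerDl sqr_ge0.
  rewrite /r ind_boxE; case: ifPn => [/andP[xl xr]|_]; last by rewrite mul0r lexx/=; lra.
  have xA0 : `|x| <= A by rewrite ler_norml xr andbT ltW.
  rewrite mul1r; have xA : x ^+ 2 <= A ^+ 2.
    by rewrite -[leLHS]real_normK ?num_real// ler_sqr ?nnegrE// (le_trans _ xA0).
  have : (1 + x ^+ 2) / K <= 1 by rewrite ler_pdivrMr// mul1r /K lerD2l.
  have : K^-1 <= (1 + x ^+ 2) / K.
    rewrite -[leLHS]mul1r; apply: ler_wpM2r; first by rewrite invr_ge0 ltW.
    by rewrite lerDl sqr_ge0.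
  by move=> h1 h2; apply/andP; split; lra.
have q1 : `|1 - K^-1| < 1.
  have K1 : K^-1 <= 1 by rewrite invf_le1// /K lerDl sqr_ge0.
  have : 0 < K^-1 by rewrite invr_gt0.
  by move=> K2; rewrite ger0_norm; lra.
apply: (@fnull_cvg (fun N x => ind_box A x * (1 - r x ^+ N)) _ 2).
- elim=> [|N IH].
    have := fnullZ 0 (cos_kernel_null 0); congr fnull; apply/funext => x.
    by rewrite mul0r expr0 subrr mulr0.
  have mN : fmult (fun x => r x ^+ N).
    elim: N {IH} => [|N IH]; first exact: (fmult_cst 1).
    by have := fmultM mr IH; congr fmult; apply/funext => x; rewrite exprS.
  have := fnullD IH (mN.2 _ (fnullZ K^-1 (fnull_ind_box_quad A))).
  congr fnull; apply/funext => x.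
  have -> : K^-1 * (ind_box A x * (1 + x ^+ 2)) = ind_box A x * (1 - r x).
    rewrite (_ : ind_box A x * (1 - r x) =
      ind_box A x - ind_box A x * ind_box A x * (1 - (1 + x ^+ 2) / K)); last by rewrite /r; ring.
    by rewrite ind_box_idem; field; rewrite gt_eqF.
  by rewrite [r x ^+ N.+1]exprSr; ring.
- move=> N x; have /andP[r0 r1] := r01 x.
  have p0 : 0 <= r x ^+ N by rewrite exprn_ge0.
  have p1 : r x ^+ N <= 1.
    rewrite exprn_ile1// (le_trans r1)//.
    have : 0 < K^-1 by rewrite invr_gt0.
    lra.
  have -> : (2 : R) = 1 * 2 by rewrite mul1r.
  by rewrite normrM ler_pM ?ind_box_le1// ler_norml; lra.
- move=> x; rewrite -[X in _ --> X]mulr1; apply: cvgM; first exact: cvg_cst.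
  rewrite -[X in _ --> X]subr0; apply: cvgB; first exact: cvg_cst.
  apply: cvg_expr; have /andP[r0 r1] := r01 x.
  by apply: le_lt_trans q1; rewrite (ger0_norm r0) (le_trans r1)// ler_norm.
Qed.

Lemma fnull_1 : fnull (fun=> 1).
Proof.
apply: (@fnull_cvg (fun n => ind_box n%:R) _ 1).
- by move=> n; exact: fnull_ind_box.
- by move=> n x; exact: ind_box_le1.
- move=> x; apply/cvgrPdist_le => e e0; near=> n.
  have : `|x| < n%:R by near: n; exact: nbhs_infty_gtr.
  rewrite ltr_norml => /andP[xl /ltW xr].
  by rewrite ind_boxE xl xr subrr normr0 ltW.
Unshelve. all: end_near. Qed.

(** A pair of measures for which all the kernels are null functions is made of two
    equal measures: 1 is a null function, and the indicators of half-lines are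
    multipliers. *)
Lemma fnull_cdf_eq y : m1 `]-oo, y]%classic = m2 `]-oo, y]%classic.
Proof.
have [_ /(_ 0) [h _]] := (fmult_ind_le y).2 _ fnull_1.
have e (m : fmeas) : \int[m]_x ind_le y x = fine (m `]-oo, y]%classic).
  rewrite -Rintegral_indic//; congr Rintegral; apply/funext => x.
  rewrite indicE /ind_le mem_setE in_itv/=.
  by case: (x <= y).
have := h; rewrite (_ : (fun x => _) = ind_le y); last first.
  by apply/funext => x; rewrite mul0r cos0 !mulr1.
rewrite /sint !e => /eqP; rewrite subr_eq0 => /eqP E.
by rewrite -[LHS]fineK ?fin_num_measure// -[RHS]fineK ?fin_num_measure// E.
Qed.

End multiplier_algebra.

(** * Helly selection and vague convergence *)

Section extraction.

Lemma extract_subsequence (P : nat -> nat -> Prop) :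
  (forall k m, exists n, (m <= n)%N /\ P k n) ->
  exists2 phi : nat -> nat, increasing_seq phi & forall k, P k (phi k).
Proof.
move=> H; have /choice[c cP] : forall km : nat * nat, exists n, (km.2 <= n)%N /\ P km.1 n.
  by move=> [k m]; exact: H.
pose phi := fix phi k := if k is k'.+1 then c (k'.+1, (phi k').+1) else c (0%N, 0%N).
exists phi.
  by apply/increasing_seqP => n /=; have [+ _] := cP (n.+1, (phi n).+1).
case=> [|k] /=; first by have [] := cP (0%N, 0%N).
by have [] := cP (k.+1, (phi k).+1).
Qed.

Lemma increasing_seq_ge (phi : nat -> nat) : increasing_seq phi -> forall k, (k <= phi k)%N.
Proof.
move=> /increasing_seqP incr; elim=> // k IH.
by apply: leq_ltn_trans IH _; exact: incr.
Qed.

Lemma increasing_seq_comp (phi psi : nat -> nat) : increasing_seq phi ->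
  increasing_seq psi -> increasing_seq (phi \o psi).
Proof.
by move=> i1 i2 m n /=; rewrite i1; exact: i2.
Qed.

Lemma cvg_subseq (R : realType) (u : nat -> R) (l : R) phi : increasing_seq phi ->
  u n @[n --> \oo] --> l -> u (phi k) @[k --> \oo] --> l.
Proof.
move=> i /cvgrPdist_le cu; apply/cvgrPdist_le => e e0.
have [N _ HN] := cu _ e0; exists N => // k /= Nk; apply: HN => /=.
by apply: leq_trans Nk _; exact: increasing_seq_ge.
Qed.

Lemma cvg_of_subsubseq (R : realType) (u : nat -> R) (l : R) :
  (forall phi, increasing_seq phi -> exists2 psi, increasing_seq psi &
    u (phi (psi k)) @[k --> \oo] --> l) -> u n @[n --> \oo] --> l.
Proof.
move=> H; apply: contrapT => ncv.
have [e e0 He] : exists2 e : R, 0 < e & forall m, exists n, (m <= n)%N /\ e < `|l - u n|.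
  apply: contrapT => ne; apply: ncv; apply/cvgrPdist_le => e e0.
  apply: contrapT => nn; apply: ne; exists e => // m.
  apply: contrapT => nm; apply: nn; exists m => // n /= mn.
  by rewrite leNgt; apply/negP => en; apply: nm; exists n.
have [phi iphi Hphi] := extract_subsequence (P := fun _ n => e < `|l - u n|) (fun _ => He).
have [psi ipsi] := H _ iphi.
move=> /cvgrPdist_le /(_ _ e0)[N _ /(_ N (leqnn N))] /=.
by rewrite leNgt Hphi.
Qed.

End extraction.

Section helly.
Context {R : realType}.
Implicit Types (x y e : R).

Lemma exists_notin_countable (D : set R) (a b : R) : countable D -> a < b ->
  exists x, [/\ a < x, x < b & ~ D x].
Proof.
move=> cD ab; apply: contrapT => nx.
have sub : `]a, b[%classic `<=` D.
  move=> x /=; rewrite in_itv/= => /andP[ax xb].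
  by apply: contrapT => nD; apply: nx; exists x.
have := countable_lebesgue_measure0 (sub_countable (subset_card_le sub) cD).
by rewrite lebesgue_measure_itv/= lte_fin ab => /eqP; rewrite -EFinB eqe subr_eq0 gt_eqF.
Qed.

(** Limits along an ultrafilter exist at all points simultaneously, which replaces
    the diagonal argument in [helly_selection]. *)
Lemma ultra_bounded_cvg (U : set_system nat) (u : nat -> R) C : UltraFilter U ->
  (forall n, 0 <= u n <= C) -> exists p : R, u n @[n --> U] --> p.
Proof.
move=> UU uC.
have FF : ProperFilter (u @ U) by exact: fmap_proper_filter.
have cpt := @segment_compact R 0 C.
have [|p [_ clp]] := cpt _ FF.
  apply: (@filterS _ U _ setT); last exact: filterT.
  by move=> n _ /=; rewrite in_itv/=.
exists p => V Vp.
have [//|nV] := in_ultra_setVsetC (u @^-1` V) UU.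
have [x [/= xV Vx]] := clp (~` V) V nV Vp.
by [].
Qed.

(** An ultrafilter limit p exists at every point; a subsequence is then chosen that
    approximates p on the first k rationals to within 1/(k+1). The limit H is the
    right-continuous version of p, and convergence can only fail at its countably
    many jumps. *)
Theorem helly_selection (u : nat -> R -> R) C :
  (forall n, {homo u n : x y / x <= y}) -> (forall n x, 0 <= u n x <= C) ->
  exists phi : nat -> nat, exists H : R -> R, exists D : set R,
  [/\ increasing_seq phi, {homo H : x y / x <= y}, right_continuous H,
      forall x, 0 <= H x <= C & countable D /\
      forall x, ~ D x -> u (phi k) x @[k --> \oo] --> H x].
Proof.
move=> und uC.
have [U [UU oU]] := @ultraFilterLemma nat \oo _.
have /choice[p pP] : forall x, exists p : R, u n x @[n --> U] --> p.
  by move=> x; apply: (@ultra_bounded_cvg U (u ^~ x) C) => // n; exact: uC.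
have pU x e : 0 < e -> U [set n | `|u n x - p x| <= e].
  move=> e0; have /cvgrPdist_le /(_ _ e0) := pP x.
  by apply: filterS => n /=; rewrite distrC.
have pnd x y : x <= y -> p x <= p y.
  move=> xy; rewrite -subr_ge0.
  have cv : u n y - u n x @[n --> U] --> p y - p x by apply: cvgB; exact: pP.
  by apply: (cvgr_to_ge cv); apply: filterS filterT => n _; rewrite subr_ge0; exact: und.
have pC x : 0 <= p x <= C.
  apply/andP; split; [apply: (cvgr_to_ge (pP x))|apply: (cvgr_to_le (pP x))];
  by apply: filterS filterT => n _; have /andP[] := uC n x.
pose P k n := forall q : rat, (choice.pickle q <= k)%N ->
  `|u n (ratr q) - p (ratr q)| <= k.+1%:R^-1.
have PU k : U (P k).
  have HK K : U [set n | forall q : rat, (choice.pickle q < K)%N ->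
      `|u n (ratr q) - p (ratr q)| <= k.+1%:R^-1].
    elim: K => [|K IH]; first by apply: filterS filterT.
    have e0 : 0 < k.+1%:R^-1 :> R by rewrite invr_gt0.
    case E : (choice.unpickle K : option rat) => [q0|].
      apply: filterS (filterI IH (pU (ratr q0) _ e0)) => n [/= h1 h2] q.
      rewrite ltnS leq_eqVlt => /predU1P[qK|]; last exact: h1.
      by move: E; rewrite -qK choice.pickleK => -[->].
    apply: filterS IH => n h1 q.
    rewrite ltnS leq_eqVlt => /predU1P[qK|]; last exact: h1.
    by move: E; rewrite -qK choice.pickleK.
  by apply: filterS (HK k.+1) => n h q qk; exact: h.
have [phi iphi phiP] : exists2 phi : nat -> nat, increasing_seq phi & forall k, P k (phi k).
  apply: extract_subsequence => k m.
  have mU : U [set n | (m <= n)%N] by apply: oU; exists m.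
  by have [n [/= h1 h2]] := filter_ex (filterI mU (PU k)); exists n.
have cvq (q : rat) : u (phi k) (ratr q) @[k --> \oo] --> p (ratr q).
  apply/cvgrPdist_le => e e0; near=> k.
  rewrite distrC; apply: (@le_trans _ _ k.+1%:R^-1).
    by apply: phiP; near: k; exact: nbhs_infty_ge.
  apply: le_trans (ler_norm _) _; rewrite -[X in `|X|]subr0 distrC; near: k.
  by have /cvgrPdist_le := @cvg_harmonic R; apply.
pose H x := inf [set p y | y in [set y | x < y]].
have lbp x : has_lbound [set p y | y in [set y | x < y]].
  by exists 0 => _ [y _ <-]; have /andP[] := pC y.
have ne x : [set p y | y in [set y | x < y]] !=set0.
  by exists (p (x + 1)); exists (x + 1) => //=; rewrite ltrDl.
have H1 x y : x < y -> H x <= p y by move=> xy; apply: ge_inf => //; exists y.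
have H2 x : p x <= H x.
  by apply: lb_le_inf => // _ [y /= xy <-]; exact/pnd/ltW.
have H3 x e : 0 < e -> exists2 y, x < y & p y <= H x + e.
  move=> e0; have [_ [y xy <-] /ltW] := inf_adherent e0 (conj (ne x) (lbp x)).
  by exists y.
have Hnd : {homo H : x y / x <= y}.
  move=> x y; rewrite le_eqVlt => /predU1P[->//|xy].
  by apply: le_trans (H2 y); exact: H1.
have HC x : 0 <= H x <= C.
  have /andP[p0 _] := pC x; have /andP[_ p1] := pC (x + 1).
  by rewrite (le_trans p0 (H2 x))/= (le_trans _ p1)// H1// ltrDl.
(* The jumps of H, in a form that gives a rational in each jump. *)
pose D := [set x | exists2 e, 0 < e & forall y, y < x -> H y + e <= H x].
exists phi, H, D; split => //.
  move=> x; apply/cvgrPdist_le => e e0; have [y xy py] := H3 x e e0.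
  near=> z.
  have xz : x < z by near: z; exact: nbhs_right_gt.
  have zy : z < y by near: z; exact: nbhs_right_lt.
  have HxHz : H x <= H z by exact/Hnd/ltW.
  rewrite ler0_norm ?subr_le0//.
  by rewrite opprB lerBlDl (le_trans _ py)// H1.
split.
  have /choice[r rP] : forall x, exists r : rat, D x ->
      ratr r < H x /\ forall y, y < x -> H y < ratr r.
    move=> x; have [[e e0 De]|nD] := pselect (D x); last by exists 0.
    have [q] : exists q, ratr q \in `]H x - e, H x[ by apply: rat_in_itvoo; rewrite gtrBl.
    rewrite in_itv/= => /andP[q1 q2]; exists q => _; split => // y /De yx.
    by apply: le_lt_trans q1; rewrite lerBrDr.
  apply/countable_injP; exists (fun x => choice.pickle (r x)) => x y /set_mem Dx /set_mem Dy.
  move=> /(pcan_inj (@choice.pickleK _)) rxy.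
  have [r1 r2] := rP x Dx; have [r3 r4] := rP y Dy.
  have [xy|yx|//] := ltgtP x y.
    by have := r4 _ xy; rewrite -rxy => /lt_trans /(_ r1); rewrite ltxx.
  by have := r2 _ yx; rewrite rxy => /lt_trans /(_ r3); rewrite ltxx.
move=> x nDx; apply/cvgrPdist_le => e e0.
have e20 : 0 < e / 2 by rewrite divr_gt0.
have [y xy py] := H3 x _ e20.
have [q1] := rat_in_itvoo xy; rewrite in_itv/= => /andP[xq1 q1y].
have [z zx Hz] : exists2 z, z < x & H x < H z + e / 2.
  apply: contrapT => nz; apply: nDx; exists (e / 2) => // z zx.
  by rewrite leNgt; apply/negP => Hz; apply: nz; exists z.
have [q2] := rat_in_itvoo zx; rewrite in_itv/= => /andP[zq2 q2x].
have pq1 : p (ratr q1) <= H x + e / 2 by apply: le_trans py; exact/pnd/ltW.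
have pq2 : H z <= p (ratr q2) by exact: H1.
near=> k.
have a1 : `|p (ratr q1) - u (phi k) (ratr q1)| <= e / 2.
  by near: k; have /cvgrPdist_le := cvq q1; apply.
have a2 : `|p (ratr q2) - u (phi k) (ratr q2)| <= e / 2.
  by near: k; have /cvgrPdist_le := cvq q2; apply.
have u1 : u (phi k) x <= u (phi k) (ratr q1) by exact/und/ltW.
have u2 : u (phi k) (ratr q2) <= u (phi k) x by exact/und/ltW.
move: a1 a2; rewrite !ler_norml => /andP[a1 a2] /andP[a3 a4].
apply/andP; split; lra.
Unshelve. all: end_near. Qed.

End helly.

Section vague_convergence.
Context {R : realType}.
Local Notation T := (measurableTypeR R).
Local Notation fmeas := {finite_measure set T -> \bar R}.
Implicit Types (f : R -> R) (e : R).

Lemma C0_uniform_continuity f e : C0 f -> 0 < e ->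
  exists2 d, 0 < d & forall x y, `|x - y| < d -> `|f x - f y| <= e.
Proof.
move=> [cf f0] e0; have e20 : 0 < e / 2 by rewrite divr_gt0.
have [A HA] := f0 _ e20.
(* Outside this interval two points at distance less than 1 both have f small. *)
pose K := `[- A - 1, A + 1]%classic : set R.
have cK : compact K by exact: segment_compact.
have /compact_near_coveringP nK := cK.
have : \forall d \near (0 : R)^'+, K `<=` (fun d x => forall y, `|x - y| < d -> `|f x - f y| <= e) d.
  apply: nK => x Kx.
  have /cvgrPdist_le /(_ _ e20) := cf x.
  move=> /nbhs_ballP[d /= d0 Hd].
  have d20 : 0 < d / 2 by rewrite divr_gt0.
  exists (ball x (d / 2), [set d' | d' < d / 2]).
    split; first exact: nbhsx_ballx.
    exact: nbhs_right_lt.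
  move=> [x' d'] [/= xx' d'd] y x'y.
  have b1 : `|f x - f x'| <= e / 2.
    by apply: Hd; apply: le_ball xx'; rewrite ler_pdivrMr// ler_pMr// ler1n.
  have b2 : `|f x - f y| <= e / 2.
    apply: Hd; rewrite /ball/= (_ : x - y = (x - x') + (x' - y)); last by ring.
    rewrite (le_lt_trans (ler_normD _ _))//.
    by move: xx'; rewrite /ball/= => xx'; have := lt_trans x'y d'd; lra.
  rewrite (_ : f x' - f y = (f x - f y) - (f x - f x')); last by ring.
  by rewrite (le_trans (ler_normB _ _))//; lra.
move=> near_d.
have [d [Hd d0 d1]] : exists d, [/\ K `<=` (fun x => forall y, `|x - y| < d -> `|f x - f y| <= e), 0 < d & d < 1].
  apply: (@filter_ex _ ((0:R)^'+)); near=> d; split.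
  - by near: d.
  - by near: d; exact: nbhs_right_gt.
  - by near: d; exact: nbhs_right_lt.
exists d => // x y xy.
have [xA|xA] := leP `|x| (A + 1).
  by apply: Hd => //; rewrite /K/= in_itv/=; move: xA; rewrite ler_norml opprD.
have yA : A <= `|y|.
  have : `|x| <= `|x - y| + `|y| by rewrite (le_trans _ (ler_normD _ _))// subrK.
  lra.
have fx : `|f x| <= e / 2 by apply: HA; lra.
have fy := HA _ yA.
by rewrite (le_trans (ler_normB _ _))//; lra.
Unshelve. all: end_near. Qed.

(** Mesh smaller than the modulus of uniform continuity; each point can be moved
    within its cell to avoid a countable set. *)
Lemma C0_partition f (D : set R) e : C0 f -> countable D -> 0 < e ->
  exists x : nat -> R, exists N, [/\ forall i, ~ D (x i), forall i, x i <= x i.+1,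
    forall i y, x i < y -> y <= x i.+1 -> `|f y - f (x i)| <= e &
    forall y, y <= x 0%N \/ x N < y -> `|f y| <= e].
Proof.
move=> Cf cD e0; have [d d0 Hd] := C0_uniform_continuity Cf e0.
have [A HA] := Cf.2 _ e0.
pose a i := - `|A| - d + i%:R * (d / 2).
have /choice[x xP] : forall i, exists x, [/\ a i < x, x < a i.+1 & ~ D x].
  move=> i; apply: exists_notin_countable => //.
  by rewrite /a ltrD2l ltr_pM2r ?divr_gt0// ltr_nat.
have aS i : a i.+1 = a i + d / 2 by rewrite /a -natr1; ring.
have [N HN] : exists N : nat, `|A| <= a N.
  exists (Num.bound ((`|A| + `|A| + d) / (d / 2))).
  rewrite /a -lerBlDl opprD !opprK.
  rewrite -ler_pdivrMr ?divr_gt0//.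
  rewrite (_ : `|A| + (`|A| + d) = `|A| + `|A| + d); last by ring.
  by rewrite ltW// archi_boundP// divr_ge0 ?divr_ge0 ?addr_ge0// ltW.
exists x, N; split.
- by move=> i; have [] := xP i.
- by move=> i; have [_ h _] := xP i; have [h' _ _] := xP i.+1; lra.
- move=> i y xy yx; apply: Hd.
  have [h1 h2 _] := xP i; have [h3 h4 _] := xP i.+1.
  rewrite ger0_norm; last lra.
  by rewrite !aS in h2 h4; lra.
- move=> y yx; apply: HA; have [h1 h2 _] := xP 0%N; have [h3 h4 _] := xP N.
  have := ler_norm A.
  have a1 : a 1%N = - `|A| - d + d / 2 by rewrite /a mul1r.
  case: yx => yx.
    have : - y <= `|y| by rewrite -normrN ler_norm.
    by rewrite a1 in h2; lra.
  have : y <= `|y| by rewrite ler_norm.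
  lra.
Qed.

Lemma step_integral (m : fmeas) (g f : R -> R) (x : nat -> R) e N :
  is_cdf m g -> bmf f -> (forall i, x i <= x i.+1) ->
  (forall i y, x i < y -> y <= x i.+1 -> `|f y - f (x i)| <= e) ->
  `|\int[m]_y (f y * \1_(`]x 0%N, x N]%classic) y)
    - \sum_(i < N) f (x i) * (g (x i.+1) - g (x i))| <= e * (g (x N) - g (x 0%N)).
Proof.
move=> mg bf xi fe.
have bI (a b : R) : bmf (\1_(`]a, b]%classic) : R -> R).
  by apply: bmf_indic; exact: measurable_itv.
have IE (a b : R) : a <= b -> \int[m]_y (\1_(`]a, b]%classic) y : R) = g b - g a.
  by move=> ab; rewrite Rintegral_indic// (is_cdf_oc mg ab).
have x0N M : x 0%N <= x M by elim: M => // M IH; apply: (le_trans IH); exact: xi.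
elim: N => [|N IH].
  rewrite big_ord0 !subrr mulr0 subr0 [X in Rintegral _ _ X](_ : _ = fun=> 0).
    by rewrite Rintegral_cst// mul0r normr0.
  by apply/funext => y; rewrite set_itv_ge ?bnd_simp// indicE in_set0 mulr0.
rewrite big_ord_recr/=.
pose I1 : R -> R := \1_(`]x 0%N, x N]%classic).
have bI1 : bmf I1 by exact: bI.
pose I2 : R -> R := \1_(`]x N, x N.+1]%classic).
have bI2 : bmf I2 by exact: bI.
have bk : bmf (fun y => (f y - f (x N)) * I2 y).
  exact: bmfM (bmfB bf (bmf_cst _)) bI2.
have bc : bmf (fun y => f (x N) * I2 y) by exact: bmfM (bmf_cst _) bI2.
have -> : \int[m]_y (f y * \1_(`]x 0%N, x N.+1]%classic) y) =
    \int[m]_y (f y * I1 y) + (f (x N) * (g (x N.+1) - g (x N)) +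
    \int[m]_y ((f y - f (x N)) * I2 y)).
  rewrite -IE// -RintegralZl//; last exact: bmf_integrable.
  rewrite -(RintegralD measurableT (bmf_integrable m bc) (bmf_integrable m bk)).
  rewrite -(RintegralD measurableT (bmf_integrable m (bmfM bf bI1))
    (bmf_integrable m (bmfD bc bk))).
  congr Rintegral; apply/funext => y.
  have -> : \1_(`]x 0%N, x N.+1]%classic) y = I1 y + I2 y :> R.
    rewrite /I1 /I2 !indicE !mem_setE !in_itv/=.
    have [y1|y1] := leP y (x N).
      by rewrite (le_trans y1 (xi N)) /= addr0.
    by rewrite (le_lt_trans (x0N N) y1) /= add0r.
  rewrite -/I2; ring.
have b2 : `|\int[m]_y ((f y - f (x N)) * I2 y)| <= e * (g (x N.+1) - g (x N)).
  apply: (le_trans (le_normr_Rintegral measurableT (bmf_integrable m bk))).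
  rewrite -IE// -RintegralZl//; last exact: bmf_integrable.
  have be : bmf (fun y => e * I2 y) by apply: bmfM => //; exact: bmf_cst.
  apply: le_Rintegral => //.
  - apply: bmf_integrable; have [mk [C kC]] := bk; split.
      exact: measurableT_comp.
    by exists C => y; rewrite normr_id.
  - exact: bmf_integrable.
  - move=> y _; rewrite /I2 indicE mem_setE in_itv/=.
    case: (boolP (_ < _ <= _)) => [/andP[y1 y2]|_]; last by rewrite !mulr0 normr0.
    by rewrite !mulr1 fe.
move: IH b2; rewrite -/I1.
set s := \sum_(i < N) _; set J1 := Rintegral m _ _; set J2 := Rintegral m _ _ => IH b2.
rewrite (_ : _ - _ = (J1 - s) + J2); last by ring.
rewrite (le_trans (ler_normD _ _))//; lra.
Qed.

Lemma C0_step_approx f (D : set R) e : C0 f -> bmf f -> countable D -> 0 < e ->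
  exists x : nat -> R, exists N, (forall i, ~ D (x i)) /\
  forall (m : fmeas) g, is_cdf m g ->
  `|\int[m]_y f y - \sum_(i < N) f (x i) * (g (x i.+1) - g (x i))| <= e * mass m.
Proof.
move=> Cf bf cD e0; have e20 : 0 < e / 2 by rewrite divr_gt0.
have [x [N [xD xi fx fo]]] := C0_partition Cf cD e20.
exists x, N; split => // m g mg.
pose I : R -> R := \1_(`]x 0%N, x N]%classic).
have bI : bmf I by apply: bmf_indic; exact: measurable_itv.
have x0N : x 0%N <= x N by elim: N {fo I bI} => // M IH; apply: (le_trans IH); exact: xi.
have gm : g (x N) - g (x 0%N) <= mass m.
  rewrite -lee_fin -(is_cdf_oc mg x0N) /mass fineK ?fin_num_measure//.
  by apply: le_measure; rewrite ?inE.
have s := step_integral N mg bf xi fx.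
have b1 : bmf (fun y => f y * (1 - I y)).
  by apply: bmfM => //; apply: bmfB => //; exact: bmf_cst.
have o : `|\int[m]_y (f y * (1 - I y))| <= e / 2 * mass m.
  apply: Rintegral_norm_le => // y; rewrite /I indicE mem_setE in_itv/=.
  case: (boolP (_ < _ <= _)) => [_|]; first by rewrite subrr mulr0 normr0 ltW.
  rewrite subr0 mulr1 negb_and -leNgt -ltNge => /orP[h|h]; apply: fo; by [left|right].
have -> : \int[m]_y f y = \int[m]_y (f y * I y) + \int[m]_y (f y * (1 - I y)).
  rewrite -RintegralD//; last 2 first.
    by apply: bmf_integrable; exact: bmfM.
    exact: bmf_integrable.
  by congr Rintegral; apply/funext => y; ring.
rewrite addrAC (le_trans (ler_normD _ _))// [e in leRHS]splitr mulrDl lerD//.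
by rewrite (le_trans s)// ler_wpM2l// ltW.
Qed.

(** f is within a multiple of the mass of a Riemann sum whose nodes avoid D, and the
    Riemann sums converge. *)
Lemma vague_C0 (m_ : nat -> fmeas) (m : fmeas) (g_ : nat -> R -> R) (g : R -> R)
    (D : set R) C f :
  (forall n, is_cdf (m_ n) (g_ n)) -> is_cdf m g -> countable D ->
  (forall x y, ~ D x -> ~ D y -> g_ n y - g_ n x @[n --> \oo] --> g y - g x) ->
  (forall n, mass (m_ n) <= C) -> C0 f -> bmf f ->
  \int[m_ n]_x f x @[n --> \oo] --> \int[m]_x f x.
Proof.
move=> mg_ mg cD cv mC Cf bf; apply/cvgrPdist_le => e e0.
have C0 : 0 <= C by apply: le_trans (mC 0%N); exact: mass_ge0.
pose K := C + mass m + 1.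
have K0 : 0 < K by rewrite /K ltr_wpDl// addr_ge0// mass_ge0.
have e1 : 0 < e / (2 * K) by rewrite divr_gt0// mulr_gt0.
have [x [N [xD H]]] := C0_step_approx Cf bf cD e1.
have cs : \sum_(i < N) f (x i) * (g_ n (x i.+1) - g_ n (x i)) @[n --> \oo] -->
    \sum_(i < N) f (x i) * (g (x i.+1) - g (x i)).
  elim: N {H} => [|N IH].
    by rewrite big_ord0; under eq_fun do rewrite big_ord0; exact: cvg_cst.
  rewrite big_ord_recr/=; under eq_fun do rewrite big_ord_recr/=.
  by apply: cvgD => //; apply: cvgM; [exact: cvg_cst|exact: cv].
near=> n.
have h1 := H _ _ mg; have h2 := H _ _ (mg_ n).
have h3 : `|\sum_(i < N) f (x i) * (g (x i.+1) - g (x i)) -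
  \sum_(i < N) f (x i) * (g_ n (x i.+1) - g_ n (x i))| <= e / 2.
  by near: n; move/cvgrPdist_le : cs; apply; rewrite divr_gt0.
move: h1 h2 h3; set a := Rintegral _ _ _; set b := Rintegral _ _ _.
set s := \sum_(i < N) _; set t := \sum_(i < N) _ => h1 h2 h3.
rewrite (_ : a - b = (a - s) + (s - t) - (b - t)); last by ring.
rewrite (le_trans (ler_normB _ _))//.
have h4 : `|a - s + (s - t)| <= e / (2 * K) * mass m + e / 2.
  by rewrite (le_trans (ler_normD _ _))// lerD.
have h5 : e / (2 * K) * (mass m + mass (m_ n)) <= e / 2.
  apply: (@le_trans _ _ (e / (2 * K) * K)).
    by rewrite ler_wpM2l ?ltW// /K; have := mC n; lra.
  by rewrite le_eqVlt; apply/orP; left; apply/eqP; field; rewrite gt_eqF.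
rewrite mulrDr in h5; lra.
Unshelve. all: end_near. Qed.

End vague_convergence.

(** * Locally uniform convergence of characteristic functions *)

Section characteristic_functions.
Context {R : realType}.
Local Notation T := (measurableTypeR R).
Local Notation fmeas := {finite_measure set T -> \bar R}.
Implicit Types (s t x a b e : R).

Lemma lipschitz1_of_derive (f df : R -> R) : (forall x, is_derive x 1 f (df x)) ->
  (forall x, `|df x| <= 1) -> forall a b, `|f a - f b| <= `|a - b|.
Proof.
move=> fd df1 a b; wlog ab : a b / a <= b.
  move=> H; have [|/ltW ba] := leP a b; first exact: H.
  by rewrite distrC (distrC a); exact: H.
have cf : {within `[a, b], continuous f}.
  apply: continuous_subspaceT => x.
  by apply: differentiable_continuous; apply/derivable1_diffP; apply: ex_derive.
have [c _ E] := MVT_segment ab (fun x _ => fd x) cf.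
by rewrite distrC E normrM (distrC a) ler_piMl.
Qed.

Lemma cos_lipschitz a b : `|cos a - cos b| <= `|a - b|.
Proof.
by apply: (@lipschitz1_of_derive cos (fun x => - sin x)) => x; rewrite normrN sin_max.
Qed.

Lemma sin_lipschitz a b : `|sin a - sin b| <= `|a - b|.
Proof. by apply: (@lipschitz1_of_derive sin cos) => x; rewrite cos_max. Qed.

Definition modulus (d x : R) : R := Num.min 2 (d * `|x|).

Lemma modulus_ge0 d x : 0 <= d -> 0 <= modulus d x.
Proof. by move=> d0; rewrite le_min ler0n mulr_ge0. Qed.

Lemma modulus_le2 d x : modulus d x <= 2.
Proof. by rewrite ge_min lexx. Qed.

Lemma continuous_modulus d : continuous (modulus d).
Proof.
move=> x; apply: (@continuous_min _ _ (fun=> 2) (fun x : R => d * `|x|)).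
  exact: cvg_cst.
by apply: (@continuous_mul _ (fun=> d) Num.norm) => y; [exact: cvg_cst|exact: norm_continuous].
Qed.

Lemma bmf_modulus d : 0 <= d -> bmf (modulus d).
Proof.
move=> d0; apply: (@continuous_bmf _ _ 2); first exact: continuous_modulus.
by move=> x; rewrite ger0_norm ?modulus_ge0 ?modulus_le2.
Qed.

Lemma modulus_integral_cvg0 (m : fmeas) :
  \int[m]_x modulus n.+1%:R^-1 x @[n --> \oo] --> (0 : R).
Proof.
have i0 n : 0 <= n.+1%:R^-1 :> R by rewrite invr_ge0.
have -> : (0 : R) = \int[m]_x 0 by rewrite Rintegral_cst// mul0r.
have [] := @Rintegral_dct _ m (fun n => modulus n.+1%:R^-1) (fun=> 0) 2.
- by move=> n; have [] := bmf_modulus (i0 n).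
- by move=> n x; rewrite ger0_norm ?modulus_ge0 ?modulus_le2.
- move=> x; have v0 : n.+1%:R^-1 * `|x| @[n --> \oo] --> (0 : R).
    by under eq_fun do rewrite mulrC; exact: inv_cvg0.
  apply/cvgrPdist_le => e e0; have /cvgrPdist_le /(_ _ e0) := v0.
  apply: filterS => n; rewrite !sub0r !normrN => h; apply: le_trans h.
  have v1 : 0 <= n.+1%:R^-1 * `|x| by rewrite mulr_ge0.
  rewrite (ger0_norm (modulus_ge0 _ (i0 n))) (ger0_norm v1).
  by rewrite /modulus ge_min lexx orbT.
- by [].
Qed.

Definition charfun_re (F : cumulativeBounded (0 : R) (1 : R)) t : R :=
  \int[lebesgue_stieltjes_measure F]_x cos (t * x).
Definition charfun_im (F : cumulativeBounded (0 : R) (1 : R)) t : R :=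
  \int[lebesgue_stieltjes_measure F]_x sin (t * x).

Definition prob_fmeas (F : cumulativeBounded (0 : R) (1 : R)) : fmeas :=
  [the fmeas of lebesgue_stieltjes_measure F].

Lemma mass_prob F : mass (prob_fmeas F) = 1.
Proof. by rewrite /mass /= probability_setT. Qed.

Lemma charfun_re_le1 F t : `|charfun_re F t| <= 1.
Proof.
have := @Rintegral_norm_le _ (prob_fmeas F) _ 1 (bmf_cos t) (fun x => cos_max _).
by rewrite mass_prob mulr1.
Qed.

Lemma charfun_im_le1 F t : `|charfun_im F t| <= 1.
Proof.
have := @Rintegral_norm_le _ (prob_fmeas F) _ 1 (bmf_sin t) (fun x => sin_max _).
by rewrite mass_prob mulr1.
Qed.

Lemma charfun_re0 F : charfun_re F 0 = 1.
Proof.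
rewrite /charfun_re (_ : (fun x => _) = fun=> 1).
  by rewrite Rintegral_cst// -/(mass (prob_fmeas F)) mass_prob mul1r.
by apply/funext => x; rewrite mul0r cos0.
Qed.

Lemma integral_modulus_bound (m : fmeas) (h : R -> R) s t d :
  (forall a b, `|h a - h b| <= `|a - b|) -> (forall a, `|h a| <= 1) ->
  (forall t, bmf (fun x => h (t * x))) -> 0 <= d -> `|s - t| <= d ->
  `|\int[m]_x h (s * x) - \int[m]_x h (t * x)| <= \int[m]_x modulus d x.
Proof.
move=> hl h1 bh d0 std.
have bk := bmfB (bh s) (bh t).
rewrite -RintegralB//; try exact: bmf_integrable.
have bN := bmfN (bmf_modulus d0).
have H x : `|h (s * x) - h (t * x)| <= modulus d x.
  rewrite le_min; apply/andP; split.
    rewrite (le_trans (ler_normB _ _))//.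
    by have := h1 (s * x); have := h1 (t * x); lra.
  apply: (le_trans (hl _ _)); rewrite -mulrBl normrM.
  by rewrite ler_wpM2r.
rewrite ler_norml; apply/andP; split.
  rewrite lerNl -[leLHS]mulN1r -RintegralZl//; last exact: bmf_integrable.
  apply: le_Rintegral => //.
  - by apply: bmf_integrable; exact: bmfM (bmf_cst _) bk.
  - exact/bmf_integrable/bmf_modulus.
  - by move=> x _; have := H x; rewrite ler_norml => /andP[+ _]; lra.
apply: le_Rintegral => //.
- exact: bmf_integrable.
- exact/bmf_integrable/bmf_modulus.
- by move=> x _; have := H x; rewrite ler_norml => /andP[_].
Qed.

Definition eventually_equicontinuous (u : nat -> R -> R) :=
  forall e, 0 < e -> exists2 d, 0 < d & exists N, forall n, (N <= n)%N ->
    forall s t, `|s - t| <= d -> `|u n s - u n t| <= e.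

(** The increments of f_n are bounded by the integral of [modulus], a single bounded
    continuous function; weak convergence transfers its smallness from F to F_n. *)
Lemma charfun_equicontinuous F_ F : weak_cvg F_ F ->
  eventually_equicontinuous (fun n => charfun_re (F_ n)) /\
  eventually_equicontinuous (fun n => charfun_im (F_ n)).
Proof.
move=> wc.
suff H (h : R -> R) : (forall a b, `|h a - h b| <= `|a - b|) -> (forall a, `|h a| <= 1) ->
    (forall t, bmf (fun x => h (t * x))) ->
    eventually_equicontinuous (fun n t => \int[lebesgue_stieltjes_measure (F_ n)]_x h (t * x)).
  by split; apply: H; [exact: cos_lipschitz|exact: cos_max|exact: bmf_cos|
    exact: sin_lipschitz|exact: sin_max|exact: bmf_sin].
move=> hl h1 bh e e0; have e20 : 0 < e / 2 by rewrite divr_gt0.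
have [k Hk] : exists k : nat, \int[prob_fmeas F]_x modulus k.+1%:R^-1 x <= e / 2.
  have /cvgrPdist_le /(_ _ e20)[k _ /(_ k (leqnn k))] := modulus_integral_cvg0 (prob_fmeas F).
  by rewrite sub0r normrN => /(le_trans (ler_norm _)); exists k.
have d0 : 0 < k.+1%:R^-1 :> R by rewrite invr_gt0.
exists k.+1%:R^-1 => //.
have bm : bounded_fun (modulus k.+1%:R^-1).
  exists 2; split; first by rewrite num_real.
  move=> y y3 x _; apply: le_trans (ltW y3).
  by rewrite ger0_norm ?modulus_ge0 ?modulus_le2// ltW.
have /cvgrPdist_le /(_ _ e20)[N _ HN] := wc _ (@continuous_modulus _) bm.
exists N => n Nn s t st.
apply: (le_trans (integral_modulus_bound (prob_fmeas (F_ n)) hl h1 bh (ltW d0) st)).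
have := HN n Nn; rewrite /= distrC => /(le_trans (ler_norm _)).
by rewrite lerBlDr => /le_trans; apply; rewrite [leRHS]splitr lerD2l.
Qed.

Lemma charfun_cvg F_ F : weak_cvg F_ F -> forall t,
  charfun_re (F_ n) t @[n --> \oo] --> charfun_re F t /\
  charfun_im (F_ n) t @[n --> \oo] --> charfun_im F t.
Proof.
move=> wc t; have b1 (h : R -> R) : (forall x, `|h x| <= 1) -> bounded_fun h.
  move=> h1; exists 1; split; first by rewrite num_real.
  by move=> y y1 x _; apply: le_trans (ltW y1); exact: h1.
split; apply: wc.
- exact: continuous_cosM.
- by apply: b1 => x; exact: cos_max.
- exact: continuous_sinM.
- by apply: b1 => x; exact: sin_max.
Qed.

Lemma locally_uniform_cvg (u : nat -> R -> R) (v : R -> R) :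
  eventually_equicontinuous u -> (forall t, u n t @[n --> \oo] --> v t) ->
  forall K e, 0 < e -> exists N, forall n, (N <= n)%N ->
    forall t, `|t| <= K -> `|u n t - v t| <= e.
Proof.
move=> eq cv K e e0; have e40 : 0 < e / 4 by rewrite divr_gt0.
have [d d0 [N HN]] := eq _ e40.
have veq s t : `|s - t| <= d -> `|v s - v t| <= e / 4.
  move=> st; have c : `|u n s - u n t| @[n --> \oo] --> `|v s - v t|.
    by apply: cvg_norm; apply: cvgB.
  by apply: (cvgr_to_le c); exists N => // n /= Nn; exact: HN.
have cK : compact (`[- K, K]%classic : set R) by exact: segment_compact.
have /compact_near_coveringP nK := cK.
have [M _ HM] : \forall n \near \oo, `[- K, K]%classic `<=` (fun n t => `|u n t - v t| <= e) n.
  apply: nK => t Kt.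
  have /cvgrPdist_le /(_ _ e40)[M _ HM] := cv t.
  exists (ball t d, [set n | (maxn N M <= n)%N]).
    by split; [exact: nbhsx_ballx|exists (maxn N M)].
  move=> [t' n] [/= tt']; rewrite geq_max => /andP[Nn Mn].
  have tt : `|t - t'| <= d by exact: ltW.
  have h1 := HN n Nn _ _ tt; have h2 := veq _ _ tt; have := HM n Mn => /= h3.
  rewrite (_ : u n t' - v t' = (v t - v t') - (v t - u n t) - (u n t - u n t')); last by ring.
  rewrite (le_trans (ler_normB _ _))//.
  have : `|v t - v t' - (v t - u n t)| <= e / 4 + e / 4.
    by rewrite (le_trans (ler_normB _ _))// lerD.
  lra.
by exists M => n Mn t tK; apply: HM => //=; rewrite in_itv/= -ler_norml.
Qed.

End characteristic_functions.

(** * Exponents of characteristic functions *)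

Section exponent_estimates.
Context {R : realType}.
Implicit Types (a b e c r t : R).

Lemma norm_le3_sin (u : R) : `|u| <= 2 -> `|u| <= 3 * `|sin u|.
Proof.
wlog u0 : u / 0 <= u.
  move=> H; have [|/ltW u0] := leP 0 u; first exact: H.
  by have := H (- u); rewrite oppr_ge0 sinN !normrN; exact.
rewrite (ger0_norm u0) => u2.
have h := sin_ge_cubic u0.
have : u ^+ 3 <= 4 * u.
  rewrite exprSr ler_wpM2r// expr2.
  have : u * u <= 2 * 2 by rewrite ler_pM.
  lra.
have := ler_norm (sin u); lra.
Qed.

Lemma expR_sub_ge (a b : R) : expR b * (a - b) <= expR a - expR b.
Proof.
have -> : expR a - expR b = expR b * (expR (a - b) - 1).
  by rewrite mulrBr mulr1 -expRD (_ : b + (a - b) = a)//; ring.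
rewrite ler_wpM2l ?expR_ge0//; have := expR_ge1Dx (a - b); lra.
Qed.

Lemma ln_lipschitz c (a b : R) : 0 < c -> c <= expR a -> c <= expR b ->
  c * `|a - b| <= `|expR a - expR b|.
Proof.
move=> c0 ca cb; wlog ab : a b ca cb / b <= a.
  move=> H; have [|/ltW ba] := leP b a; first exact: H.
  by rewrite distrC (distrC (expR a)); exact: H.
rewrite ger0_norm ?subr_ge0//; apply: le_trans (ler_norm _).
by apply: le_trans (expR_sub_ge a b); rewrite ler_wpM2r ?subr_ge0.
Qed.

(** If two points exp(r1 + i u1) and exp(r2 + i u2) of the square [-1, 1]^2 are
    close and away from 0, then r1 and r2 are close, and u1 and u2 are close modulo 2 pi. *)
Lemma polar_close (x1 y1 x2 y2 r1 u1 r2 u2 c e : R) :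
  x1 = expR r1 * cos u1 -> y1 = expR r1 * sin u1 ->
  x2 = expR r2 * cos u2 -> y2 = expR r2 * sin u2 ->
  `|x1| <= 1 -> `|y1| <= 1 -> `|x2| <= 1 -> `|y2| <= 1 ->
  0 < c -> c <= expR r1 -> c <= expR r2 -> `|x1 - x2| <= e -> `|y1 - y2| <= e ->
  2 * e < c ^+ 2 ->
  [/\ c ^+ 2 * `|r1 - r2| <= 2 * e, 0 < cos (u1 - u2) & c ^+ 2 * `|sin (u1 - u2)| <= 2 * e].
Proof.
move=> ex1 ey1 ex2 ey2 x1le y1le x2le y2le c0 c1 c2 hx hy ec.
have e0 : 0 <= e by rewrite (le_trans _ hx).
have prod_le (p q : R) : `|q| <= 1 -> `|p| <= e -> `|p * q| <= e.
  by move=> q1 pe; rewrite normrM -[e]mulr1 ler_pM.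
have q1 : x1 ^+ 2 + y1 ^+ 2 = expR (r1 + r1).
  by rewrite ex1 ey1 expRD !exprMn -mulrDr cos2Dsin2 mulr1 expr2.
have q2 : x2 ^+ 2 + y2 ^+ 2 = expR (r2 + r2).
  by rewrite ex2 ey2 expRD !exprMn -mulrDr cos2Dsin2 mulr1 expr2.
have cc1 : c ^+ 2 <= expR (r1 + r1) by rewrite expRD expr2 ler_pM// ltW.
have cc2 : c ^+ 2 <= expR (r2 + r2) by rewrite expRD expr2 ler_pM// ltW.
have cc12 : c ^+ 2 <= expR r1 * expR r2 by rewrite expr2 ler_pM// ltW.
have a1 := prod_le _ _ x1le hx; have a2 := prod_le _ _ x2le hx.
have a3 := prod_le _ _ y1le hy; have a4 := prod_le _ _ y2le hy.
have csin : expR r1 * expR r2 * sin (u1 - u2) = (y1 - y2) * x2 - (x1 - x2) * y2.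
  by rewrite sinB ex1 ey1 ex2 ey2; ring.
have ccos : expR r1 * expR r2 * cos (u1 - u2) =
    expR (r2 + r2) + ((x1 - x2) * x2 + (y1 - y2) * y2).
  by rewrite -q2 cosB ex1 ey1 ex2 ey2; ring.
have p0 : 0 < expR r1 * expR r2 by rewrite mulr_gt0 ?expR_gt0.
split.
- have := ln_lipschitz (exprn_gt0 2 c0) cc1 cc2.
  rewrite -q1 -q2.
  rewrite (_ : r1 + r1 - (r2 + r2) = 2 * (r1 - r2)); last by ring.
  rewrite (_ : _ + _ - _ = ((x1 - x2) * x1 + (x1 - x2) * x2) +
     ((y1 - y2) * y1 + (y1 - y2) * y2)); last by ring.
  rewrite normrM (@ger0_norm _ 2)// => h.
  have n1 := ler_normD ((x1 - x2) * x1) ((x1 - x2) * x2).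
  have n2 := ler_normD ((y1 - y2) * y1) ((y1 - y2) * y2).
  have n3 := ler_normD ((x1 - x2) * x1 + (x1 - x2) * x2) ((y1 - y2) * y1 + (y1 - y2) * y2).
  lra.
- rewrite -(pmulr_rgt0 _ p0) ccos.
  move: a2 a4; rewrite !ler_norml => /andP[b1 b2] /andP[b3 b4]; lra.
- apply: (@le_trans _ _ (expR r1 * expR r2 * `|sin (u1 - u2)|)).
    by rewrite ler_wpM2r.
  rewrite -(gtr0_norm p0) -normrM csin (le_trans (ler_normB _ _))//.
  have b2 : `|(y1 - y2) * x2| <= e by exact: prod_le.
  have b1 : `|(x1 - x2) * y2| <= e by exact: prod_le.
  lra.
Qed.

(** By the intermediate value theorem |D| would have to take the value pi/2, where
    the cosine vanishes. *)
Lemma cos_gt0_continuation (D : R -> R) (K : R) : continuous D -> D 0 = 0 ->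
  (forall t, `|t| <= K -> 0 < cos (D t)) -> forall t, `|t| <= K -> `|D t| <= 2.
Proof.
move=> cD D0 cosD t tK; rewrite leNgt; apply/negP => D2.
have cN : continuous (fun s => `|D s|).
  move=> s; apply: (@continuous_comp _ _ _ D Num.norm); first exact: cD.
  exact: norm_continuous.
have p0 : 0 <= pi / 2 :> R by rewrite divr_ge0// pi_ge0.
have p2 : pi / 2 < 2 :> R by exact: pihalf_lt2.
have [c cK Dc] : exists2 c, `|c| <= K & `|D c| = pi / 2.
  have [t0|t0] := leP 0 t.
    have hyp : Num.min `|D 0| `|D t| <= pi / 2 <= Num.max `|D 0| `|D t|.
      by rewrite D0 normr0 min_l// max_r// p0/= ltW// (lt_trans p2).
    have [c] := IVT t0 (continuous_subspaceT cN) hyp.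
    rewrite in_itv/= => /andP[c0 ct] Dc; exists c => //.
    by rewrite ger0_norm// (le_trans ct)// (le_trans (ler_norm _)).
  have hyp : Num.min `|D t| `|D 0| <= pi / 2 <= Num.max `|D t| `|D 0|.
    by rewrite D0 normr0 min_r// max_l// p0/= ltW// (lt_trans p2).
  have [c] := IVT (ltW t0) (continuous_subspaceT cN) hyp.
  rewrite in_itv/= => /andP[c0 ct] Dc; exists c => //.
  by rewrite ler0_norm// (le_trans _ tK)// ltr0_norm// lerN2.
by have := cosD _ cK; rewrite -cos_norm Dc cos_pihalf ltxx.
Qed.

End exponent_estimates.

Section exponents.
Context {R : realType}.
Local Notation T := (measurableTypeR R).
Local Notation fmeas := {finite_measure set T -> \bar R}.
Implicit Types (s t x e h : R) (p q : fmeas).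

(** [rho] and [theta] are the real and imaginary parts of the exponent. *)
Definition rho p q t : R := - sint p q (cos_kernel t).
Definition theta tau p q g t : R := t * g + sint p q (sin_kernel tau t).

Lemma eventually_bounded (u : nat -> R) N C : (forall n, (N <= n)%N -> u n <= C) ->
  exists C', forall n, u n <= C'.
Proof.
elim: N C => [|N IH] C H; first by exists C => n; exact: H.
apply: (IH (Num.max C (u N))) => n.
rewrite leq_eqVlt => /predU1P[<-|Nn]; first by rewrite le_max lexx orbT.
by rewrite le_max H.
Qed.

Lemma continuous_cosMl x : continuous (fun t : R => cos (t * x)).
Proof. by under eq_fun do rewrite mulrC; exact: continuous_cosM. Qed.

Lemma continuous_sinMl x : continuous (fun t : R => sin (t * x)).
Proof. by under eq_fun do rewrite mulrC; exact: continuous_sinM. Qed.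

Lemma continuous_cos_kernel_l x : continuous (fun t : R => cos_kernel t x).
Proof.
rewrite /cos_kernel; case: (x == 0); apply: continuous_mul; try by move=> t; exact: cvg_cst.
  by move=> t; exact: exprn_continuous.
by apply: continuous_sub; [move=> t; exact: cvg_cst|exact: continuous_cosMl].
Qed.

Lemma continuous_sin_kernel_l tau x : continuous (fun t : R => sin_kernel tau t x).
Proof.
rewrite /sin_kernel; case: (x == 0); first by move=> t; exact: cvg_cst.
apply: continuous_mul; last by move=> t; exact: cvg_cst.
apply: continuous_sub; first exact: continuous_sinMl.
apply: (@continuous_mul R (fun t => t / tau) (fun=> sin (tau * x))).
  apply: (@continuous_mul R id (fun=> tau^-1)) => y; [exact: cvg_id|exact: cvg_cst].
by move=> y; exact: cvg_cst.
Qed.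

Lemma continuous_sint_param p q (k : R -> R -> R) (b : R -> R) :
  (forall t, bmf (k t)) -> (forall x, continuous (fun t => k t x)) ->
  (forall B t x, `|t| <= B -> `|k t x| <= b B) ->
  continuous (fun t => sint p q (k t)).
Proof.
move=> bk ck kb t; apply/(@cvg_nbhsP _ R^o) => u ut.
have [B uB] : exists B, forall n, `|u n| <= B.
  have [B [_ HB]] := cvg_seq_bounded (cvgP _ ut).
  by exists (B + 1) => n; apply: (HB (B + 1)) => //; rewrite ltrDl.
apply: (@sint_dct _ _ _ _ _ (b B)).
- by move=> n; have [] := bk (u n).
- by move=> n x; apply: kb.
- by move=> x; exact: (cvg_comp _ _ ut (ck x t)).
Qed.

Lemma continuous_rho p q : continuous (rho p q).
Proof.
move=> t; apply: (@continuousN _ _ _ (fun t => sint p q (cos_kernel t))).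
apply: (@continuous_sint_param p q cos_kernel (fun B => 2 + B ^+ 2 / 2)) => [u|x|B u x uB].
- exact: bmf_cos_kernel.
- exact: continuous_cos_kernel_l.
- rewrite ger0_norm ?cos_kernel_ge0// (le_trans (cos_kernel_le _ _))// lerD2l ler_wpM2r//.
  by rewrite -[leLHS]real_normK ?num_real// ler_sqr ?nnegrE// (le_trans _ uB).
Qed.

Lemma continuous_theta tau p q g : 0 < tau -> continuous (theta tau p q g).
Proof.
move=> tau0; apply: continuous_add.
  by apply: (@continuous_mul R id (fun=> g)) => y; [exact: cvg_id|exact: cvg_cst].
apply: (@continuous_sint_param p q (sin_kernel tau)
  (fun B => (1 + B / tau) + (B ^+ 2 + B * tau))) => [u|x|B u x uB].
- exact: bmf_sin_kernel.
- exact: continuous_sin_kernel_l.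
- rewrite (le_trans (sin_kernel_norm_le _ _ tau0))// !lerD//.
  + by rewrite ler_wpM2r// invr_ge0 ltW.
  + by rewrite -[leLHS]real_normK ?num_real// ler_sqr ?nnegrE// (le_trans _ uB).
  + by rewrite ler_wpM2r// ltW.
Qed.

Lemma theta0 tau p q g : theta tau p q g 0 = 0.
Proof.
rewrite /theta mul0r add0r (_ : sin_kernel tau 0 = fun=> 0) ?sint_cst ?mul0r//.
by apply/funext => x; rewrite /sin_kernel !mul0r sin0; case: ifP; rewrite // subrr mul0r.
Qed.

Lemma rho_diff2 p q t s :
  2 * rho p q t - rho p q (t + s) - rho p q (t - s) =
  2 * sint p q (fun x => cos (t * x) * cos_kernel s x).
Proof.
have b1 := bmf_cos_kernel t; have b2 := bmf_cos_kernel (t + s); have b3 := bmf_cos_kernel (t - s).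
rewrite -sintZ; last by apply: bmfM; [exact: bmf_cos|exact: bmf_cos_kernel].
rewrite (_ : (fun x => 2 * (_ * _)) =
    fun x => cos_kernel (t + s) x + cos_kernel (t - s) x - 2 * cos_kernel t x).
  rewrite sintB ?sintD ?sintZ//; first by rewrite /rho; ring.
    exact: bmfD.
  exact: bmfM (bmf_cst _) _.
by apply/funext => x; rewrite cos_kernel_diff2.
Qed.

Lemma theta_diff2 tau p q g t s : 0 < tau ->
  2 * theta tau p q g t - theta tau p q g (t + s) - theta tau p q g (t - s) =
  2 * sint p q (fun x => sin (t * x) * cos_kernel s x).
Proof.
move=> tau0; have b1 := bmf_sin_kernel t tau0; have b2 := bmf_sin_kernel (t + s) tau0.
have b3 := bmf_sin_kernel (t - s) tau0.
rewrite -sintZ; last by apply: bmfM; [exact: bmf_sin|exact: bmf_cos_kernel].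
rewrite (_ : (fun x => 2 * (_ * _)) =
    fun x => 2 * sin_kernel tau t x - sin_kernel tau (t + s) x - sin_kernel tau (t - s) x).
  rewrite !sintB ?sintZ//; first by rewrite /theta; ring.
    exact: bmfM (bmf_cst _) _.
  by apply: bmfB => //; exact: bmfM (bmf_cst _) _.
by apply/funext => x; rewrite sin_kernel_diff2// gt_eqF.
Qed.

Variables (tau : R) (F_ : nat -> cumulativeBounded (0 : R) (1 : R))
  (F : cumulativeBounded (0 : R) (1 : R)) (p_ q_ : nat -> fmeas) (gam : nat -> R) (C : R).
Hypotheses (tau0 : 0 < tau) (wc : weak_cvg F_ F)
  (fcE : forall n t, charfun_re (F_ n) t =
     expR (rho (p_ n) (q_ n) t) * cos (theta tau (p_ n) (q_ n) (gam n) t))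
  (fsE : forall n t, charfun_im (F_ n) t =
     expR (rho (p_ n) (q_ n) t) * sin (theta tau (p_ n) (q_ n) (gam n) t))
  (qC : forall n, mass (q_ n) <= C).

Let C_ge0 : 0 <= C. Proof. exact: le_trans (mass_ge0 _) (qC 0). Qed.

Lemma sint_le_mass n (k : R -> R) K : bmf k -> (forall x, 0 <= k x <= K) ->
  - (K * C) <= sint (p_ n) (q_ n) k.
Proof.
move=> bk kK; have K0 : 0 <= K by have /andP[h1 h2] := kK 0; exact: le_trans h2.
have h1 : 0 <= \int[p_ n]_x k x by apply: Rintegral_ge0 => x _; have /andP[] := kK x.
have h2 : \int[q_ n]_x k x <= K * mass (q_ n).
  by apply: Rintegral_mass_le => // x; have /andP[] := kK x.
have : K * mass (q_ n) <= K * C by rewrite ler_wpM2l.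
rewrite /sint; lra.
Qed.

(** Only the negative masses are assumed to be bounded. Since f_n is close to 1 near
    0, the signed integrals of the kernels are at most 1 for small s; averaging and
    [cos_kernel_sinc_ge] turn this into a bound on the positive masses. *)
Lemma positive_mass_bounded : exists C', forall n, mass (p_ n) <= C'.
Proof.
have half0 : 0 < 1 / 2 :> R by rewrite divr_gt0.
have [d d0 [N HN]] := (charfun_equicontinuous wc).1 _ half0.
pose h := Num.min d 1.
have h0 : 0 < h by rewrite lt_min d0 ltr01.
have h1 : h <= 1 by rewrite ge_min lexx orbT.
have hd : h <= d by rewrite ge_min lexx.
have cos_kernel1 n s : (N <= n)%N -> `|s| <= h -> sint (p_ n) (q_ n) (cos_kernel s) <= 1.
  move=> Nn sh.
  have : `|s - 0| <= d by rewrite subr0 (le_trans sh).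
  move=> /(HN n Nn); rewrite charfun_re0 ler_norml => /andP[+ _].
  rewrite fcE => fh; rewrite leNgt; apply/negP => k1.
  (* An integral k > 1 would give |f_n| = exp(-k) < 1/2, as exp(k) >= 1 + k. *)
  have e1 := expR_ge1Dx (sint (p_ n) (q_ n) (cos_kernel s)).
  have e2 : expR (rho (p_ n) (q_ n) s) * expR (sint (p_ n) (q_ n) (cos_kernel s)) = 1.
    by rewrite -expRD /rho addNr expR0.
  have e3 : expR (rho (p_ n) (q_ n) s) * cos (theta tau (p_ n) (q_ n) (gam n) s) <=
      expR (rho (p_ n) (q_ n) s).
    by rewrite ler_piMr ?expR_ge0 ?cos_le1.
  have e4 : 1 / 2 <= expR (rho (p_ n) (q_ n) s) by lra.
  have : 1 / 2 * (1 + sint (p_ n) (q_ n) (cos_kernel s)) <=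
      expR (rho (p_ n) (q_ n) s) * expR (sint (p_ n) (q_ n) (cos_kernel s)).
    by rewrite ler_pM//; lra.
  lra.
have sinc1 n : (N <= n)%N -> sint (p_ n) (q_ n) (fun x => 1 - sinc (h * x)) <= 1 + C.
  move=> Nn.
  have -> : (fun x => 1 - sinc (h * x)) = (fun x => 1 * (1 - sinc (h * x))).
    by apply/funext => x; rewrite mul1r.
  apply: (@sint_sinc_le _ _ _ (fun=> 1)); [exact: ltW|exact: bmf_cst|] => s sh.
  have -> : (fun x => 1 * (1 - cos (s * x))) = (fun x => cos_kernel s x - cos_tail s x).
    by apply/funext => x; rewrite mul1r cos_kernelE addrK.
  rewrite sintB; [|exact: bmf_cos_kernel|exact: bmf_cos_tail].
  have k1 := cos_kernel1 n s Nn sh.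
  have s2 : s ^+ 2 / 2 <= 1.
    rewrite -[s ^+ 2]real_normK ?num_real//.
    have : `|s| ^+ 2 <= 1 by rewrite exprn_ile1// (le_trans sh).
    lra.
  have : - (1 * C) <= sint (p_ n) (q_ n) (cos_tail s).
    apply: sint_le_mass => [|x]; first exact: bmf_cos_tail.
    by rewrite cos_tail_ge0 (le_trans (cos_tail_le _ _)).
  lra.
have H3 : 0 < h ^+ 2 / 3 by rewrite divr_gt0// exprn_gt0.
apply: (@eventually_bounded _ N ((2 + C + 5 * C) / (h ^+ 2 / 3))) => n Nn.
rewrite ler_pdivlMr// mulrC.
pose k x := cos_kernel h x + (1 - sinc (h * x)).
have b1 : bmf (fun x => 1 - sinc (h * x)) by apply: bmfB; [exact: bmf_cst|exact: bmf_sincM].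
have bk : bmf k by apply: bmfD => //; exact: bmf_cos_kernel.
have l1 : h ^+ 2 / 3 * mass (p_ n) <= \int[p_ n]_x k x.
  by apply: Rintegral_mass_ge => // x; exact: cos_kernel_sinc_ge.
have l2 : \int[q_ n]_x k x <= 5 * mass (q_ n).
  apply: Rintegral_mass_le => // x; rewrite /k.
  have := cos_kernel_le h x; have := sinc_le1 (h * x); rewrite ler_norml => /andP[s1 _].
  have : h ^+ 2 <= 1 by rewrite exprn_ile1// ltW.
  lra.
have l3 : sint (p_ n) (q_ n) k <= 2 + C.
  rewrite sintD//; last exact: bmf_cos_kernel.
  have := sinc1 n Nn; have := cos_kernel1 n h Nn; rewrite (gtr0_norm h0) lexx => /(_ isT).
  lra.
have : 5 * mass (q_ n) <= 5 * C by rewrite ler_wpM2l.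
move: l3; rewrite /sint; lra.
Qed.

End exponents.

(** * Limits of the exponents and of the spectral measures *)

Section exponent_limits.
Context {R : realType}.
Local Notation T := (measurableTypeR R).
Local Notation fmeas := {finite_measure set T -> \bar R}.
Implicit Types (s t x e h : R).

Lemma real_cauchy_cvg (u : nat -> R) :
  (forall e, 0 < e -> exists N, forall n m, (N <= n)%N -> (N <= m)%N -> `|u n - u m| <= e) ->
  exists l : R, u n @[n --> \oo] --> l.
Proof.
move=> H; apply/cvg_ex; apply: cauchy_cvg; apply: cauchy_exP => e e0.
have e20 : 0 < e / 2 by rewrite divr_gt0.
have [N HN] := H _ e20; exists (u N); exists N => // n /= Nn.
rewrite -ball_normE /ball_/=; apply: le_lt_trans (HN _ _ (leqnn N) Nn) _.
by rewrite ltr_pdivrMr// ltr_pMr// ltr1n.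
Qed.

Variables (tau : R) (F_ : nat -> cumulativeBounded (0 : R) (1 : R))
  (F : cumulativeBounded (0 : R) (1 : R)) (p_ q_ : nat -> fmeas) (gam : nat -> R) (C : R).
Hypotheses (tau0 : 0 < tau) (wc : weak_cvg F_ F).
Local Notation r n := (rho (p_ n) (q_ n)).
Local Notation th n := (theta tau (p_ n) (q_ n) (gam n)).
Hypotheses (fcE : forall n t, charfun_re (F_ n) t = expR (r n t) * cos (th n t))
  (fsE : forall n t, charfun_im (F_ n) t = expR (r n t) * sin (th n t))
  (pC : forall n, mass (p_ n) <= C) (qC : forall n, mass (q_ n) <= C).

Let C_ge0 : 0 <= C. Proof. exact: le_trans (mass_ge0 _) (qC 0). Qed.

Lemma sint_norm_le_mass n (k : R -> R) K : bmf k -> (forall x, `|k x| <= K) ->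
  `|sint (p_ n) (q_ n) k| <= K * (C + C).
Proof.
move=> bk kK; apply: (le_trans (sint_norm_le _ _ bk kK)).
by rewrite ler_wpM2l ?lerD// (le_trans _ (kK 0)).
Qed.

Lemma expR_rho_ge K n t : `|t| <= K -> expR (- ((2 + K ^+ 2 / 2) * C)) <= expR (r n t).
Proof.
move=> tK; rewrite ler_expR /rho lerN2.
have t2 : t ^+ 2 <= K ^+ 2.
  by rewrite -[leLHS]real_normK ?num_real// ler_sqr ?nnegrE// (le_trans _ tK).
have h1 : \int[p_ n]_x cos_kernel t x <= (2 + K ^+ 2 / 2) * mass (p_ n).
  apply: Rintegral_mass_le; first exact: bmf_cos_kernel.
  by move=> x; rewrite (le_trans (cos_kernel_le _ _))// lerD2l ler_wpM2r.
have h2 : 0 <= \int[q_ n]_x cos_kernel t x by apply: Rintegral_ge0 => x _; exact: cos_kernel_ge0.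
have : (2 + K ^+ 2 / 2) * mass (p_ n) <= (2 + K ^+ 2 / 2) * C.
  by rewrite ler_wpM2l// addr_ge0// divr_ge0// sqr_ge0.
rewrite /sint; lra.
Qed.

Lemma dist_le_halves (a b v d : R) : `|a - v| <= d / 2 -> `|b - v| <= d / 2 -> `|a - b| <= d.
Proof.
move=> av bv; rewrite -(subrKA v) -(opprB b v).
by rewrite (le_trans (ler_normB _ _))//; lra.
Qed.

(** The moduli are bounded below on compact sets, so [polar_close] applies to f_n and
    f_m, and [cos_gt0_continuation] removes the ambiguity modulo 2 pi. *)
Lemma exponents_cauchy K e : 0 < e -> exists N, forall n m, (N <= n)%N -> (N <= m)%N ->
  forall t, `|t| <= K -> `|r n t - r m t| <= e /\ `|th n t - th m t| <= e.
Proof.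
move=> e0; (* c bounds both moduli from below on [-K, K]; d absorbs the factors 2 and 3
   of [polar_close] and [norm_le3_sin]. *)
pose c := expR (- ((2 + K ^+ 2 / 2) * C)).
have c0 : 0 < c by exact: expR_gt0.
have c2 : 0 < c ^+ 2 by exact: exprn_gt0.
pose d := Num.min (c ^+ 2 / 4) (c ^+ 2 * e / 6).
have d0 : 0 < d by rewrite lt_min !divr_gt0// mulr_gt0.
have d1 : d <= c ^+ 2 / 4 by rewrite ge_min lexx.
have d2 : d <= c ^+ 2 * e / 6 by rewrite ge_min lexx orbT.
have d20 : 0 < d / 2 by rewrite divr_gt0.
have [eqc eqs] := charfun_equicontinuous wc.
have [Nc HNc] := locally_uniform_cvg eqc (fun t => (charfun_cvg wc t).1) K d20.
have [Ns HNs] := locally_uniform_cvg eqs (fun t => (charfun_cvg wc t).2) K d20.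
exists (maxn Nc Ns) => n m; rewrite !geq_max => /andP[n1 n2] /andP[k1 k2].
have H t : `|t| <= K -> [/\ c ^+ 2 * `|r n t - r m t| <= 2 * d,
    0 < cos (th n t - th m t) & c ^+ 2 * `|sin (th n t - th m t)| <= 2 * d].
  move=> tK; apply: (polar_close (fcE n t) (fsE n t) (fcE m t) (fsE m t)) => //.
  - exact: charfun_re_le1.
  - exact: charfun_im_le1.
  - exact: charfun_re_le1.
  - exact: charfun_im_le1.
  - exact: expR_rho_ge.
  - exact: expR_rho_ge.
  - have := HNc n n1 t tK; have := HNc m k1 t tK => h1 h2.
    exact: dist_le_halves h2 h1.
  - have := HNs n n2 t tK; have := HNs m k2 t tK => h1 h2.
    exact: dist_le_halves h2 h1.
  - lra.
have H2 t : `|t| <= K -> `|th n t - th m t| <= 2.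
  apply: (@cos_gt0_continuation _ (fun t => th n t - th m t)).
  - by apply: continuous_sub; exact: continuous_theta.
  - by rewrite !theta0 subrr.
  - by move=> u /H[].
move=> t tK; have [h1 _ h3] := H t tK.
split; rewrite -(ler_pM2l c2); first by lra.
have h4 : c ^+ 2 * `|th n t - th m t| <= c ^+ 2 * (3 * `|sin (th n t - th m t)|).
  by rewrite ler_pM2l// norm_le3_sin// H2.
lra.
Qed.

Lemma exponents_cvg : exists rl tl : R -> R,
  forall t, r n t @[n --> \oo] --> rl t /\ th n t @[n --> \oo] --> tl t.
Proof.
have /choice[rl rlP] : forall t, exists l : R, r n t @[n --> \oo] --> l.
  move=> t; apply: real_cauchy_cvg => e e0.
  have [N HN] := exponents_cauchy `|t| e0; exists N => n m Nn Nm.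
  by have [] := HN n m Nn Nm t (lexx _).
have /choice[tl tlP] : forall t, exists l : R, th n t @[n --> \oo] --> l.
  move=> t; apply: real_cauchy_cvg => e e0.
  have [N HN] := exponents_cauchy `|t| e0; exists N => n m Nn Nm.
  by have [] := HN n m Nn Nm t (lexx _).
by exists rl, tl.
Qed.

Lemma exponents_equicontinuous t e : 0 < e -> exists2 d, 0 < d & exists N,
  forall n, (N <= n)%N -> forall s, `|s| <= d ->
  `|r n (t + s) - r n t| <= e /\ `|th n (t + s) - th n t| <= e.
Proof.
move=> e0; have e30 : 0 < e / 3 by rewrite divr_gt0.
have [N HN] := exponents_cauchy (`|t| + 1) e30.
have ct (f : R -> R) : continuous f ->
    exists2 d, 0 < d & forall s, `|s| <= d -> `|f (t + s) - f t| <= e / 3.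
  move=> cf; have /cvgrPdist_le /(_ _ e30) := cf t.
  move=> /nbhs_ballP[d /= d0 Hd].
  exists (d / 2); first by rewrite divr_gt0.
  move=> s sd; rewrite distrC; apply: Hd; rewrite -ball_normE /ball_/=.
  rewrite opprD addNKr normrN; apply: le_lt_trans sd _.
  by rewrite ltr_pdivrMr// ltr_pMr// ltr1n.
have [d1 d10 Hd1] := ct _ (@continuous_rho _ (p_ N) (q_ N)).
have [d2 d20 Hd2] := ct _ (@continuous_theta _ tau (p_ N) (q_ N) (gam N) tau0).
exists (Num.min 1 (Num.min d1 d2)); first by rewrite !lt_min ltr01 d10 d20.
exists N => n Nn s; rewrite !le_min => /and3P[s1 sd1 sd2].
have tK : `|t| <= `|t| + 1 by rewrite lerDl.
have tsK : `|t + s| <= `|t| + 1 by rewrite (le_trans (ler_normD _ _))// lerD2l.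
have [a1 a2] := HN n N Nn (leqnn N) t tK.
have [b1 b2] := HN n N Nn (leqnn N) (t + s) tsK.
have c1 := Hd1 s sd1; have c2 := Hd2 s sd2.
split.
  rewrite (_ : _ - _ = (r n (t + s) - r N (t + s)) + (r N (t + s) - r N t)
     - (r n t - r N t)); last by ring.
  rewrite (le_trans (ler_normB _ _))//.
  have := ler_normD (r n (t + s) - r N (t + s)) (r N (t + s) - r N t).
  lra.
rewrite (_ : _ - _ = (th n (t + s) - th N (t + s)) + (th N (t + s) - th N t)
   - (th n t - th N t)); last by ring.
rewrite (le_trans (ler_normB _ _))//.
have := ler_normD (th n (t + s) - th N (t + s)) (th N (t + s) - th N t).
lra.
Qed.

(** The second difference of the exponents at t bounds the integrals of
    e(x)(1 - cos sx) for all small s, up to the tail, which is of size s^2; averaging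
    over s gives the statement. It says that the spectral measures have no
    uncontrolled oscillating mass at infinity. *)
Lemma sint_sinc_small t e : 0 < e -> exists2 d, 0 < d & exists N,
  forall n, (N <= n)%N -> forall h, 0 <= h -> h <= d ->
  `|sint (p_ n) (q_ n) (fun x => cos (t * x) * (1 - sinc (h * x)))| <= e /\
  `|sint (p_ n) (q_ n) (fun x => sin (t * x) * (1 - sinc (h * x)))| <= e.
Proof.
move=> e0; have e20 : 0 < e / 2 by rewrite divr_gt0.
have [d d0 [N HN]] := exponents_equicontinuous t e20.
(* The last bound makes the contribution s^2 C of [cos_tail] at most e/2. *)
pose d' := Num.min d (Num.min 1 (e / 2 / (C + 1))).
have C1 : 0 < C + 1 by rewrite ltr_wpDl.
exists d'; first by rewrite !lt_min d0 ltr01 divr_gt0.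
exists N => n Nn h h0 hd'.
have main (k : R -> R) s : `|s| <= h -> (forall x, `|k x| <= 1) -> bmf k ->
    `|sint (p_ n) (q_ n) (fun x => k x * cos_kernel s x)| <= e / 2 ->
    `|sint (p_ n) (q_ n) (fun x => k x * (1 - cos (s * x)))| <= e.
  move=> sh k1 bk H.
  have -> : (fun x => k x * (1 - cos (s * x))) = (fun x => k x * cos_kernel s x - k x * cos_tail s x).
    by apply/funext => x; rewrite cos_kernelE; ring.
  rewrite sintB; [|exact: bmfM bk (bmf_cos_kernel s)|exact: bmfM bk (bmf_cos_tail s)].
  rewrite (le_trans (ler_normB _ _))//.
  have : `|sint (p_ n) (q_ n) (fun x => k x * cos_tail s x)| <= s ^+ 2 / 2 * (C + C).
    apply: sint_norm_le_mass; first exact: bmfM bk (bmf_cos_tail s).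
    move=> x; rewrite normrM -[leRHS]mul1r ler_pM// ger0_norm ?cos_tail_ge0//.
    exact: cos_tail_le.
  move: (le_trans sh hd'); rewrite /d' !le_min => /and3P[_ s1 sC].
  have : `|s| * (C + 1) <= e / 2 by rewrite -ler_pdivlMr.
  have : s ^+ 2 <= `|s|.
    by rewrite -real_normK ?num_real// expr2 ler_piMr.
  move=> s2 sC1.
  have : s ^+ 2 * C <= `|s| * (C + 1).
    by rewrite ler_pM ?sqr_ge0// lerDl.
  lra.
have dd s : `|s| <= h -> `|s| <= d.
  by move=> sh; apply: le_trans sh (le_trans hd' _); rewrite /d' ge_min lexx.
split; apply: sint_sinc_norm_le => //.
- exact: bmf_cos.
- move=> s sh; apply: main => //; [by move=> x; exact: cos_max|exact: bmf_cos|].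
  have [a1 _] := HN n Nn s (dd s sh).
  have ns : `|- s| <= d by rewrite normrN; exact: dd.
  have [b1 _] := HN n Nn _ ns.
  have := rho_diff2 (p_ n) (q_ n) t s.
  move: a1 b1; rewrite !ler_norml => /andP[a1 a2] /andP[b1 b2] D.
  by apply/andP; split; lra.
- exact: bmf_sin.
- move=> s sh; apply: main => //; [by move=> x; exact: sin_max|exact: bmf_sin|].
  have [_ a1] := HN n Nn s (dd s sh).
  have ns : `|- s| <= d by rewrite normrN; exact: dd.
  have [_ b1] := HN n Nn _ ns.
  have := @theta_diff2 _ tau (p_ n) (q_ n) (gam n) t s tau0.
  move: a1 b1; rewrite !ler_norml => /andP[a1 a2] /andP[b1 b2] D.
  by apply/andP; split; lra.
Qed.

Section subsequence.
Variables (psi : nat -> nat) (p q : fmeas).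
Hypotheses (ipsi : increasing_seq psi)
  (vp : forall f, C0 f -> bmf f -> \int[p_ (psi k)]_x f x @[k --> \oo] --> \int[p]_x f x)
  (vq : forall f, C0 f -> bmf f -> \int[q_ (psi k)]_x f x @[k --> \oo] --> \int[q]_x f x).

Lemma sint_C0_cvg f : C0 f -> bmf f ->
  sint (p_ (psi k)) (q_ (psi k)) f @[k --> \oo] --> sint p q f.
Proof. by move=> Cf bf; apply: cvgB; [exact: vp|exact: vq]. Qed.

(** e(x) = e(x) sinc(hx) + e(x)(1 - sinc(hx)): the first part vanishes at infinity
    and the second is uniformly small. Vague convergence alone would not suffice,
    since mass may escape in both measures. *)
Lemma sint_trig_cvg t :
  sint (p_ (psi k)) (q_ (psi k)) (fun x => cos (t * x)) @[k --> \oo] -->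
    sint p q (fun x => cos (t * x)) /\
  sint (p_ (psi k)) (q_ (psi k)) (fun x => sin (t * x)) @[k --> \oo] -->
    sint p q (fun x => sin (t * x)).
Proof.
suff main (k : R -> R) : continuous k -> (forall x, `|k x| <= 1) ->
    (forall e, 0 < e -> exists2 d, 0 < d & exists N, forall n, (N <= n)%N ->
       forall h, 0 <= h -> h <= d ->
       `|sint (p_ n) (q_ n) (fun x => k x * (1 - sinc (h * x)))| <= e) ->
    sint (p_ (psi i)) (q_ (psi i)) k @[i --> \oo] --> sint p q k.
  split; apply: main => [|x|e /(sint_sinc_small t)[d d0 [N HN]]].
  - exact: continuous_cosM.
  - exact: cos_max.
  - by exists d => //; exists N => n Nn h h0 hd; have [] := HN n Nn h h0 hd.
  - exact: continuous_sinM.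
  - exact: sin_max.
  - by exists d => //; exists N => n Nn h h0 hd; have [] := HN n Nn h h0 hd.
move=> ck k1 H; have bk := continuous_bmf ck k1.
apply/cvgrPdist_le => e e0; have e30 : 0 < e / 3 by rewrite divr_gt0.
have [d d0 [N HN]] := H _ e30.
have b1 h : bmf (fun x => k x * (1 - sinc (h * x))).
  by apply: bmfM => //; apply: bmfB; [exact: bmf_cst|exact: bmf_sincM].
have [h [h0 hd Hh]] : exists h, [/\ 0 < h, h <= d &
    `|sint p q (fun x => k x * (1 - sinc (h * x)))| <= e / 3].
  have cv : sint p q (fun x => k x * (1 - sinc (d / i.+1%:R * x))) @[i --> \oo] -->
      sint p q (fun=> 0).
    apply: (@sint_dct _ _ _ _ _ (1 * 2)).
    - by move=> i; have [] := b1 (d / i.+1%:R).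
    - move=> i x; rewrite normrM ler_pM// (le_trans (ler_normB _ _))// normr1.
      by have := sinc_le1 (d / i.+1%:R * x); lra.
    - move=> x; have z : k x * (1 - 1) = 0 by rewrite subrr mulr0.
      rewrite -[X in _ --> X]z; apply: cvgM; first exact: cvg_cst.
      apply: cvgB; first exact: cvg_cst.
      have := inv_cvg0 (d * x) => cz.
      apply/cvgrPdist_le => e' e'0; have /cvgrPdist_le /(_ _ e'0) := cz.
      apply: filterS => i; rewrite sub0r normrN distrC => h'.
      apply: (le_trans (sinc_near1 _)); apply: le_trans h'.
      by rewrite mulrAC.
  rewrite sint_cst mul0r in cv.
  have /cvgrPdist_le /(_ _ e30)[i _ /(_ i (leqnn i))] := cv.
  rewrite /= sub0r normrN => Hi; exists (d / i.+1%:R); split => //.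
    by rewrite divr_gt0.
  by rewrite ler_pdivrMr// -[leLHS]mulr1 ler_wpM2l ?ler1n// ltW.
have Cs : C0 (fun x => k x * sinc (h * x)) by exact: C0_sincM.
have bs : bmf (fun x => k x * sinc (h * x)) by apply: bmfM => //; exact: bmf_sincM.
have split_k (p' q' : fmeas) : sint p' q' k =
    sint p' q' (fun x => k x * sinc (h * x)) + sint p' q' (fun x => k x * (1 - sinc (h * x))).
  by rewrite -sintD//; congr sint; apply/funext => x; ring.
near=> i.
have i1 : `|sint p q (fun x => k x * sinc (h * x)) -
    sint (p_ (psi i)) (q_ (psi i)) (fun x => k x * sinc (h * x))| <= e / 3.
  by near: i; have /cvgrPdist_le := sint_C0_cvg Cs bs; apply.
have Ni : (N <= psi i)%N.
  apply: leq_trans (increasing_seq_ge ipsi i).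
  by near: i; exact: nbhs_infty_ge.
have i2 := HN _ Ni h (ltW h0) hd.
rewrite (split_k p q) (split_k (p_ (psi i))).
move: i1 i2 Hh; set a := sint _ _ _; set b := sint _ _ _; set a' := sint _ _ _; set b' := sint _ _ _.
move=> i1 i2 Hh.
rewrite (_ : _ - _ = (a - b) + b' - a'); last by ring.
rewrite (le_trans (ler_normB _ _))//; have := ler_normD (a - b) b'; lra.
Unshelve. all: end_near. Qed.

Lemma mass_diff_cvg :
  mass (p_ (psi k)) - mass (q_ (psi k)) @[k --> \oo] --> mass p - mass q.
Proof.
have [c _] := sint_trig_cvg 0.
have E (p' q' : fmeas) : sint p' q' (fun x => cos (0 * x)) = mass p' - mass q'.
  rewrite (_ : (fun x => _) = fun=> 1) ?sint_cst ?mul1r//.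
  by apply/funext => x; rewrite mul0r cos0.
by move: c; rewrite E; under eq_fun do rewrite E.
Qed.

Lemma sint_cos_kernel_cvg t : sint (p_ (psi k)) (q_ (psi k)) (cos_kernel t) @[k --> \oo] -->
  sint p q (cos_kernel t).
Proof.
have E (p' q' : fmeas) : sint p' q' (cos_kernel t) =
    (mass p' - mass q') - sint p' q' (fun x => cos (t * x)) + sint p' q' (cos_tail t).
  have -> : cos_kernel t = (fun x => (1 - cos (t * x)) + cos_tail t x).
    by apply/funext => x; rewrite cos_kernelE.
  rewrite sintD; [|exact: bmf_1cos|exact: bmf_cos_tail].
  rewrite sintB; [|exact: bmf_cst|exact: bmf_cos].
  by rewrite sint_cst mul1r.
rewrite E; under eq_fun do rewrite E.
apply: cvgD; last by apply: sint_C0_cvg; [exact: C0_cos_tail|exact: bmf_cos_tail].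
by apply: cvgB; [exact: mass_diff_cvg|have [] := sint_trig_cvg t].
Qed.

Lemma sint_sin_kernel_cvg t : sint (p_ (psi k)) (q_ (psi k)) (sin_kernel tau t) @[k --> \oo] -->
  sint p q (sin_kernel tau t).
Proof.
have E (p' q' : fmeas) : sint p' q' (sin_kernel tau t) =
    sint p' q' (fun x => sin (t * x)) - t / tau * sint p' q' (fun x => sin (tau * x))
    + sint p' q' (sin_tail tau t).
  have -> : sin_kernel tau t = (fun x => (sin (t * x) - t / tau * sin (tau * x)) + sin_tail tau t x).
    by apply/funext => x; rewrite sin_kernelE.
  have b2 : bmf (fun x => t / tau * sin (tau * x)) by exact: bmfM (bmf_cst _) (bmf_sin tau).
  rewrite sintD; [|exact: bmfB (bmf_sin t) b2|exact: bmf_sin_tail].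
  by rewrite sintB ?sintZ//; exact: bmf_sin.
rewrite E; under eq_fun do rewrite E.
apply: cvgD; last by apply: sint_C0_cvg; [exact: C0_sin_tail|exact: bmf_sin_tail].
apply: cvgB; first by have [] := sint_trig_cvg t.
by apply: cvgM; [exact: cvg_cst|have [] := sint_trig_cvg tau].
Qed.

(** The value at t = 1 isolates the drift. *)
Lemma exponents_limitE (rl tl : R -> R) :
  (forall t, r n t @[n --> \oo] --> rl t /\ th n t @[n --> \oo] --> tl t) ->
  exists g : R, [/\ gam (psi k) @[k --> \oo] --> g,
    forall t, rl t = rho p q t & forall t, tl t = theta tau p q g t].
Proof.
move=> lim; pose g := tl 1 - sint p q (sin_kernel tau 1).
have cg : gam (psi k) @[k --> \oo] --> g.
  have -> : (fun k => gam (psi k)) =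
      (fun k => th (psi k) 1 - sint (p_ (psi k)) (q_ (psi k)) (sin_kernel tau 1)).
    by apply/funext => k; rewrite /theta mul1r addrK.
  apply: cvgB; last exact: sint_sin_kernel_cvg.
  exact: (cvg_subseq ipsi (lim 1).2).
exists g; split => // t.
- apply: (cvg_unique _ (cvg_subseq ipsi (lim t).1)) => //.
  by apply: cvgN; exact: sint_cos_kernel_cvg.
- apply: (cvg_unique _ (cvg_subseq ipsi (lim t).2)) => //.
  by apply: cvgD; [apply: cvgM; [exact: cvg_cst|exact: cg]|exact: sint_sin_kernel_cvg].
Qed.

End subsequence.

End exponent_limits.

(** * Uniqueness of the spectral pair *)

Section uniqueness.
Context {R : realType}.
Local Notation T := (measurableTypeR R).
Local Notation fmeas := {finite_measure set T -> \bar R}.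
Implicit Types (p q : fmeas).

Definition fadd p q := measure_add p q.

HB.instance Definition _ p q := Measure.on (fadd p q).

Lemma fadd_fin_num p q : fin_num_fun (fadd p q).
Proof. by move=> A mA; rewrite /fadd measure_addE fin_numD !fin_num_measure. Qed.

HB.instance Definition _ p q :=
  @Measure_isFinite.Build _ T R (fadd p q) (fadd_fin_num p q).

Lemma Rintegral_fadd p q h : bmf h ->
  \int[[the fmeas of fadd p q]]_x h x = \int[p]_x h x + \int[q]_x h x.
Proof.
move=> bh; have ih (m : fmeas) := bmf_integrable m bh.
apply: EFin_inj; rewrite EFinD /Rintegral !fineK;
  try exact/integrable_fin_num/bmf_integrable.
exact: (integral_measure_add measurableT (ih p) (ih q)).
Qed.

(** Equal exponents have equal second differences, hence the kernels are null
    functions of the difference of the two signed measures. *)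
Lemma exponents_injective tau g g' (p q p' q' : fmeas) : 0 < tau ->
  (forall t, rho p q t = rho p' q' t) ->
  (forall t, theta tau p q g t = theta tau p' q' g' t) ->
  forall y, (p `]-oo, y]%classic + q' `]-oo, y]%classic
           = p' `]-oo, y]%classic + q `]-oo, y]%classic)%E.
Proof.
move=> tau0 er et y.
pose m1 : fmeas := [the fmeas of fadd p q']; pose m2 : fmeas := [the fmeas of fadd p' q].
have E h : bmf h -> sint m1 m2 h = sint p q h - sint p' q' h.
  by move=> bh; rewrite /sint !Rintegral_fadd//; ring.
have null s : fnull m1 m2 (cos_kernel s).
  split; first exact: bmf_cos_kernel.
  move=> t; split.
    rewrite E; last by apply: bmfM; [exact: bmf_cos_kernel|exact: bmf_cos].
    have := rho_diff2 p q t s; have := rho_diff2 p' q' t s; rewrite !er.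
    rewrite (_ : (fun x => cos_kernel s x * cos (t * x)) =
      fun x => cos (t * x) * cos_kernel s x); first by lra.
    by apply/funext => x; rewrite mulrC.
  rewrite E; last by apply: bmfM; [exact: bmf_cos_kernel|exact: bmf_sin].
  have := theta_diff2 p q g t s tau0; have := theta_diff2 p' q' g' t s tau0; rewrite !et.
  rewrite (_ : (fun x => cos_kernel s x * sin (t * x)) =
    fun x => sin (t * x) * cos_kernel s x); first by lra.
  by apply/funext => x; rewrite mulrC.
have := fnull_cdf_eq null y; rewrite /m1 /m2 /= /fadd.
by rewrite !measure_addE.
Qed.

End uniqueness.

(** * Total variation and subsequential limits *)

Section variation.
Context {R : realType}.
Local Notation T := (measurableTypeR R).
Local Notation fmeas := {finite_measure set T -> \bar R}.
Implicit Types (p q : fmeas) (G g : R -> R).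

Lemma limn_esup_le (u : nat -> \bar R) c N : (forall n, (N <= n)%N -> (u n <= c)%E) ->
  (limn_esup u <= c)%E.
Proof.
move=> uc; rewrite limn_esup_lim; apply: lime_le; first exact: is_cvg_esups.
exists N => // n Nn; apply: ge_ereal_sup => _ [k /= nk <-].
by apply: uc; exact: leq_trans nk.
Qed.

Lemma limn_esup_lt_near (u : nat -> \bar R) c : (limn_esup u < c)%E ->
  exists N, forall n, (N <= n)%N -> (u n <= c)%E.
Proof.
rewrite limn_esup_lim (cvg_lim _ (@cvg_esups_inf R u))// => /ereal_inf_lt[_ [N _ <-] Nc].
exists N => n Nn; apply: le_trans (ltW Nc).
by apply: ereal_sup_ubound; exists n.
Qed.

Lemma limn_esup_ge0 (u : nat -> \bar R) : (forall n, 0 <= u n)%E -> (0 <= limn_esup u)%E.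
Proof.
move=> u0; rewrite limn_esup_lim; apply: lime_ge; first exact: is_cvg_esups.
apply: nearW => n; apply: (le_trans (u0 n)).
by apply: ereal_sup_ubound; exists n => /=.
Qed.

Lemma variation_norm_ge0 G : (0 <= variation_norm G)%E.
Proof.
apply: (@le_trans _ _ (total_variation 0 0 G)); first exact: total_variation_ge0.
by apply: ereal_sup_ubound; exists 0, 0.
Qed.

Lemma variation_norm_le_mass p q g1 g2 : is_cdf p g1 -> is_cdf q g2 ->
  (variation_norm (fun x => (g1 x - g2 x)%R) <= (mass p + mass q)%:E)%E.
Proof.
move=> c1 c2; apply: ge_ereal_sup => _ [a [b [ab ->]]].
apply: (le_trans (total_variation_le g1 (\- g2) ab)).
rewrite total_variationN EFinD.
have H (m : fmeas) g : is_cdf m g -> (total_variation a b g <= (mass m)%:E)%E.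
  move=> mg; rewrite nondecreasing_total_variation//; last first.
    by move=> x y _ _; exact: (is_cdf_nd mg).
  rewrite -(is_cdf_oc mg ab) /mass fineK ?fin_num_measure//.
  by apply: le_measure; rewrite ?inE.
by apply: leeD; exact: H.
Qed.

Lemma sum_le_total_variation f (x : nat -> R) N : (forall i, (i < N)%N -> x i <= x i.+1) ->
  x 0%N <= x N /\
  ((\sum_(i < N) `|f (x i.+1) - f (x i)|)%:E <= total_variation (x 0%N) (x N) f)%E.
Proof.
elim: N => [|N IH] xi; first by rewrite big_ord0 total_variationxx.
have [i Ni|x0N sN] := IH; first by apply: xi; exact: ltnW.
have xN := xi N (ltnSn N).
split; first exact: le_trans xN.
rewrite (total_variationD f x0N xN) big_ord_recr/= EFinD leeD//.
exact: total_variation_ge.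
Qed.

(** A partition is moved to the right, off D; right-continuity makes the error
    arbitrarily small, and on the new points the variations converge. *)
Lemma variation_norm_lsc (G_ : nat -> R -> R) G (psi : nat -> nat) (D : set R) (B : R) :
  right_continuous G -> increasing_seq psi -> countable D ->
  (forall x y, ~ D x -> ~ D y ->
     G_ (psi k) y - G_ (psi k) x @[k --> \oo] --> G y - G x) ->
  (limn_esup (fun n => variation_norm (G_ n)) <= B%:E)%E ->
  (variation_norm G <= B%:E)%E.
Proof.
move=> rc ipsi cD cv GB; apply: ge_ereal_sup => _ [a [b [ab ->]]].
apply: ge_ereal_sup => _ [_ [s [sp slast] <-] <-].
set N := size s; pose x i := nth b (a :: s) i.
have -> : variation a b G s = \sum_(i < N) `|G (x i.+1) - G (x i)|.
  by rewrite /variation big_mkord.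
have xS i : (i < N)%N -> x i < x i.+1.
  by move=> iN; have /(pathP b) := sp; apply.
rewrite lee_fin; apply/ler_addgt0Pr => e e0.
pose d := e / 4 / N.+1%:R.
have d0 : 0 < d by rewrite !divr_gt0.
have /choice[x' x'P] : forall i, exists x', [/\ ~ D x', x i < x',
    `|G x' - G (x i)| <= d & (i < N)%N -> x' < x i.+1].
  move=> i; have /cvgrPdist_le /(_ _ d0) := rc (x i).
  move=> /nbhs_ballP[r /= r0 Hr].
  have [z [z1 z2 z3]] : exists z, [/\ x i < z, z <= x i + r & (i < N)%N -> z <= x i.+1].
    have [iN|Ni] := ltnP i N; last by exists (x i + r); split => //; rewrite ltrDl.
    exists (Num.min (x i + r) (x i.+1)); split => [||_].
    - by rewrite lt_min ltrDl r0 xS.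
    - by rewrite ge_min lexx.
    - by rewrite ge_min lexx orbT.
  have [w [w1 w2 wD]] := exists_notin_countable cD z1.
  exists w; split => // [|iN]; last exact: lt_le_trans (z3 iN).
  rewrite distrC; apply: Hr => //; rewrite -ball_normE /ball_/= distrC.
  by rewrite gtr0_norm ?subr_gt0// ltrBlDl (lt_le_trans w2).
have x'S i : (i < N)%N -> x' i <= x' i.+1.
  move=> iN; have [_ _ _ h] := x'P i; have [_ h' _ _] := x'P i.+1.
  by rewrite ltW// (lt_trans (h iN)).
have sum_lim L : \sum_(i < L) `|G_ (psi k) (x' i.+1) - G_ (psi k) (x' i)| @[k --> \oo] -->
    \sum_(i < L) `|G (x' i.+1) - G (x' i)|.
  elim: L => [|L IH].
    by rewrite big_ord0; under eq_fun do rewrite big_ord0; exact: cvg_cst.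
  rewrite big_ord_recr/=; under eq_fun do rewrite big_ord_recr/=.
  have [nD1 _ _ _] := x'P L; have [nD2 _ _ _] := x'P L.+1.
  by apply: cvgD => //; apply: cvg_norm; exact: cv.
have e20 : 0 < e / 2 by rewrite divr_gt0.
have [M HM] : exists M, forall n, (M <= n)%N -> (variation_norm (G_ n) <= (B + e / 2)%:E)%E.
  by apply: limn_esup_lt_near; apply: le_lt_trans GB _; rewrite lte_fin ltrDl.
have s1 : \sum_(i < N) `|G (x' i.+1) - G (x' i)| <= B + e / 2.
  apply: (cvgr_to_le (sum_lim N)); exists M => // k /= Mk.
  have [x0N sN] := sum_le_total_variation (G_ (psi k)) x'S.
  rewrite -lee_fin (le_trans sN)//; apply: le_trans (HM (psi k) _).
    by apply: ereal_sup_ubound; exists (x' 0%N), (x' N).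
  by apply: leq_trans Mk _; exact: increasing_seq_ge.
have s2 : \sum_(i < N) `|G (x i.+1) - G (x i)| <=
    \sum_(i < N) (`|G (x' i.+1) - G (x' i)| + 2 * d).
  apply: ler_sum => i _.
  have [_ _ h1 _] := x'P i; have [_ _ h2 _] := x'P i.+1.
  rewrite (_ : G (x i.+1) - G (x i) = (G (x' i.+1) - G (x' i))
    - (G (x' i.+1) - G (x i.+1)) + (G (x' i) - G (x i))); last by ring.
  rewrite (le_trans (ler_normD _ _))//.
  have := ler_normB (G (x' i.+1) - G (x' i)) (G (x' i.+1) - G (x i.+1)).
  lra.
have s3 : \sum_(i < N) (2 * d) <= e / 2.
  rewrite sumr_const card_ord -[leLHS]mulr_natr.
  apply: (@le_trans _ _ (2 * d * N.+1%:R)).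
    by rewrite ler_wpM2l ?ler_nat// mulr_ge0// ltW.
  rewrite /d le_eqVlt; apply/orP; left; apply/eqP; field.
  by rewrite gt_eqF// ltr_pwDl.
move: s2; rewrite big_split/=; lra.
Qed.

(** The mass that escapes to the left is subtracted from the Helly limit, so that the
    result vanishes at -oo; increments are not affected. *)
Lemma helly_cdf (m_ : nat -> fmeas) (g_ : nat -> R -> R) C :
  (forall n, is_cdf (m_ n) (g_ n)) -> (forall n, mass (m_ n) <= C) ->
  exists phi m g (D : set R), [/\ increasing_seq phi, is_cdf m g, classV g, countable D &
    forall x y, ~ D x -> ~ D y ->
      g_ (phi k) y - g_ (phi k) x @[k --> \oo] --> g y - g x].
Proof.
move=> mg mC.
have gC n x : 0 <= g_ n x <= C.
  apply/andP; split; first by rewrite -lee_fin -mg measure_ge0.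
  apply: le_trans (mC n); rewrite -lee_fin -mg /mass fineK ?fin_num_measure//.
  by apply: le_measure; rewrite ?inE.
have [phi [H [D [iphi Hnd Hrc HC [cD cv]]]]] :=
  helly_selection (fun n => is_cdf_nd (mg n)) gC.
pose l := inf (range H); pose g x := H x - l.
have hlb : has_lbound (range H) by exists 0 => _ [x _ <-]; have /andP[] := HC x.
have lH x : l <= H x by apply: ge_inf => //; exists x.
have gnd : {homo g : x y / x <= y} by move=> x y xy; rewrite /g lerD2r Hnd.
have gV : classV g.
  split.
  - apply: (@le_lt_trans _ _ C%:E); last exact: ltry.
    apply: ge_ereal_sup => _ [a [b [ab ->]]].
    rewrite nondecreasing_total_variation//; last by move=> x y _ _; exact: gnd.
    have /andP[h1 _] := HC a; have /andP[_ h2] := HC b.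
    by rewrite lee_fin /g; lra.
  - by move=> x; apply: cvgB; [exact: Hrc|exact: cvg_cst].
  - apply/cvgrPdist_le => e e0.
    have [_ [y _ <-] /ltW Hy] := inf_adherent e0 (conj (ex_intro _ (H 0) (ex_intro2 _ _ 0 I erefl)) hlb).
    exists y; split; first by rewrite num_real.
    move=> x /ltW /Hnd xy; rewrite sub0r normrN ger0_norm ?subr_ge0//.
    by rewrite /g lerBlDl (le_trans xy).
have [m mgg] := exists_cdf gV gnd.
exists phi, m, g, D; split => // x y Dx Dy.
have -> : g y - g x = H y - H x by rewrite /g; lra.
by apply: cvgB; exact: cv.
Qed.

Lemma classV_diff p q g1 g2 : is_cdf p g1 -> is_cdf q g2 -> classV g1 -> classV g2 ->
  classV (fun x => g1 x - g2 x).
Proof.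
move=> c1 c2 [_ rc1 l1] [_ rc2 l2]; split.
- by apply: le_lt_trans (variation_norm_le_mass c1 c2) _; exact: ltry.
- by move=> x; apply: cvgB; [exact: rc1|exact: rc2].
- by rewrite -[X in _ --> X](subrr (0 : R)); exact: cvgB.
Qed.

Lemma limy_diff p q g1 g2 : is_cdf p g1 -> is_cdf q g2 ->
  limy (fun x => g1 x - g2 x) = mass p - mass q.
Proof.
move=> c1 c2; have [l1 <-] := is_cdf_limy c1; have [l2 <-] := is_cdf_limy c2.
by apply: cvg_lim => //; exact: cvgB.
Qed.

End variation.

(** * Spectral pairs in terms of exponents *)

Section spectral_pairs.
Context {R : realType}.
Local Notation T := (measurableTypeR R).
Local Notation fmeas := {finite_measure set T -> \bar R}.

Lemma charge_Cintegral_spectral_kernel (tau t : R) (p q : fmeas) g1 g2 nu : 0 < tau ->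
  is_cdf p g1 -> is_cdf q g2 ->
  is_stieltjes_charge (fun x => g1 x - g2 x) nu ->
  charge_Cintegral nu (spectral_kernel tau t) =
  (rho p q t +i* sint p q (sin_kernel tau t))%C.
Proof.
move=> tau0 c1 c2 nuG.
have eR : (fun x => complex.Re (spectral_kernel tau t x)) = (fun x => - cos_kernel t x).
  by apply/funext => x; rewrite spectral_kernelE.
have eI : (fun x => complex.Im (spectral_kernel tau t x)) = sin_kernel tau t.
  by apply/funext => x; rewrite spectral_kernelE.
rewrite (charge_CintegralE c1 c2 nuG) ?eR ?eI.
- by rewrite sintN //; exact: bmf_cos_kernel.
- by apply: bmfN; exact: bmf_cos_kernel.
- exact: bmf_sin_kernel.
Qed.

(** The charge and its Hahn decomposition disappear from the definition. *)
Lemma spectral_pairP (tau gamma : R) (F : cumulativeBounded (0 : R) (1 : R))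
    (p q : fmeas) g1 g2 : 0 < tau -> is_cdf p g1 -> is_cdf q g2 ->
  classV (fun x => g1 x - g2 x) ->
  spectral_pair tau F gamma (fun x => g1 x - g2 x) <->
  forall t, charfun_re F t = expR (rho p q t) * cos (theta tau p q gamma t) /\
            charfun_im F t = expR (rho p q t) * sin (theta tau p q gamma t).
Proof.
move=> tau0 c1 c2 GV.
have E nu t : is_stieltjes_charge (fun x => g1 x - g2 x) nu ->
    expC (((t * gamma)%:C * 'i + charge_Cintegral nu (spectral_kernel tau t))%C) =
    ((expR (rho p q t) * cos (theta tau p q gamma t)) +i*
     (expR (rho p q t) * sin (theta tau p q gamma t)))%C.
  by move=> nuG; rewrite (charge_Cintegral_spectral_kernel t tau0 c1 c2 nuG) expCE.
split=> [[_ [nu nuG H]] t|H].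
  by have := H t; rewrite E// charfunE => -[].
split=> //; have [nu nuG] := stieltjes_charge_exists c1 c2.
by exists nu => // t; rewrite E// charfunE -/(charfun_re F t) -/(charfun_im F t); have [-> ->] := H t.
Qed.

End spectral_pairs.

Theorem theorem6 (R : realType) (tau : R) (tau_gt0 : 0 < tau)
    (F_ : nat -> cumulativeBounded (0 : R) (1 : R))
    (gamma_ : nat -> R) (G_ : nat -> R -> R)
    (F_spectral : forall n, spectral_pair tau (F_ n) (gamma_ n) (G_ n))
    (Gp Gm : nat -> R -> R)
    (GpV : forall n, classV (Gp n))
    (GmV : forall n, classV (Gm n))
    (Gp_nd : forall n, {homo Gp n : x y / x <= y})
    (Gm_nd : forall n, {homo Gm n : x y / x <= y})
    (G_decomp : forall n x, G_ n x = Gp n x - Gm n x)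
    (M : R) (M_ge0 : 0 <= M)
    (Gm_limsup : limn_esup (fun n => (limy (Gm n))%:E) = M%:E)
    (F : cumulativeBounded (0 : R) (1 : R))
    (F_weak : weak_cvg F_ F) :
  exists B : R,
    [/\ 0 <= B,
        limn_esup (fun n => variation_norm (G_ n)) = B%:E &
        exists (gamma : R) (G : R -> R),
          [/\ spectral_pair tau F gamma G,
              (variation_norm G <= B%:E)%E,
              gamma_ n @[n --> \oo] --> gamma,
              basic_cvg G_ G &
              limy (G_ n) @[n --> \oo] --> limy G /\ B <= limy G + 2 * M]].
Proof.
have /choice[p_ pP] : forall n, exists m : {finite_measure set (measurableTypeR R) -> \bar R},
    is_cdf m (Gp n) by move=> n; exact: exists_cdf.
have /choice[q_ qP] : forall n, exists m : {finite_measure set (measurableTypeR R) -> \bar R},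
    is_cdf m (Gm n) by move=> n; exact: exists_cdf.
have GE n : G_ n = (fun x => Gp n x - Gm n x) by apply/funext => x; exact: G_decomp.
have qE n : limy (Gm n) = mass (q_ n) by have [] := is_cdf_limy (qP n).
have GlE n : limy (G_ n) = mass (p_ n) - mass (q_ n) by rewrite GE; exact: limy_diff.
have exps n t : charfun_re (F_ n) t = expR (rho (p_ n) (q_ n) t) *
      cos (theta tau (p_ n) (q_ n) (gamma_ n) t) /\
    charfun_im (F_ n) t = expR (rho (p_ n) (q_ n) t) *
      sin (theta tau (p_ n) (q_ n) (gamma_ n) t).
  have := F_spectral n; have [GV _] := F_spectral n; rewrite GE in GV *.
  by move/(spectral_pairP (gamma_ n) (F_ n) tau_gt0 (pP n) (qP n) GV).
have fcE n t := (exps n t).1; have fsE n t := (exps n t).2.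
have qM e : 0 < e -> exists N, forall n, (N <= n)%N -> mass (q_ n) <= M + e.
  move=> e0; have [|N HN] := @limn_esup_lt_near R (fun n => (limy (Gm n))%:E) (M + e)%:E.
    by rewrite Gm_limsup lte_fin ltrDl.
  by exists N => n Nn; rewrite -qE -lee_fin; exact: HN.
have [C1 qC1] : exists C, forall n, mass (q_ n) <= C.
  have [N HN] := qM _ ltr01; exact: eventually_bounded HN.
have [C2 pC2] := positive_mass_bounded F_weak fcE qC1.
pose C := Num.max C1 C2.
have qC n : mass (q_ n) <= C by rewrite (le_trans (qC1 n))// le_max lexx.
have pC n : mass (p_ n) <= C by rewrite (le_trans (pC2 n))// le_max lexx orbT.
have [rl [tl lim]] := exponents_cvg tau_gt0 F_weak fcE fsE pC.
have key (phi : nat -> nat) : increasing_seq phi -> exists psi p q gp gm g (D : set R),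
    [/\ increasing_seq psi, is_cdf p gp /\ is_cdf q gm, classV gp /\ classV gm,
        countable D /\ (forall x y, ~ D x -> ~ D y ->
          G_ (phi (psi k)) y - G_ (phi (psi k)) x @[k --> \oo] -->
          (gp y - gm y) - (gp x - gm x)) &
        [/\ gamma_ (phi (psi k)) @[k --> \oo] --> g,
            limy (G_ (phi (psi k))) @[k --> \oo] --> mass p - mass q,
            forall t, rl t = rho p q t & forall t, tl t = theta tau p q g t]].
  move=> iphi.
  have [psi1 [p [gp [D1 [i1 cp Vp cD1 cv1]]]]] :=
    helly_cdf (fun n => pP (phi n)) (fun n => pC (phi n)).
  have [psi2 [q [gm [D2 [i2 cq Vq cD2 cv2]]]]] :=
    helly_cdf (fun n => qP (phi (psi1 n))) (fun n => qC (phi (psi1 n))).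
  pose psi k := psi1 (psi2 k).
  have ipsi : increasing_seq psi by exact: increasing_seq_comp.
  have iall : increasing_seq (phi \o psi) by exact: increasing_seq_comp.
  have cv1' x y : ~ D1 x -> ~ D1 y ->
      Gp (phi (psi k)) y - Gp (phi (psi k)) x @[k --> \oo] --> gp y - gp x.
    by move=> Dx Dy; exact: (cvg_subseq i2 (cv1 x y Dx Dy)).
  have vp f : C0 f -> bmf f -> \int[p_ ((phi \o psi) k)]_x f x @[k --> \oo] --> \int[p]_x f x.
    exact: (vague_C0 (fun k => pP (phi (psi k))) cp cD1 cv1' (fun k => pC (phi (psi k)))).
  have vq f : C0 f -> bmf f -> \int[q_ ((phi \o psi) k)]_x f x @[k --> \oo] --> \int[q]_x f x.
    exact: (vague_C0 (fun k => qP (phi (psi k))) cq cD2 cv2 (fun k => qC (phi (psi k)))).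
  have [g [cg rE tE]] :=
    exponents_limitE tau_gt0 F_weak fcE fsE pC qC iall vp vq lim.
  exists psi, p, q, gp, gm, g, (D1 `|` D2); split => //.
    split.
      rewrite -bigcup2E; apply: bigcup_countable; first exact: countableP.
      by move=> [|[|i]] _.
    move=> x y /not_orP[D1x D2x] /not_orP[D1y D2y].
    have -> : gp y - gm y - (gp x - gm x) = (gp y - gp x) - (gm y - gm x) by ring.
    have -> : (fun k => G_ (phi (psi k)) y - G_ (phi (psi k)) x) = (fun k =>
        (Gp (phi (psi k)) y - Gp (phi (psi k)) x) - (Gm (phi (psi k)) y - Gm (phi (psi k)) x)).
      by apply/funext => k; rewrite !G_decomp; ring.
    by apply: cvgB; [exact: cv1'|exact: cv2].
  split => //.
  have -> : (fun k => limy (G_ (phi (psi k)))) =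
      (fun k => mass (p_ ((phi \o psi) k)) - mass (q_ ((phi \o psi) k))).
    by apply/funext => k; rewrite GlE.
  exact: (mass_diff_cvg tau_gt0 F_weak fcE fsE pC qC iall vp vq).
have [psi0 [p [q [gp [gm [g [D0 [i0 [cp cq] [Vp Vq] [cD0 cv0] [_ _ rE tE]]]]]]]]] :=
  key id (fun m n => erefl).
pose G x := gp x - gm x.
have GV : classV G by exact: classV_diff Vp Vq.
have GlimE : limy G = mass p - mass q by exact: limy_diff.
(* All subsequential limits have the exponents rl and tl, so injectivity of the
     exponents identifies them; convergence along the whole sequence follows. *)
have uniq p' q' gp' gm' g' : is_cdf p' gp' -> is_cdf q' gm' ->
    (forall t, rl t = rho p' q' t) -> (forall t, tl t = theta tau p' q' g' t) ->
    (forall x, gp' x - gm' x = G x) /\ mass p' - mass q' = mass p - mass q /\ g' = g.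
  move=> cp' cq' rE' tE'.
  have GG x : gp' x - gm' x = G x.
    have := @exponents_injective R tau g g' p q p' q' tau_gt0
      (fun t => etrans (esym (rE t)) (rE' t)) (fun t => etrans (esym (tE t)) (tE' t)) x.
    by rewrite cp cq cp' cq' -!EFinD => -[]; rewrite /G; lra.
  split=> //; split.
    by rewrite -(limy_diff cp' cq') -GlimE; congr limy; exact/funext.
  have b := bmf_sin_kernel 1 tau_gt0.
  have E : sint p' q' (sin_kernel tau 1) = sint p q (sin_kernel tau 1).
    apply: sint_eq_ocitv => // a c ac.
    rewrite (is_cdf_oc cp')// (is_cdf_oc cq)// (is_cdf_oc cp)// (is_cdf_oc cq')//.
    rewrite -!EFinD; congr EFin; have := GG a; have := GG c; rewrite /G; lra.
  by have := tE 1; rewrite tE' /theta E !mul1r => /addIr.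
have cvgl : limy (G_ n) @[n --> \oo] --> limy G.
  rewrite GlimE; apply: cvg_of_subsubseq => phi iphi.
  have [psi [p' [q' [gp' [gm' [g' [D [ipsi [cp' cq'] _ _ [_ cl rE' tE']]]]]]]]] := key phi iphi.
  by have [_ [<- _]] := uniq _ _ _ _ _ cp' cq' rE' tE'; exists psi.
have TVn n : (variation_norm (G_ n) <= (limy (G_ n) + 2 * mass (q_ n))%:E)%E.
  rewrite GlE GE; apply: le_trans (variation_norm_le_mass (pP n) (qP n)) _.
  by rewrite lee_fin; lra.
have TVlim : (limn_esup (fun n => variation_norm (G_ n)) <= (limy G + 2 * M)%:E)%E.
  apply/lee_addgt0Pr => e e0.
  have e30 : 0 < e / 3 by rewrite divr_gt0.
  have [N1 HN1] := qM _ e30.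
  have /cvgrPdist_le /(_ _ e30)[N2 _ HN2] := cvgl.
  apply: (@limn_esup_le _ _ _ (maxn N1 N2)) => n; rewrite geq_max => /andP[n1 n2].
  apply: (le_trans (TVn n)); rewrite -EFinD lee_fin.
  have := HN1 n n1; have := HN2 n n2; rewrite /= ler_norml => /andP[h1 h2]; lra.
have TV0 : (0 <= limn_esup (fun n => variation_norm (G_ n)))%E.
  by apply: limn_esup_ge0 => n; exact: variation_norm_ge0.
have [B BE] : exists B : R, limn_esup (fun n => variation_norm (G_ n)) = B%:E.
  move: TVlim TV0; case: (limn_esup _) => [B|//|//] _ _; by exists B.
exists B; split => //.
  by rewrite -lee_fin -BE.
exists g, G; split.
- apply/(spectral_pairP g F tau_gt0 cp cq GV) => t.
  have [cc cs] := charfun_cvg F_weak t.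
  have [lr lt] := lim t; rewrite -rE -tE.
  have ce : expR (rho (p_ n) (q_ n) t) @[n --> \oo] --> expR (rl t).
    by apply: continuous_cvg => //; exact: continuous_expR.
  rewrite (funext (fcE ^~ t)) in cc; rewrite (funext (fsE ^~ t)) in cs.
  split.
    apply: (cvg_unique _ cc) => //.
    by apply: cvgM => //; apply: continuous_cvg => //; exact: continuous_cos.
  apply: (cvg_unique _ cs) => //.
  by apply: cvgM => //; apply: continuous_cvg => //; exact: continuous_sin.
- apply: (@variation_norm_lsc _ G_ G psi0 D0) => //; last by rewrite BE.
  by have [] := GV.
- apply: cvg_of_subsubseq => phi iphi.
  have [psi [p' [q' [gp' [gm' [g' [D [ipsi [cp' cq'] _ _ [cg _ rE' tE']]]]]]]]] := key phi iphi.
  by have [_ [_ <-]] := uniq _ _ _ _ _ cp' cq' rE' tE'; exists psi.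
- move=> phi iphi.
  have [psi [p' [q' [gp' [gm' [g' [D [ipsi [cp' cq'] _ [cD cv] [_ _ rE' tE']]]]]]]]] := key phi iphi.
  have [GG _] := uniq _ _ _ _ _ cp' cq' rE' tE'.
  exists psi => //; exists D => // x1 x2 D1 D2; rewrite -!GG; exact: cv.
- by split => //; rewrite -lee_fin -BE.
Qed.
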